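(* For the stochastic multisymplectic system $$M_{\alpha\beta}\,dz^\beta+K^i_{\alpha\beta}z^\beta_{,i}\,dt+\widetilde K^i_{\alpha\beta}z^\beta_{,i}\circ dW_t=\frac{\partial H}{\partial z^\alpha}\,dt+\frac{\partial \widetilde H}{\partial z^\alpha}\circ dW_t,\qquad \alpha=1,\dots,m,$$ the structural conservation law $$d\,\mathbf d\big(L^0_\alpha\,\mathbf d z^\alpha\big)+\mathbf d\big(L^i_\alpha\,\mathbf d z^\alpha\,dt+\widetilde L^i_\alpha\,\mathbf d z^\alpha\circ dW_t\big)_{,i}=0$$ holds. In terms of the exact $2$-forms $$\omega=\mathbf d(L^0_\alpha\,\mathbf d z^\alpha)=\tfrac12M_{\alpha\beta}\,\mathbf d z^\alpha\wedge\mathbf d z^\beta,\quad \kappa^i=\mathbf d(L^i_\alpha\,\mathbf d z^\alpha)=\tfrac12K^i_{\alpha\beta}\,\mathbf d z^\alpha\wedge\mathbf d z^\beta,\quad \widetilde\kappa^i=\mathbf d(\widetilde L^i_\alpha\,\mathbf d z^\alpha)=\tfrac12\widetilde K^i_{\alpha\beta}\,\mathbf d z^\alpha\wedge\mathbf d z^\beta,$$ it can be written as $$d\omega+\kappa^i_{,i}\,dt+\widetilde\kappa^i_{,i}\circ dW_t=0 .$$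
   Context: Let $x=(x^1,\dots,x^n)$ be the spatial coordinates and $t$ time; a subscript ${}_{,i}$ denotes the total derivative with respect to $x^i$. Repeated spatial indices are summed over $1,\dots,n$ (time excluded) and repeated Greek indices over $1,\dots,m$. Let $W$ be a one-dimensional Brownian motion on a probability space; all components of the dependent variable $z=(z^1,\dots,z^m)$ are adapted to the filtration generated by $W$. The symbol $d$ (not bold) is the stochastic time increment, and $\circ\,dW_t$ denotes stochastic integration in the Stratonovich sense, so that the standard product and chain rules apply. The bold symbol $\mathbf d$ is the exterior derivative in the dependent variables $z^\alpha$ (and their derivatives), as opposed to the time increment $d$. The law is obtained formally, by taking the exterior derivative $\mathbf d$ of the $1$-form quasi-conservation law $d(L^0_\alpha\mathbf d z^\alpha)+(L^i_\alpha\mathbf d z^\alpha\,dt+\widetilde L^i_\alpha\mathbf d z^\alpha\circ dW_t)_{,i}=\mathbf d(L^0_\alpha dz^\alpha+L^i_\alpha z^\alpha_{,i}\,dt+\widetilde L^i_\alpha z^\alpha_{,i}\circ dW_t-H\,dt-\widetilde H\circ dW_t)$. $L^0_\alpha(z),\ L^i_\alpha(z),\ \widetilde L^i_\alpha(z),\ H(z),\ \widetilde H(z)$ are given functions of $z$ ($i=1,\dots,n$, $\alpha=1,\dots,m$), and $$M_{\alpha\beta}=\frac{\partial L^0_\beta}{\partial z^\alpha}-\frac{\partial L^0_\alpha}{\partial z^\beta},\quad K^i_{\alpha\beta}=\frac{\partial L^i_\beta}{\partial z^\alpha}-\frac{\partial L^i_\alpha}{\partial z^\beta},\quad \widetilde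 K^i_{\alpha\beta}=\frac{\partial \widetilde L^i_\beta}{\partial z^\alpha}-\frac{\partial \widetilde L^i_\alpha}{\partial z^\beta}$$ are skew-symmetric. *)

(* Defs.v *)
From mathcomp Require Import all_boot all_order all_algebra.
From mathcomp Require Import all_classical all_reals all_analysis.

Set Implicit Arguments.
Unset Strict Implicit.
Unset Printing Implicit Defensive.

Import Order.TTheory GRing.Theory Num.Theory.
Import numFieldNormedType.Exports.

Local Open Scope classical_set_scope.
Local Open Scope ring_scope.

Section Forms.
Context {R : realType} {m : nat}.
Implicit Types (f : 'rV[R]_m -> R) (L : 'I_m -> 'rV[R]_m -> R).

Definition partial (a : 'I_m) f : 'rV[R]_m -> R :=
  fun z => 'D_(delta_mx 0 a) f z.

Fixpoint Ck (k : nat) f : Prop :=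
  match k with
  | 0%N => continuous f
  | k'.+1 => (forall z, differentiable f z) /\ forall a, Ck k' (partial a f)
  end.

Definition smooth f := forall k, Ck k f.

(* A 1-form, resp. 2-form, on the space of dependent variables: its value at
   z on one, resp. two, tangent vectors. *)
Definition form1 := 'rV[R]_m -> 'rV[R]_m -> R.
Definition form2 := 'rV[R]_m -> 'rV[R]_m -> 'rV[R]_m -> R.

Definition extd0 f : form1 := fun z u => 'D_u f z.

Definition dz (a : 'I_m) : form1 := extd0 (fun z => z 0 a).

(* (d theta)(u, v) = u(theta(v)) - v(theta(u)) for constant vector fields
   u and v, whose Lie bracket vanishes. *)
Definition extd1 (theta : form1) : form2 := fun z u v =>
  'D_u (fun y => theta y v) z - 'D_v (fun y => theta y u) z.

Definition wedge (eta theta : form1) : form2 := fun z u v =>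
  eta z u * theta z v - eta z v * theta z u.

Definition oneform L : form1 := fun z u => \sum_(a < m) L a z * dz a z u.

Definition curl L (a b : 'I_m) : 'rV[R]_m -> R := fun z =>
  partial a (L b) z - partial b (L a) z.

Definition half_curl_form L : form2 := fun z u v =>
  2^-1 * \sum_(a < m) \sum_(b < m) curl L a b z * wedge (dz a) (dz b) z u v.

End Forms.

Section Stochastic.
Context {R : realType} {d : measure_display} {T : measurableType d}.
Variable P : probability T R.

(* Processes are indexed by R, but only the times t >= 0 matter. *)
Definition process := R -> T -> R.
Implicit Types (W X Y : process).

Definition continuous_paths X :=
  {ae P, forall w, {within `[0, +oo[, continuous (X ^~ w)}}.

Definition past W (t : R) : set_system T :=
  <<s [set A | exists2 s, 0 <= s <= t &
        exists2 B : set R, measurable B & A = W s @^-1` B] >>.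

Definition brownian W :=
  [/\ forall t, 0 <= t -> measurable_fun [set: T] (W t),
      {ae P, forall w, W 0 w = 0},
      continuous_paths W,
      forall s t, 0 <= s -> s < t -> forall (A : set T) (B : set R),
        past W s A -> measurable B ->
        let dWB := (W t \- W s)%R @^-1` B in P (A `&` dWB) = (P A * P dWB)%E &
      forall s t, 0 <= s -> s < t -> forall B : set R, measurable B ->
        P ((W t \- W s)%R @^-1` B) = normal_prob 0 (Num.sqrt (t - s)) B].

(* The filtration generated by W, augmented as usual by the null events. *)
Definition filtration W (t : R) : set_system T :=
  <<s past W t `|` [set A | measurable A /\ P A = 0%E] >>.

Definition measurable_wrt (F : set_system T) (f : T -> R) :=
  forall B : set R, measurable B -> F (f @^-1` B).

Definition adapted W X :=
  forall t, 0 <= t -> measurable_wrt (filtration W t) (X t).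

(* k-th point of the partition 0 :: s of [0, t]. *)
Definition pt (t : R) (s : seq R) (k : nat) : R := nth t (0 :: s) k.

(* Semimartingales in the sense of good integrators (Bichteler-Dellacherie,
   Protter): on each [0, t] the elementary integrals of the simple predictable
   integrands bounded by 1 are bounded in probability. *)
Definition good_integrator W X :=
  forall t e : R, 0 <= t -> 0 < e ->
  exists C : R, forall (s : seq R) (h : nat -> T -> R),
    itv_partition 0 t s ->
    (forall k, (k < size s)%N ->
       measurable_wrt (filtration W (pt t s k)) (h k)) ->
    (forall k w, `|h k w| <= 1) ->
    (P [set w | (C < `|\sum_(0 <= k < size s)
          h k w * (X (pt t s k.+1) w - X (pt t s k) w)|)%R] <= e%:E)%E.

Definition continuous_semimartingale W X :=
  [/\ adapted W X, continuous_paths X & good_integrator W X].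

Definition trapezoidal_sum X Y (t : R) (s : seq R) : T -> R := fun w =>
  \sum_(0 <= k < size s) 2^-1 * (X (pt t s k) w + X (pt t s k.+1) w) *
    (Y (pt t s k.+1) w - Y (pt t s k) w).

(* I = \int_0^t X o dY: the trapezoidal sums converge to I in probability as
   the mesh of the partition tends to 0.  The outer measure mu_ext P is P on
   events; it is used because the x-derivatives below, and hence the integrands,
   are controlled only outside of a null set. *)
Definition stratonovich X Y (t : R) (I : T -> R) :=
  forall e eta : R, 0 < e -> 0 < eta -> exists2 delta : R, 0 < delta &
  forall s, itv_partition 0 t s ->
    (forall k, (k < size s)%N -> pt t s k.+1 - pt t s k < delta) ->
    (mu_ext P [set w | (e <= `|trapezoidal_sum X Y t s w - I w|)%R]
       <= eta%:E)%E.

Definition time_integral X (t : R) : T -> R := fun w =>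
  \int[lebesgue_measure]_(s in `[0, t]) X s w.

End Stochastic.

Section Multisymplectic.
Context {R : realType} {d : measure_display} {T : measurableType d} {n m : nat}.
Variables (P : probability T R) (W : R -> T -> R).

(* Random fields (x, t, w) |-> z(x, t)(w). *)
Definition field (V : Type) := 'rV[R]_n -> R -> T -> V.

(* The total derivative z_{,i}. *)
Definition xder {V : normedModType R} (i : 'I_n) (z : field V) : field V :=
  fun x t w => 'D_(delta_mx 0 i) (fun y => z y t w) x.

Definition regular_field (z : field 'rV[R]_m) :=
  {ae P, forall w, forall t x, 0 <= t -> differentiable (fun y => z y t w) x} /\
  forall x a,
    continuous_semimartingale P W (fun t w => z x t w 0 a) /\
    forall i, continuous_semimartingale P W (fun t w => xder i z x t w 0 a).

Variables (L0 : 'I_m -> 'rV[R]_m -> R) (L Lt : 'I_n -> 'I_m -> 'rV[R]_m -> R).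
Variables (H Ht : 'rV[R]_m -> R).

Local Notation M := (curl L0).
Local Notation K i := (curl (L i)).
Local Notation Kt i := (curl (Lt i)).

(* The system, integrated over [0, t]. *)
Definition solution (z : field 'rV[R]_m) :=
  forall (x : 'rV[R]_n) (a : 'I_m) (t : R), 0 <= t ->
  exists (I : 'I_m -> T -> R) (J JH : T -> R),
  [/\ forall b, stratonovich P (fun s w => M a b (z x s w))
                  (fun s w => z x s w 0 b) t (I b),
      stratonovich P (fun s w => \sum_(i < n) \sum_(b < m)
        Kt i a b (z x s w) * xder i z x s w 0 b) W t J,
      stratonovich P (fun s w => partial a Ht (z x s w)) W t JH &
      {ae P, forall w,
        \sum_(b < m) I b w
        + time_integral (fun s w => \sum_(i < n) \sum_(b < m)
            K i a b (z x s w) * xder i z x s w 0 b) t w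
        + J w
        = time_integral (fun s w => partial a H (z x s w)) t w + JH w}].

(* U is a first variation of z: the exterior derivative of the system, evaluated
   on U, vanishes, i.e. U solves the system linearized at z,
     (D_U M_ab) dz^b + M_ab dU^b
     + ((D_U K^i_ab) z^b_{,i} + K^i_ab U^b_{,i}) dt
     + ((D_U Kt^i_ab) z^b_{,i} + Kt^i_ab U^b_{,i}) o dW
     = D_U (dH/dz^a) dt + D_U (dHt/dz^a) o dW. *)
Definition linearized_solution (z U : field 'rV[R]_m) :=
  forall (x : 'rV[R]_n) (a : 'I_m) (t : R), 0 <= t ->
  exists (I I' : 'I_m -> T -> R) (J JH : T -> R),
  [/\ forall b, stratonovich P (fun s w => 'D_(U x s w) (M a b) (z x s w))
                  (fun s w => z x s w 0 b) t (I b),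
      forall b, stratonovich P (fun s w => M a b (z x s w))
                  (fun s w => U x s w 0 b) t (I' b),
      stratonovich P (fun s w => \sum_(i < n) \sum_(b < m)
        ('D_(U x s w) (Kt i a b) (z x s w) * xder i z x s w 0 b
         + Kt i a b (z x s w) * xder i U x s w 0 b)) W t J,
      stratonovich P
        (fun s w => 'D_(U x s w) (partial a Ht) (z x s w)) W t JH &
      {ae P, forall w,
        \sum_(b < m) (I b w + I' b w)
        + time_integral (fun s w => \sum_(i < n) \sum_(b < m)
            ('D_(U x s w) (K i a b) (z x s w) * xder i z x s w 0 b
             + K i a b (z x s w) * xder i U x s w 0 b)) t w
        + J w
        = time_integral
            (fun s w => 'D_(U x s w) (partial a H) (z x s w)) t w + JH w}].

Definition first_variation (z U : field 'rV[R]_m) :=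
  regular_field U /\ linearized_solution z U.

Definition along (theta : @form2 R m) (z U V : field 'rV[R]_m) : field R :=
  fun x t w => theta (z x t w) (U x t w) (V x t w).

(* d omega + kappa^i_{,i} dt + kappat^i_{,i} o dW = 0 along z, integrated over
   [0, t].  A 2-form along a solution is evaluated on pairs of first variations,
   the vectors tangent to the solutions; d and (.)_{,i} are total, i.e. they also
   act on U and V (hence on the dz^a). *)
Definition structural_law (z : field 'rV[R]_m)
    (omega : @form2 R m) (kappa kappat : 'I_n -> @form2 R m) :=
  forall U V, first_variation z U -> first_variation z V ->
  forall (x : 'rV[R]_n) (t : R), 0 <= t ->
  exists2 J : T -> R,
    stratonovich P (fun s w =>
      \sum_(i < n) xder i (along (kappat i) z U V) x s w) W t J &
    {ae P, forall w,
      (along omega z U V x t w - along omega z U V x 0 w)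
      + time_integral (fun s w =>
          \sum_(i < n) xder i (along (kappa i) z U V) x s w) t w
      + J w = 0}.

End Multisymplectic.

(* Main.v *)
Require Import Defs.
From mathcomp Require Import all_boot all_order all_algebra.
From mathcomp Require Import all_classical all_reals all_analysis.
From mathcomp Require Import measurable_realfun ring lra.

(** A 2-form along a solution [z] is evaluated on two first variations [U] and
[V]. Contract the system linearized along [V] with [U], the one linearized along
[U] with [V], and subtract. The Hessian terms cancel by symmetry, and since
[M = curl L0] is closed, [(D_V M_ac) U^a - (D_U M_ac) V^a = U^a V^b dM_ab/dz^c];
so the terms in [dz], [dU], [dV] are the Stratonovich differential of
[M_ab U^a V^b]. The same identity for [K^i] and [Kt^i] gives the
[x]-derivatives of [kappa^i] and [kappat^i].

Stratonovich integrals are limits in (outer) probability of trapezoidal sums, so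
two rules of calculus are needed: associativity [U o (F o dY) = (U F) o dY], by
which the integrated system may be contracted, and the chain rule. For good
integrators the elementary integrals are tight uniformly over all partial sums
(stop the sum when it becomes large), hence small adapted integrands have small
integrals, quadratic variations are tight and third-order terms vanish. For
associativity, the integral over each interval of a partition is computed on a
fine refinement of it, and the error is an integral of a small adapted integrand
along that refinement. Time integrals are treated as Stratonovich integrals
against the process [t]. *)

Set Implicit Arguments.
Unset Strict Implicit.
Unset Printing Implicit Defensive.

Import Order.TTheory GRing.Theory Num.Theory.
Import numFieldNormedType.Exports.

Local Open Scope classical_set_scope.
Local Open Scope ring_scope.

(** * Outer probability and measurability *)

(** A Stratonovich integral is given here separately at each time. As a function of its upper limit
    it is a mere family of random variables, not known to be adapted or continuous, so multiplying
    the integrated system by [U] is not a formal step. A partition sees this family only at finitely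
    many times, where it may be replaced by sums over a refinement chosen afterwards; the errors
    must therefore be small uniformly in the refinement. They contain second-order terms that are
    not small in absolute sum. The discrete Levy area exhibits their adapted structure, without
    which they could not be estimated. Neither brackets nor stochastic integrals are constructed.
    All identities concern trapezoidal sums and hold exactly or up to vanishing terms, and squared
    increments are controlled by summation by parts. The last integral of the law is obtained by
    solving the law for it: the other terms provide a random variable, and the trapezoidal sums are
    shown to converge to it. *)

Definition outer_le {R : realType} {d} {T : measurableType d}
  (P : probability T R) (A : set T) (e : R) : Prop := (mu_ext P A <= e%:E)%E.

Section RationalPoints.
Context {R : realType}.

Definition qreal (q : rat) : R := ratr q.

Lemma qreal_between (x y : R) : x < y -> exists2 q, x < qreal q & qreal q < y.
Proof.
by move=> /rat_in_itvoo[q]; rewrite in_itv/= => /andP[]; exists q.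
Qed.

Lemma qreal_approx (s D : R) : 0 < D -> exists2 q, s <= qreal q & `|s - qreal q| < D.
Proof.
move=> D0; have [|q q1 q2] := @qreal_between s (s + D); first by rewrite ltrDl.
by exists q; [exact: ltW|rewrite ltr_norml; apply/andP; split; lra].
Qed.

End RationalPoints.

Section OuterProbability.
Context {R : realType} {d : measure_display} {T : measurableType d}.
Variable P : probability T R.

Lemma mu_extU (A B : set T) : (mu_ext P (A `|` B) <= mu_ext P A + mu_ext P B)%E.
Proof. exact: outer_measureU2. Qed.

Lemma mu_extS (A B : set T) : A `<=` B -> (mu_ext P A <= mu_ext P B)%E.
Proof. exact: le_mu_ext. Qed.

Lemma mu_ext_measurable (A : set T) : measurable A -> mu_ext P A = P A.
Proof. exact: measurable_mu_extE. Qed.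

Lemma mu_ext_negligible (A : set T) : P.-negligible A -> mu_ext P A = 0%E.
Proof.
move=> [B [mB B0 AB]]; apply/eqP; rewrite eq_le mu_ext_ge0// andbT.
by rewrite -B0 -mu_ext_measurable//; exact: mu_extS.
Qed.

Lemma mu_ext_sum (I : Type) (r : seq I) (A : I -> set T) (e : R) :
  (forall i, (mu_ext P (A i) <= e%:E)%E) ->
  (mu_ext P (\big[setU/set0]_(i <- r) A i) <= (e *+ size r)%:E)%E.
Proof.
move=> Ae; elim: r => [|x r IH]; first by rewrite big_nil mu_ext0// mulr0n.
rewrite big_cons /= mulrS EFinD; apply: (le_trans (mu_extU _ _)).
exact: leeD.
Qed.

(** Continuity of [P] from above. It converts an almost sure property of paths, expressed by a
    decreasing sequence of events, into a probability bound at one scale. *)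
Lemma nonincreasing_null_small (E : nat -> set T) :
  (forall n, measurable (E n)) -> (forall n, E n.+1 `<=` E n) ->
  P.-negligible (\bigcap_n E n) ->
  forall e : R, 0 < e -> exists n, (P (E n) <= e%:E)%E.
Proof.
move=> mE dE nE e e0.
have mI : measurable (\bigcap_n E n) by exact: bigcapT_measurable.
have cE : P \o E @ \oo --> P (\bigcap_n E n).
  apply: nonincreasing_cvg_mu => //; first by rewrite (le_lt_trans (probability_le1 _ _))// ltry.
  by apply/nonincreasing_seqP => n; apply/subsetPset.
move/negligibleP : nE => /(_ mI) P0; rewrite P0 in cE.
have := cE (fun x => (x < e%:E)%E).
have /[swap]/[apply] : nbhs (0%:E : \bar R) (fun x : \bar R => (x < e%:E)%E).
  by apply: open_nbhs_nbhs; split; [exact: open_ereal_lt_ereal|rewrite /= lte_fin].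
by move=> [n _ /(_ n (leqnn n))] /ltW h; exists n.
Qed.

End OuterProbability.

Section MeasurableLevels.
Context {R : realType} {d : measure_display} {T : measurableType d}.
Implicit Types (f : T -> R) (c : R).

Lemma measurable_cst_lt f c : measurable_fun [set: T] f ->
  measurable [set w | c < f w].
Proof.
move=> /(_ measurableT `]c, +oo[%classic (measurable_itv _)); rewrite setTI.
by rewrite (_ : _ @^-1` _ = [set w | c < f w])//; apply/seteqP; split=> w /=; rewrite in_itv/= andbT.
Qed.

Lemma measurable_lt_cst f c : measurable_fun [set: T] f ->
  measurable [set w | f w < c].
Proof.
move=> /(_ measurableT `]-oo, c[%classic (measurable_itv _)); rewrite setTI.
by rewrite (_ : _ @^-1` _ = [set w | f w < c])//; apply/seteqP; split=> w /=; rewrite in_itv/=.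
Qed.

End MeasurableLevels.

Section MeasurableWrt.
Context {R : realType} {d : measure_display} {T : measurableType d}.
Implicit Types (G : set_system T) (f g : T -> R).

Lemma measurable_wrtP G f : measurable_wrt <<s G>> f <->
  @measurable_fun _ _ (g_sigma_algebraType G) R [set: T] f.
Proof.
split=> [h _ B mB|h B mB]; first by rewrite setTI; exact: h.
by have := h measurableT B mB; rewrite setTI.
Qed.

Lemma measurable_wrt_cst G (c : R) : measurable_wrt <<s G>> (fun=> c).
Proof. by apply/measurable_wrtP; exact: measurable_cst. Qed.

Lemma measurable_wrtD G f g : measurable_wrt <<s G>> f ->
  measurable_wrt <<s G>> g -> measurable_wrt <<s G>> (fun w => f w + g w).
Proof.
by move=> /measurable_wrtP hf /measurable_wrtP hg; apply/measurable_wrtP/measurable_funD.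
Qed.

Lemma measurable_wrtM G f g : measurable_wrt <<s G>> f ->
  measurable_wrt <<s G>> g -> measurable_wrt <<s G>> (fun w => f w * g w).
Proof.
by move=> /measurable_wrtP hf /measurable_wrtP hg; apply/measurable_wrtP/measurable_funM.
Qed.

Lemma measurable_wrt_comp G f (k : R -> R) : measurable_fun setT k ->
  measurable_wrt <<s G>> f -> measurable_wrt <<s G>> (fun w => k (f w)).
Proof.
by move=> mk /measurable_wrtP hf; apply/measurable_wrtP/measurableT_comp.
Qed.

Lemma measurable_wrt_prod G (I : Type) (r : seq I) (F : I -> T -> R) :
  (forall i, measurable_wrt <<s G>> (F i)) ->
  measurable_wrt <<s G>> (fun w => \prod_(i <- r) F i w).
Proof.
move=> mF; elim: r => [|x r IH].
  by under eq_fun do rewrite big_nil; exact: measurable_wrt_cst.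
by under eq_fun do rewrite big_cons; exact: measurable_wrtM.
Qed.

(* An open set of the finite-dimensional space is the union of the rational
   cubes that it contains. *)
Lemma measurable_wrt_continuous G m (X : T -> 'rV[R]_m) (g : 'rV[R]_m -> R) :
  continuous g -> (forall a, measurable_wrt <<s G>> (fun w => X w 0 a)) ->
  measurable_wrt <<s G>> (fun w => g (X w)).
Proof.
move=> cg mX; apply/measurable_wrtP.
apply: (measurability _ (RGenOpens.measurableE R)) => _ [_ [a [b -> <-]]].
rewrite setTI.
pose V := g @^-1` `]a, b[%classic.
have oV : open V by move/continuousP : cg; apply; exact: interval_open.
pose rv (q : 'rV[rat]_m) : 'rV[R]_m := \row_j qreal (q 0 j).
pose B (qk : 'rV[rat]_m * nat) : set T :=
  \bigcap_(a in [set: 'I_m]) [set w | `|X w 0 a - qreal (qk.1 0 a)| < (qk.2.+1%:R)^-1].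
have -> : (fun w => g (X w)) @^-1` `]a, b[%classic =
    \bigcup_(qk in [set qk | ball (rv qk.1) (qk.2.+1%:R)^-1 `<=` V]) B qk.
  apply/seteqP; split => w /=; last first.
    move=> [[q k] /= qkV Bw]; apply: (qkV (X w)).
    split; first by rewrite invr_gt0.
    by move=> i j; rewrite /ball/= distrC mxE (ord1 i); exact: Bw.
  move=> Vw.
  have /nbhs_ballP[e /= e0 eV] : nbhs (X w) V by exact: open_nbhs_nbhs.
  have e20 : 0 < e / 2 by rewrite divr_gt0.
  have [k _ /(_ k (leqnn k)) ke] := near_infty_natSinv_lt (PosNum e20).
  have /choice[q qP] : forall a : 'I_m, exists q : rat, `|X w 0 a - qreal q| < k.+1%:R^-1.
    by move=> c; have [|q _] := @qreal_approx R (X w 0 c) k.+1%:R^-1; [rewrite invr_gt0|exists q].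
  exists (\row_j q j, k) => /=; last by move=> c _ /=; rewrite mxE.
  move=> y [_ yq]; apply: eV; split => // i j; rewrite /ball/=.
  have := yq i j; rewrite /ball/= !mxE (ord1 i) => yq1.
  have := ler_distD (qreal (q j)) (X w 0 j) (y 0 j).
  by have := lt_trans (qP j) ke; have /= := lt_trans yq1 ke; lra.
rewrite bigcup_mkcond; apply: countable_bigcupT_measurable => [|qk].
  exact: countableP.
case: ifPn => // _; apply: fin_bigcap_measurable => // a0 _.
pose h (x : R) : R := `|x - qreal (qk.1 0 a0)|.
have mh : measurable_fun setT h.
  by apply: measurableT_comp => //; exact: measurable_funB.
have := measurable_wrt_comp mh (mX a0).
by move=> /measurable_wrtP; exact: measurable_lt_cst.
Qed.

End MeasurableWrt.

Section Filtration.
Context {R : realType} {d : measure_display} {T : measurableType d}.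
Variables (P : probability T R) (W : R -> T -> R).
Hypothesis mW : forall t : R, 0 <= t -> measurable_fun [set: T] (W t).
Implicit Types (s t : R) (f : T -> R).

Lemma past_mono s t : s <= t -> past W s `<=` past W t.
Proof.
move=> st; apply: smallest_sub; first exact: smallest_sigma_algebra.
move=> A [r /andP[r0 rs] [B mB ->]]; rewrite /past; apply: sub_gen_smallest.
by exists r => /=; [rewrite r0 (le_trans rs)|exists B].
Qed.

Lemma filtration_mono s t : s <= t -> filtration P W s `<=` filtration P W t.
Proof.
move=> st; apply: sub_smallest2r; first exact: smallest_sigma_algebra.
by move=> A [|h]; [left; exact: (past_mono st)|right].
Qed.

Lemma past_measurable t A : past W t A -> measurable A.
Proof.
apply: (smallest_sub (@sigma_algebra_measurable _ T)) => B [s /andP[s0 _] [C mC ->]].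
by rewrite -[X in measurable X]setTI; exact: mW.
Qed.

Lemma filtration_measurable t A : filtration P W t A -> measurable A.
Proof.
apply: (smallest_sub (@sigma_algebra_measurable _ T)) => B [|[]//].
exact: past_measurable.
Qed.

Lemma measurable_wrt_le s t f : s <= t ->
  measurable_wrt (filtration P W s) f -> measurable_wrt (filtration P W t) f.
Proof. by move=> st mf B mB; apply: (filtration_mono st); exact: mf. Qed.

Lemma measurable_wrt_filtration t f :
  measurable_wrt (filtration P W t) f -> measurable_fun [set: T] f.
Proof.
by move=> mf _ B mB; rewrite setTI; apply: (@filtration_measurable t); exact: mf.
Qed.

End Filtration.

(** * Bounds and moduli of continuity of paths, in probability *)

Section ContinuousPaths.
Context {R : realType} {d : measure_display} {T : measurableType d}.
Variables (P : probability T R).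
Implicit Types (X : R -> T -> R) (f : R -> R) (s r t e D C : R).

Lemma within_continuousP f : {within `[0, +oo[, continuous f} <->
  forall s : R, 0 <= s -> forall e : R, 0 < e -> exists2 D : R, 0 < D &
    forall r : R, 0 <= r -> `|s - r| < D -> `|f s - f r| < e.
Proof.
split=> [cf s s0 e e0|h].
  move/subspace_continuousP : cf => /(_ s); rewrite /= in_itv/= s0 => /(_ isT).
  move=> /cvgrPdist_lt /(_ _ e0); rewrite near_withinE => /nbhs_ballP[D /= D0 DH].
  by exists D => // r r0 rs; apply: DH => //=; rewrite in_itv/= r0.
apply/subspace_continuousP => s; rewrite /= in_itv/= andbT => s0.
apply/cvgrPdist_lt => e e0; rewrite near_withinE.
have [D D0 DH] := h _ s0 _ e0.
apply/nbhs_ballP; exists D => //= r rs; rewrite in_itv/= andbT => r0.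
exact: DH.
Qed.

(** Compactness of [0, t]. The modulus has the form 1/(n+1), so that failures of continuity are
    described by a sequence of events. *)
Lemma uniform_modulus f t e : {within `[0, +oo[, continuous f} -> 0 < e ->
  exists n : nat, forall s r : R, 0 <= s <= t -> 0 <= r -> `|s - r| < n.+1%:R^-1 ->
    `|f s - f r| < e.
Proof.
move=> /within_continuousP cf e0.
have /compact_near_coveringP/(_ nat \oo%classic) := @segment_compact R 0 t.
move=> /(_ (fun n s => 0 <= s -> forall r, 0 <= r -> `|s - r| < n.+1%:R^-1 -> `|f s - f r| < e) _).
case.
- move=> s; rewrite /= in_itv/= => /andP[s0 st].
  have [D D0 DH] := cf _ s0 _ (divr_gt0 e0 (ltr0Sn _ 1) : 0 < e / 2).
  have D20 : 0 < D / 2 by rewrite divr_gt0.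
  near=> s' n => /= s'0 r r0 s'r.
  have h1 : `|s - s'| < D / 2 by near: s'; apply: nbhsx_ballx.
  have h2 : n.+1%:R^-1 < D / 2.
    by near: n; exact: (near_infty_natSinv_lt (PosNum D20)).
  have h3 := DH s' s'0; have h4 := DH r r0.
  have h5 := ler_distD s' s r; have h6 := lt_trans s'r h2.
  have := ler_distD (f s) (f s') (f r); rewrite (distrC (f s') (f s)).
  have {}h3 : `|f s - f s'| < e / 2 by apply: h3; lra.
  have {}h4 : `|f s - f r| < e / 2 by apply: h4; lra.
  lra.
move=> n _ /(_ n (leqnn n)) H; exists n => s r /andP[s0 st] r0.
by apply: (H s) => //=; rewrite in_itv/= s0.
Unshelve. all: by end_near. Qed.

Variable (X : R -> T -> R).
Hypothesis mX : forall s : R, 0 <= s -> measurable_fun [set: T] (X s).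
Hypothesis cX : continuous_paths P X.

Let Z := [set w | ~ {within `[0, +oo[, continuous (X ^~ w)}].

Lemma paths_bounded t e : 0 < e -> exists2 C : R, 0 < C &
  outer_le P [set w | exists2 s : R, 0 <= s <= t & C < `|X s w|] e.
Proof.
move=> e0.
(* Rational times make the event measurable; the extra unit beyond [t] leaves room for a rational to
   the right of any time in [0, t]. *)
pose E n := \bigcup_(q in [set q : rat | 0 <= (qreal q : R) <= t + 1])
  [set w | n%:R < `|X (qreal q) w|].
have mE n : measurable (E n).
  rewrite /E bigcup_mkcond; apply: bigcupT_measurable_rat => q.
  case: ifPn => [/set_mem/= /andP[q0 _]|_]; last exact: measurable0.
  have mh : measurable_fun [set: T] (fun w => `|X (qreal q) w|).
    by apply: measurableT_comp => //; exact: mX.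
  exact: measurable_cst_lt.
have dE n : E n.+1 `<=` E n.
  by move=> w [q /= qt h]; exists q => //=; rewrite (le_lt_trans _ h)// ler_nat.
have nE : P.-negligible (\bigcap_n E n).
  apply: negligibleS cX => w /= Ew cw.
  have [c c0 cP] : exists2 c : R, 0 < c & forall s r : R, 0 <= s <= t + 1 -> 0 <= r ->
      `|s - r| <= c -> `|X s w - X r w| < 1.
    have [k kP] := uniform_modulus (t + 1) cw ltr01.
    exists k.+2%:R^-1; first by rewrite invr_gt0.
    move=> s r s0 r0 sr; apply: kP => //; apply: (le_lt_trans sr).
    by rewrite ltf_pV2 ?posrE// ltr_nat.
  (* The path is followed from 0 in steps of length [c], each of which changes it by less than 1. *)
  have H : forall (m : nat) (s : R), 0 <= s <= t + 1 -> s <= m%:R * c ->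
      `|X s w| <= `|X 0 w| + m%:R.
    elim=> [s /andP[s0 _]|m IH s /andP[s0 st]].
      by rewrite mul0r addr0 => s0'; have -> : s = 0 by lra.
    rewrite -natr1 mulrDl mul1r => sm.
    have t10 : 0 <= t + 1 by lra.
    have [sk|ks] := leP s c.
      have := cP 0 s; rewrite lexx t10 /= sub0r normrN (ger0_norm s0).
      move=> /(_ isT s0 sk); have := ler0n R m.
      have : `|X s w| <= `|X 0 w - X s w| + `|X 0 w|.
        by rewrite -{1}(subrK (X 0 w) (X s w)) distrC; exact: ler_normD.
      lra.
    have IH1 : `|X (s - c) w| <= `|X 0 w| + m%:R.
      by apply: IH; [apply/andP; split; lra|lra].
    have sc0 : 0 <= s - c by lra.
    have := cP s (s - c); rewrite s0 st /= subKr (gtr0_norm c0).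
    move=> /(_ isT sc0 (lexx _)).
    have : `|X s w| <= `|X s w - X (s - c) w| + `|X (s - c) w|.
      by rewrite -{1}(subrK (X (s - c) w) (X s w)); exact: ler_normD.
    lra.
  have [m mP] : exists m : nat, t + 1 <= m%:R * c.
    exists (Num.truncn (`|t + 1| / c)).+1.
    rewrite -ler_pdivrMr//; apply/ltW; apply: le_lt_trans (truncnS_gt _).
    by rewrite ler_wpM2r ?ler_norm// invr_ge0 ltW.
  have [n nP] : exists n : nat, `|X 0 w| + m%:R < n%:R.
    by exists (Num.truncn (`|X 0 w| + m%:R)).+1; exact: truncnS_gt.
  have [q /= qt] := Ew n I; rewrite ltNge => /negP; apply.
  apply: (le_trans (H m _ qt _)); last exact/ltW.
  by move/andP: qt => [_ qt]; exact: le_trans mP.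
have [n nP] := nonincreasing_null_small mE dE nE e0.
(* The extra 1 pays for the move from a real time to a nearby rational one. *)
exists n.+1%:R => //.
apply: le_trans (_ : (mu_ext P (E n `|` Z) <= _)%E).
  apply: mu_extS => w /= [s /andP[s0 st] h]; case: (pselect (Z w)) => [|/contrapT cw]; [by right|left].
  have /within_continuousP/(_ _ s0 _ ltr01)[D D0 DH] := cw.
  have D10 : 0 < Num.min D 1 by rewrite lt_min D0 ltr01.
  have [q sq] := qreal_approx s D10.
  rewrite lt_min => /andP[qD q1]; exists q => /=.
    by rewrite (le_trans s0 sq)/=; move: q1; rewrite ltr_norml; lra.
  have := DH _ (le_trans s0 sq) qD.
  have : `|X s w| <= `|X s w - X (qreal q) w| + `|X (qreal q) w|.
    by rewrite -{1}(subrK (X (qreal q) w) (X s w)); exact: ler_normD.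
  by move: h; rewrite -natr1; lra.
apply: (le_trans (mu_extU _ _ _)).
by rewrite (mu_ext_negligible cX) adde0 mu_ext_measurable.
Qed.

Lemma paths_modulus t e (eta : R) : 0 < e -> 0 < eta -> exists2 D : R, 0 < D &
  outer_le P [set w | exists s r : R, [/\ 0 <= s <= t, 0 <= r <= t, `|s - r| < D &
     e < `|X s w - X r w| ] ] eta.
Proof.
move=> e0 eta0.
pose E n := \bigcup_(q in [set q : rat | 0 <= (qreal q : R) <= t + 1])
  \bigcup_(p in [set p : rat | 0 <= (qreal p : R) <= t + 1 /\ `|qreal q - (qreal p : R)| < n.+1%:R^-1])
  [set w | e < `|X (qreal q) w - X (qreal p) w|].
have mE n : measurable (E n).
  rewrite /E bigcup_mkcond; apply: bigcupT_measurable_rat => q.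
  case: ifPn => [/set_mem/= /andP[q0 _]|_]; last exact: measurable0.
  rewrite bigcup_mkcond; apply: bigcupT_measurable_rat => p.
  case: ifPn => [/set_mem/= [/andP[p0 _] _]|_]; last exact: measurable0.
  have mh : measurable_fun [set: T] (fun w => `|X (qreal q) w - X (qreal p) w|).
    by apply: measurableT_comp => //; apply: measurable_funB; exact: mX.
  exact: measurable_cst_lt.
have dE n : E n.+1 `<=` E n.
  move=> w [q /= qt [p /= [pt qp] h]]; exists q => //=; exists p => //=; split => //.
  by rewrite (lt_le_trans qp)// lef_pV2 ?posrE// ler_nat.
have nE : P.-negligible (\bigcap_n E n).
  apply: negligibleS cX => w /= Ew cw.
  have [k kP] := uniform_modulus (t + 1) cw e0.
  have [q /= qt [p /= [/andP[p0 _] qp] h]] := Ew k I.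
  by have := kP _ _ qt p0 qp; rewrite ltNge (ltW h).
have [n nP] := nonincreasing_null_small mE dE nE eta0.
(* This mesh is strictly below 1/(n+1), so both times can be moved to rationals that stay within
   1/(n+1) of each other. *)
exists n.+2%:R^-1; first by rewrite invr_gt0.
apply: le_trans (_ : (mu_ext P (E n `|` Z) <= _)%E).
  apply: mu_extS => w /= [s [r [/andP[s0 st] /andP[r0 rt] sr h]]].
  case: (pselect (Z w)) => [|/contrapT cw]; [by right|left].
  have g0 : 0 < (`|X s w - X r w| - e) / 2 by rewrite divr_gt0// subr_gt0.
  have kk : n.+2%:R^-1 < n.+1%:R^-1 :> R by rewrite ltf_pV2 ?posrE// ltr_nat.
  have hh : 0 < (n.+1%:R^-1 - n.+2%:R^-1) / 2 :> R by rewrite divr_gt0// subr_gt0.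
  have get (u : R) : 0 <= u <= t -> exists2 q : rat, 0 <= (qreal q : R) <= t + 1 &
     `|u - qreal q| < (n.+1%:R^-1 - n.+2%:R^-1) / 2 /\
     `|X u w - X (qreal q) w| < (`|X s w - X r w| - e) / 2.
    move=> /andP[u0 ut].
    have /within_continuousP/(_ _ u0 _ g0)[D D0 DH] := cw.
    have D10 : 0 < Num.min (Num.min D 1) ((n.+1%:R^-1 - n.+2%:R^-1) / 2).
      by rewrite !lt_min D0 ltr01.
    have [q sq] := qreal_approx u D10.
    rewrite !lt_min => /andP[/andP[qD q1] q2]; exists q.
      by rewrite (le_trans u0 sq)/=; move: q1; rewrite ltr_norml; lra.
    by split => //; apply: DH => //; exact: le_trans sq.
  have [|q q1 [q2 q3]] := get s; first by rewrite s0.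
  have [|p p1 [p2 p3]] := get r; first by rewrite r0.
  exists q => //=; exists p => /=.
    split => //; have := ler_distD s (qreal q) (qreal p : R).
    have := ler_distD r s (qreal p : R); rewrite (distrC (qreal q) s).
    by move: (n.+1%:R^-1) (n.+2%:R^-1) sr q2 p2 => a b; lra.
  have := ler_distD (X (qreal q) w) (X s w) (X r w).
  have := ler_distD (X (qreal p) w) (X (qreal q) w) (X r w).
  rewrite (distrC (X (qreal p) w)).
  lra.
apply: (le_trans (mu_extU _ _ _)).
by rewrite (mu_ext_negligible cX) adde0 mu_ext_measurable.
Qed.

End ContinuousPaths.

Section OuterLe.
Context {R : realType} {d : measure_display} {T : measurableType d}.
Variable P : probability T R.
Implicit Types (A B : set T) (e : R).

Lemma outer_leS A B e : A `<=` B -> outer_le P B e -> outer_le P A e.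
Proof. by move=> AB; exact/le_trans/mu_extS. Qed.

Lemma outer_leU A B e : outer_le P A (e / 2) -> outer_le P B (e / 2) ->
  outer_le P (A `|` B) e.
Proof.
move=> hA hB; apply: (le_trans (mu_extU _ _ _)).
by rewrite (splitr e) EFinD; exact: leeD.
Qed.

Lemma outer_le_negligible A B e : P.-negligible B -> outer_le P A e ->
  outer_le P (A `|` B) e.
Proof.
move=> nB hA; apply: (le_trans (mu_extU _ _ _)).
by rewrite (mu_ext_negligible nB) adde0.
Qed.

End OuterLe.

(** * Elementary integrals along partitions *)

Section PartitionPoints.
Context {R : realType}.
Implicit Types (t : R) (s : seq R).

Lemma pt0 t s : pt t s 0 = 0. Proof. by []. Qed.

(** Beyond its last point a partition is continued by [t], the default of [nth]. Increments vanish
    there, so sums and arrays can be indexed by all natural numbers. *)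
Lemma pt_size t s j : itv_partition 0 t s -> (size s <= j)%N -> pt t s j = t.
Proof.
move=> ps; rewrite leq_eqVlt => /predU1P[<-|sj]; first exact: itv_partition_nth_size ps.
by rewrite /pt nth_default.
Qed.

Lemma pt_ltS t s j : itv_partition 0 t s -> (j < size s)%N -> pt t s j < pt t s j.+1.
Proof. by move=> [/(pathP t) + _] js; apply. Qed.

Lemma pt_leS t s j : itv_partition 0 t s -> pt t s j <= pt t s j.+1.
Proof.
move=> ps; have [js|js] := ltnP j (size s); first exact/ltW/pt_ltS.
by rewrite !(pt_size ps)// leqW.
Qed.

Lemma pt_le t s i j : itv_partition 0 t s -> (i <= j)%N -> pt t s i <= pt t s j.
Proof.
move=> ps /subnK <-; elim: (j - i)%N => [//|k IH].
by rewrite addSn; exact: le_trans IH (pt_leS _ ps).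
Qed.

Lemma pt_ge0 t s j : itv_partition 0 t s -> 0 <= pt t s j.
Proof. by move=> ps; rewrite -(pt0 t s); exact: pt_le. Qed.

Lemma pt_le_end t s j : itv_partition 0 t s -> pt t s j <= t.
Proof.
move=> ps; rewrite -[leRHS](@pt_size t s (maxn (size s) j) ps) ?leq_maxl//.
by apply: pt_le => //; exact: leq_maxr.
Qed.

End PartitionPoints.

(** * A maximal inequality for good integrators *)

Section GoodIntegrator.
Context {R : realType} {d : measure_display} {T : measurableType d}.
Variables (P : probability T R) (W : R -> T -> R).
Hypothesis mW : forall t : R, 0 <= t -> measurable_fun [set: T] (W t).
Implicit Types (X Y : R -> T -> R) (h : nat -> T -> R) (s : seq R) (t : R).

Definition adapted_steps t s h :=
  forall k, measurable_wrt (filtration P W (pt t s k)) (h k).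

Definition step_integral X t s h (l : nat) (w : T) : R :=
  \sum_(0 <= k < l) h k w * (X (pt t s k.+1) w - X (pt t s k) w).

Lemma step_integral_adapted X t s h : adapted P W X -> itv_partition 0 t s ->
  adapted_steps t s h -> adapted_steps t s (step_integral X t s h).
Proof.
move=> aX ps ah l; rewrite /step_integral.
elim: l => [|l IH].
  by under eq_fun do rewrite big_nil; exact: measurable_wrt_cst.
under eq_fun do rewrite big_nat_recr//=.
apply: measurable_wrtD.
  exact: measurable_wrt_le (pt_leS _ ps) IH.
apply: measurable_wrtM.
  exact: measurable_wrt_le (pt_leS _ ps) (ah l).
apply: measurable_wrtD; first exact: (aX _ (pt_ge0 _ ps)).
apply: (@measurable_wrt_comp _ _ _ _ _ -%R); first exact: oppr_measurable.
exact: measurable_wrt_le (pt_leS _ ps) (aX _ (pt_ge0 _ ps)).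
Qed.

Lemma step_integral_stop X t s h l w : itv_partition 0 t s ->
  (size s <= l)%N -> step_integral X t s h l w = step_integral X t s h (size s) w.
Proof.
move=> ps sl; rewrite /step_integral (big_cat_nat (n := size s))//=.
rewrite [X in _ + X]big_nat_cond [X in _ + X]big1 ?addr0// => k /andP[/andP[sk _] _].
by rewrite !(pt_size ps) ?leqW// subrr mulr0.
Qed.

(* The integrand is stopped when the partial sums first exceed C * c, so that
   the integral of the stopped integrand is the first excessive partial sum. *)
Lemma step_integral_max X t (eta : R) : adapted P W X -> good_integrator P W X ->
  0 <= t -> 0 < eta -> exists2 C : R, 0 < C & forall s h (c : R),
    itv_partition 0 t s -> adapted_steps t s h -> 0 < c ->
    outer_le P [set w | (exists l, C * c < `|step_integral X t s h l w|) /\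
      forall j, `|h j w| <= c] eta.
Proof.
move=> aX gX t0 eta0; have [C0 HC] := gX t eta t0 eta0.
pose C := Num.max C0 1; have C_gt0 : 0 < C by rewrite /C lt_max ltr01 orbT.
have C0C : C0 <= C by rewrite /C le_max lexx.
exists C => // s h c ps ah c0.
pose K : R := C * c; have K0 : 0 < K by rewrite mulr_gt0.
pose S := step_integral X t s h.
pose ind (b x : R) : R := \1_(`[- b, b]%classic) x.
have indE (b x : R) : ind b x = (`|x| <= b)%R%:R.
  by rewrite /ind indicE ler_norml mem_setE in_itv.
have mind (b : R) : measurable_fun setT (ind b).
  by apply: measurable_indic; exact: measurable_itv.
(* Dividing by [c] and cutting off where |h| > c gives the bound 1 that [good_integrator] asks for;
   the product over l <= k does the stopping. Every factor is known at the k-th point. *)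
pose h' k w := h k w / c * ind c (h k w) * \prod_(l < k.+1) ind K (S l w).
have ah' : adapted_steps t s h'.
  move=> k; apply: measurable_wrtM; first apply: measurable_wrtM.
  - by apply: measurable_wrtM; [exact: ah|exact: measurable_wrt_cst].
  - by apply: measurable_wrt_comp; [exact: mind|exact: ah].
  apply: measurable_wrt_prod => l.
  apply: measurable_wrt_comp; first exact: mind.
  apply: (measurable_wrt_le (pt_le ps (leq_ord l))).
  exact: step_integral_adapted.
have h'1 k w : `|h' k w| <= 1.
  have p1 : `|\prod_(l < k.+1) ind K (S l w)| <= 1.
    rewrite normr_prod; apply: prodr_ile1 => l _.
    by rewrite normr_ge0 indE; case: (lerP `|S l w| K) => _; rewrite ?normr1 ?normr0 ?ler01 ?lexx.
  rewrite /h' normrM mulr_ile1// indE; case: (lerP `|h k w| c) => hc; rewrite ?mulr0 ?normr0//.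
  by rewrite mulr1 normrM normfV (gtr0_norm c0) ler_pdivrMr// mul1r.
have := HC s h' ps (fun k _ => ah' k) h'1.
rewrite -/(step_integral X t s h' (size s) _).
set B := [set w | _]; move=> HB.
have mB : measurable B.
  apply: measurable_cst_lt; apply: measurableT_comp => //.
  apply: (measurable_wrt_filtration mW (t := pt t s (size s))).
  exact: step_integral_adapted.
have {}HB : outer_le P B eta by rewrite /outer_le mu_ext_measurable.
apply: outer_leS HB => w /= [[l0 hl0] hc].
have exl : exists l, K < `|S l w| by exists l0.
(* [l] is the first excessive index. It is at most the size of the partition, because the partial
   sums are constant from there on. *)
case: (ex_minnP exl) => l Sl lmin.
have ls : (l <= size s)%N.
  rewrite leqNgt; apply/negP => sl.
  have := lmin (size s); rewrite /S -(step_integral_stop X h w ps (ltnW sl)) => /(_ Sl).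
  by rewrite leqNgt sl.
have h'lt k : (k < l)%N -> h' k w = h k w / c.
  move=> kl; rewrite /h' indE hc mulr1 big1 ?mulr1// => i _.
  rewrite indE; case: lerP => // Ki; have := lmin _ Ki.
  by rewrite leqNgt (leq_ltn_trans (leq_ord i) kl).
have h'ge k : (l <= k)%N -> h' k w = 0.
  move=> lk; rewrite /h' (bigD1 (Ordinal (lk : (l < k.+1)%N)))//= [ind K _]indE.
  by rewrite leNgt Sl mul0r mulr0.
have : step_integral X t s h' (size s) w = S l w / c.
  rewrite /step_integral (big_cat_nat (n := l))//=.
  rewrite [X in _ + X]big_nat_cond [X in _ + X]big1; last first.
    by move=> k /andP[/andP[lk _] _]; rewrite h'ge// mul0r.
  rewrite addr0 /S /step_integral big_distrl/= [LHS]big_nat_cond [RHS]big_nat_cond.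
  apply: eq_bigr => k /andP[/andP[_ kl] _].
  by rewrite h'lt// mulrAC.
move=> E; rewrite /B /= -/(step_integral X t s h' (size s) w) E.
apply: (le_lt_trans C0C).
by rewrite normrM normfV (gtr0_norm c0) ltr_pdivlMr.
Qed.

End GoodIntegrator.

(* Triangular arrays: nu ranges over a family of partitions directed by Fil.
   A single random variable is an array that is constant in j. *)
Section Arrays.
Context {R : realType} {d : measure_display} {T : measurableType d}.
Variable P : probability T R.
Context {I : Type} (Fil : set_system I) {FF : Filter Fil}.
Implicit Types (a b : I -> nat -> T -> R).

(** Convergence to 0 in outer probability, uniformly in [j]; for arrays of partial sums this is a
    statement about the maximal sum. In [tight] the bound [C] is chosen before the partition. *)
Definition small a := forall e eta : R, 0 < e -> 0 < eta ->
  \forall nu \near Fil, outer_le P [set w | exists j, e < `|a nu j w|] eta.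

Definition tight a := forall eta : R, 0 < eta -> exists2 C : R, 0 < C &
  \forall nu \near Fil, outer_le P [set w | exists j, C < `|a nu j w|] eta.

Lemma small_le a b : (forall nu j w, `|a nu j w| <= `|b nu j w|) -> small b -> small a.
Proof.
move=> ab sb e eta e0 eta0; have := sb e eta e0 eta0; apply: filterS => nu.
by apply: outer_leS => w [j h]; exists j; exact: lt_le_trans (ab _ _ _).
Qed.

Lemma tight_le a b : (forall nu j w, `|a nu j w| <= `|b nu j w|) -> tight b -> tight a.
Proof.
move=> ab sb eta eta0; have [C C0 HC] := sb eta eta0; exists C => //.
move: HC; apply: filterS => nu.
by apply: outer_leS => w [j h]; exists j; exact: lt_le_trans (ab _ _ _).
Qed.

Lemma small_tight a : small a -> tight a.
Proof. by move=> sa eta eta0; exists 1 => //; exact: sa. Qed.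

Lemma small_eq a b : a = b -> small a -> small b. Proof. by move=> ->. Qed.
Lemma tight_eq a b : a = b -> tight a -> tight b. Proof. by move=> ->. Qed.

Lemma tight_cst (c : R) : tight (fun _ _ _ => c).
Proof.
move=> eta eta0; exists (`|c| + 1); first by rewrite ltr_pwDr.
near=> nu; rewrite /outer_le (_ : [set _ | _] = set0) ?mu_ext0 ?lee_fin ?ltW//.
by apply/seteqP; split => // w /= [_]; rewrite ltNge lerDl ler01.
Unshelve. all: by end_near. Qed.

Lemma small0 : small (fun _ _ _ => 0).
Proof.
move=> e eta e0 eta0.
near=> nu; rewrite /outer_le (_ : [set _ | _] = set0) ?mu_ext0 ?lee_fin ?ltW//.
by apply/seteqP; split => // w /= [_]; rewrite normr0 ltNge ltW.
Unshelve. all: by end_near. Qed.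

Lemma smallN a : small a -> small (fun nu j w => - a nu j w).
Proof. by apply: small_le => nu j w; rewrite normrN. Qed.

Lemma tightN a : tight a -> tight (fun nu j w => - a nu j w).
Proof. by apply: tight_le => nu j w; rewrite normrN. Qed.

Lemma smallD a b : small a -> small b -> small (fun nu j w => a nu j w + b nu j w).
Proof.
move=> sa sb e eta e0 eta0.
have e20 : 0 < e / 2 by rewrite divr_gt0.
have eta20 : 0 < eta / 2 by rewrite divr_gt0.
move: (sa _ _ e20 eta20) (sb _ _ e20 eta20); apply: filterS2 => nu ha hb; apply: outer_leS (outer_leU ha hb) => w [j h].
have [aj|aj] := ltP (e / 2) `|a nu j w|; [by left; exists j|right; exists j].
have := ler_normD (a nu j w) (b nu j w); move: h aj => /=; lra.
Qed.

Lemma tightD a b : tight a -> tight b -> tight (fun nu j w => a nu j w + b nu j w).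
Proof.
move=> sa sb eta eta0.
have eta20 : 0 < eta / 2 by rewrite divr_gt0.
have [C C0 HC] := sa _ eta20; have [D D0 HD] := sb _ eta20.
exists (C + D); first exact: addr_gt0.
move: HC HD; apply: filterS2 => nu ha hb; apply: outer_leS (outer_leU ha hb) => w [j h].
have [aj|aj] := ltP C `|a nu j w|; [by left; exists j|right; exists j].
have := ler_normD (a nu j w) (b nu j w); move: h aj => /=; lra.
Qed.

Lemma smallB a b : small a -> small b -> small (fun nu j w => a nu j w - b nu j w).
Proof. by move=> sa sb; exact: (smallD sa (smallN sb)). Qed.

Lemma tightB a b : tight a -> tight b -> tight (fun nu j w => a nu j w - b nu j w).
Proof. by move=> sa sb; exact: (tightD sa (tightN sb)). Qed.

Lemma smallM a b : tight a -> small b -> small (fun nu j w => a nu j w * b nu j w).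
Proof.
move=> sa sb e eta e0 eta0.
have eta20 : 0 < eta / 2 by rewrite divr_gt0.
have [C C0 HC] := sa _ eta20.
have eC0 : 0 < e / C by rewrite divr_gt0.
move: HC (sb _ _ eC0 eta20); apply: filterS2 => nu ha hb; apply: outer_leS (outer_leU ha hb) => w [j /= h].
have [aj|aj] := ltP C `|a nu j w|; [by left; exists j|right; exists j].
rewrite /= ltr_pdivrMr//; apply: (lt_le_trans h).
by rewrite normrM mulrC ler_wpM2l.
Qed.

Lemma tightM a b : tight a -> tight b -> tight (fun nu j w => a nu j w * b nu j w).
Proof.
move=> sa sb eta eta0.
have eta20 : 0 < eta / 2 by rewrite divr_gt0.
have [C C0 HC] := sa _ eta20; have [D D0 HD] := sb _ eta20.
exists (C * D); first exact: mulr_gt0.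
move: HC HD; apply: filterS2 => nu ha hb; apply: outer_leS (outer_leU ha hb) => w [j /= h].
have [aj|aj] := ltP C `|a nu j w|; [by left; exists j|right; exists j].
rewrite /= ltNge; apply/negP => bj; move: h; rewrite ltNge => /negP; apply.
by rewrite normrM ler_pM.
Qed.

Lemma small_sum (J : Type) (r : seq J) (F : J -> I -> nat -> T -> R) :
  (forall i, small (F i)) -> small (fun nu j w => \sum_(i <- r) F i nu j w).
Proof.
move=> sF; elim: r => [|x r IH].
  apply: small_eq small0.
  by apply/funext => nu; apply/funext => j; apply/funext => w; rewrite big_nil.
apply: small_eq (smallD (sF x) IH).
by apply/funext => nu; apply/funext => j; apply/funext => w; rewrite big_cons.
Qed.

Lemma tight_sum (J : Type) (r : seq J) (F : J -> I -> nat -> T -> R) :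
  (forall i, tight (F i)) -> tight (fun nu j w => \sum_(i <- r) F i nu j w).
Proof.
move=> sF; elim: r => [|x r IH].
  apply: tight_eq (small_tight small0).
  by apply/funext => nu; apply/funext => j; apply/funext => w; rewrite big_nil.
apply: tight_eq (tightD (sF x) IH).
by apply/funext => nu; apply/funext => j; apply/funext => w; rewrite big_cons.
Qed.

Lemma tight_norm a : tight a -> tight (fun nu j w => `|a nu j w|).
Proof. by apply: tight_le => nu j w; rewrite normr_id. Qed.

Lemma small_reindex a (p : I -> nat -> nat) : small a -> small (fun nu j => a nu (p nu j)).
Proof.
move=> sa e eta e0 eta0; have := sa e eta e0 eta0; apply: filterS => nu.
by apply: outer_leS => w [j h]; exists (p nu j).
Qed.

Lemma tight_reindex a (p : I -> nat -> nat) : tight a -> tight (fun nu j => a nu (p nu j)).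
Proof.
move=> sa eta eta0; have [C C0 HC] := sa eta eta0; exists C => //; move: HC; apply: filterS => nu.
by apply: outer_leS => w [j h]; exists (p nu j).
Qed.

Definition csum a : I -> nat -> T -> R := fun nu l w => \sum_(0 <= k < l) a nu k w.

Lemma csum_norm_le a nu l w : `|csum a nu l w| <= csum (fun nu j w => `|a nu j w|) nu l w.
Proof. exact: ler_norm_sum. Qed.

(** The supremum of |a| times the total variation of the partial sums of [b] bounds the sum. No
    adaptedness enters, so this rule serves the terms that contain products of increments. *)
Lemma small_csum a b : small a -> tight (csum (fun nu j w => `|b nu j w|)) ->
  small (csum (fun nu j w => a nu j w * b nu j w)).
Proof.
move=> sa tb e eta e0 eta0.
have eta20 : 0 < eta / 2 by rewrite divr_gt0.
have [C C0 HC] := tb _ eta20.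
have eC0 : 0 < e / C by rewrite divr_gt0.
move: HC (sa _ _ eC0 eta20); apply: filterS2 => nu ha hb; apply: outer_leS (outer_leU ha hb) => w [l h].
apply: contrapT => /not_orP[/forallNP h1 /forallNP h2].
move: h; apply/negP; rewrite -leNgt; apply: (le_trans (csum_norm_le _ _ _ _)).
rewrite /csum; apply: (@le_trans _ _ (\sum_(0 <= k < l) e / C * `|b nu k w|)).
  apply: ler_sum => k _; rewrite normrM ler_wpM2r//.
  by rewrite leNgt; apply/negP; exact: h2.
rewrite -big_distrr/= mulrAC ler_pdivrMr// ler_pM2l//.
have := h1 l => /= /negP; rewrite -leNgt; apply: le_trans; exact: ler_norm.
Qed.

Lemma tight_csum a b : tight a -> tight (csum (fun nu j w => `|b nu j w|)) ->
  tight (csum (fun nu j w => a nu j w * b nu j w)).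
Proof.
move=> sa tb eta eta0.
have eta20 : 0 < eta / 2 by rewrite divr_gt0.
have [C C0 HC] := tb _ eta20; have [D D0 HD] := sa _ eta20.
exists (D * C); first exact: mulr_gt0.
move: HC HD; apply: filterS2 => nu ha hb; apply: outer_leS (outer_leU ha hb) => w [l h].
apply: contrapT => /not_orP[/forallNP h1 /forallNP h2].
move: h; apply/negP; rewrite -leNgt; apply: (le_trans (csum_norm_le _ _ _ _)).
rewrite /csum; apply: (@le_trans _ _ (\sum_(0 <= k < l) D * `|b nu k w|)).
  apply: ler_sum => k _; rewrite normrM ler_wpM2r//.
  by rewrite leNgt; apply/negP; exact: h2.
rewrite -big_distrr/= ler_pM2l//.
have := h1 l => /= /negP; rewrite -leNgt; apply: le_trans; exact: ler_norm.
Qed.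

Lemma csumD a b nu l w :
  csum (fun nu j w => a nu j w + b nu j w) nu l w = csum a nu l w + csum b nu l w.
Proof. by rewrite /csum big_split. Qed.

Lemma small_csumD a b : small (csum a) -> small (csum b) ->
  small (csum (fun nu j w => a nu j w + b nu j w)).
Proof.
move=> sa sb; apply: small_eq (smallD sa sb).
by apply/funext => nu; apply/funext => j; apply/funext => w; rewrite csumD.
Qed.

Lemma tight_csumD a b : tight (csum a) -> tight (csum b) ->
  tight (csum (fun nu j w => a nu j w + b nu j w)).
Proof.
move=> sa sb; apply: tight_eq (tightD sa sb).
by apply/funext => nu; apply/funext => j; apply/funext => w; rewrite csumD.
Qed.

Lemma tight_csum_sum (J : Type) (r : seq J) (F : J -> I -> nat -> T -> R) :
  (forall i, tight (csum (F i))) -> tight (csum (fun nu j w => \sum_(i <- r) F i nu j w)).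
Proof.
move=> sF; apply: tight_eq (tight_sum r sF).
by apply/funext => nu; apply/funext => j; apply/funext => w; rewrite /csum exchange_big.
Qed.

End Arrays.

(** * Integrals and brackets along a family of partitions *)

Section PartitionArrays.
Context {R : realType} {d : measure_display} {T : measurableType d}.
Variables (P : probability T R) (W : R -> T -> R).
Hypothesis mW : forall t : R, 0 <= t -> measurable_fun [set: T] (W t).
Context {I : Type} (Fil : set_system I) {FF : Filter Fil}.
Variables (t : R) (sq : I -> seq R).
Hypothesis t0 : 0 <= t.
Hypothesis vsq : forall nu, itv_partition 0 t (sq nu).
Implicit Types (X Y Z : R -> T -> R) (a b h : I -> nat -> T -> R).

Local Notation CS := (continuous_semimartingale P W).
Local Notation tau nu j := (pt t (sq nu) j).

Definition smp X : I -> nat -> T -> R := fun nu j w => X (tau nu j) w.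
Definition inc X : I -> nat -> T -> R := fun nu j w => X (tau nu j.+1) w - X (tau nu j) w.
Definition adp h := forall nu, adapted_steps P W t (sq nu) (h nu).

Lemma adapted_measurable X s : adapted P W X -> 0 <= s -> measurable_fun [set: T] (X s).
Proof. by move=> aX s0; apply: (measurable_wrt_filtration mW (aX s s0)). Qed.

Lemma tight_process X (p : I -> nat -> R) : adapted P W X -> continuous_paths P X ->
  (forall nu j, 0 <= p nu j <= t) -> tight P Fil (fun nu j w => X (p nu j) w).
Proof.
move=> aX cX hp eta eta0.
have [C C0 HC] := paths_bounded (fun s => @adapted_measurable X s aX) cX t eta0.
exists C => //; near=> nu; apply: outer_leS HC => w [j h].
by exists (p nu j).
Unshelve. all: by end_near. Qed.

Lemma small_process_diff X (p q : I -> nat -> R) : adapted P W X -> continuous_paths P X ->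
  (forall nu j, 0 <= p nu j <= t) -> (forall nu j, 0 <= q nu j <= t) ->
  (forall D : R, 0 < D -> \forall nu \near Fil, forall j, `|p nu j - q nu j| < D) ->
  small P Fil (fun nu j w => X (p nu j) w - X (q nu j) w).
Proof.
move=> aX cX hp hq pq e eta e0 eta0.
have [D D0 HD] := paths_modulus (fun s => @adapted_measurable X s aX) cX t e0 eta0.
have := pq D D0; apply: filterS => nu Hnu; apply: outer_leS HD => w [j h].
by exists (p nu j), (q nu j).
Qed.

Lemma tau_itv nu j : 0 <= tau nu j <= t.
Proof. by rewrite pt_ge0 ?pt_le_end. Qed.

Lemma tight_smp X : CS X -> tight P Fil (smp X).
Proof. by move=> [aX cX _]; apply: tight_process => //; exact: tau_itv. Qed.

Lemma adp_smp X : adapted P W X -> adp (smp X).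
Proof. by move=> aX nu j; apply: aX; exact: pt_ge0. Qed.

Lemma adp_cst (c : R) : adp (fun _ _ _ => c).
Proof. by move=> nu j; exact: measurable_wrt_cst. Qed.

Lemma adpD a b : adp a -> adp b -> adp (fun nu j w => a nu j w + b nu j w).
Proof. by move=> ha hb nu j; apply: measurable_wrtD; [exact: ha|exact: hb]. Qed.

Lemma adpM a b : adp a -> adp b -> adp (fun nu j w => a nu j w * b nu j w).
Proof. by move=> ha hb nu j; apply: measurable_wrtM; [exact: ha|exact: hb]. Qed.

Lemma adpN a : adp a -> adp (fun nu j w => - a nu j w).
Proof.
move=> ha nu j; apply: (@measurable_wrt_comp _ _ _ _ _ -%R); last exact: ha.
exact: oppr_measurable.
Qed.

Lemma adpB a b : adp a -> adp b -> adp (fun nu j w => a nu j w - b nu j w).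
Proof. by move=> ha hb; exact: (adpD ha (adpN hb)). Qed.

Lemma adp_reindex a (p : I -> nat -> nat) : (forall nu j, (p nu j <= j)%N) -> adp a ->
  adp (fun nu j => a nu (p nu j)).
Proof.
by move=> hp ha nu j; apply: (measurable_wrt_le (pt_le (vsq nu) (hp nu j))); exact: ha.
Qed.

Lemma adp_csum_inc X h : adapted P W X -> adp h ->
  adp (csum (fun nu j w => h nu j w * inc X nu j w)).
Proof. by move=> aX ah nu; apply: step_integral_adapted. Qed.

Lemma tight_integral X h : CS X -> adp h -> tight P Fil h ->
  tight P Fil (csum (fun nu j w => h nu j w * inc X nu j w)).
Proof.
move=> [aX _ gX] ah th eta eta0.
have eta20 : 0 < eta / 2 by rewrite divr_gt0.
have [C C0 HC] := step_integral_max mW aX gX t0 eta20.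
have [D D0 HD] := th _ eta20.
exists (C * D); first exact: mulr_gt0.
move: HD; apply: filterS => nu hD.
apply: outer_leS (outer_leU (HC _ _ D (vsq nu) (ah nu) D0) hD) => w [l hl].
have [|/forallNP hn] := pselect (exists j, D < `|h nu j w|); first by right.
left; split; first by exists l.
by move=> j; rewrite leNgt; apply/negP; exact: hn.
Qed.

(** The increments of [X] need not be absolutely summable; adaptedness compensates for this. The
    bound of [step_integral_max] is linear in the bound of the integrand, hence the choice e / C. *)
Lemma small_integral X h : CS X -> adp h -> small P Fil h ->
  small P Fil (csum (fun nu j w => h nu j w * inc X nu j w)).
Proof.
move=> [aX _ gX] ah th e eta e0 eta0.
have eta20 : 0 < eta / 2 by rewrite divr_gt0.
have [C C0 HC] := step_integral_max mW aX gX t0 eta20.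
have eC0 : 0 < e / C by rewrite divr_gt0.
have := th _ _ eC0 eta20; apply: filterS => nu hD.
apply: outer_leS (outer_leU (HC _ _ (e / C) (vsq nu) (ah nu) eC0) hD) => w [l hl].
have [|/forallNP hn] := pselect (exists j, e / C < `|h nu j w|); first by right.
left; split; first by exists l; rewrite mulrC divfK// gt_eqF.
by move=> j; rewrite leNgt; apply/negP; exact: hn.
Qed.

(** Summation by parts, the discrete form of [X] = X^2 - X_0^2 - 2 int X dX. It reduces tightness of
    the quadratic variation to that of an integral with adapted integrand. *)
Lemma csum_sqr X nu l w : csum (fun nu j w => inc X nu j w * inc X nu j w) nu l w =
  smp X nu l w ^+ 2 - smp X nu 0%N w ^+ 2
  - 2 * csum (fun nu j w => smp X nu j w * inc X nu j w) nu l w.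
Proof.
rewrite /csum /smp /inc; elim: l => [|l IH]; first by rewrite !big_nil; ring.
by rewrite !big_nat_recr//= IH; ring.
Qed.

Lemma tight_quadratic X : CS X ->
  tight P Fil (csum (fun nu j w => inc X nu j w * inc X nu j w)).
Proof.
move=> sX; have tX := tight_smp sX; have [aX _ _] := sX.
have h1 : tight P Fil (fun nu j w => smp X nu j w ^+ 2).
  exact: (tightM tX tX).
have h2 : tight P Fil (fun nu l w => 2 * csum (fun nu j w => smp X nu j w * inc X nu j w) nu l w).
  by apply: tightM; [exact: tight_cst|apply: tight_integral => //; exact: adp_smp].
apply: tight_eq (tightB (tightB h1 (tight_reindex (fun _ _ => 0%N) h1)) h2).
by apply/funext => nu; apply/funext => j; apply/funext => w; rewrite csum_sqr.
Qed.

Lemma tight_bracket X Y : CS X -> CS Y ->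
  tight P Fil (csum (fun nu j w => `|inc X nu j w * inc Y nu j w|)).
Proof.
move=> sX sY; apply: tight_le (tightD (tight_quadratic sX) (tight_quadratic sY)) => nu l w.
rewrite ger0_norm; last by apply: sumr_ge0 => k _; exact: normr_ge0.
rewrite -csumD; apply: le_trans (ler_norm _); apply: ler_sum => k _.
by rewrite ler_norml; apply/andP; split; nra.
Qed.

Lemma small_bracket X Y a : CS X -> CS Y -> small P Fil a ->
  small P Fil (csum (fun nu j w => a nu j w * (inc X nu j w * inc Y nu j w))).
Proof. by move=> sX sY sa; apply: small_csum => //; exact: tight_bracket. Qed.

Lemma tight_csum_bracket X Y a : CS X -> CS Y -> tight P Fil a ->
  tight P Fil (csum (fun nu j w => a nu j w * (inc X nu j w * inc Y nu j w))).
Proof. by move=> sX sY sa; apply: tight_csum => //; exact: tight_bracket. Qed.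

Lemma small_inc X : CS X ->
  (forall D : R, 0 < D -> \forall nu \near Fil, forall j, tau nu j.+1 - tau nu j < D) ->
  small P Fil (inc X).
Proof.
move=> [aX cX _] mesh.
apply: (small_process_diff (p := fun nu j => tau nu j.+1) (q := fun nu j => tau nu j)) => //.
- by move=> nu j; exact: tau_itv.
- by move=> nu j; exact: tau_itv.
move=> D D0; have := mesh D D0; apply: filterS => nu h j.
by rewrite ger0_norm// subr_ge0 pt_leS.
Qed.

End PartitionArrays.

(** * Smooth functions of several variables *)

Section Smooth.
Context {R : realType} {m : nat}.
Implicit Types (f g : 'rV[R]_m -> R) (x y z u v : 'rV[R]_m).

Lemma smooth_differentiable f z : smooth f -> differentiable f z.
Proof. by move=> /(_ 1%N)[]. Qed.

Lemma smooth_continuous f : smooth f -> continuous f.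
Proof. by move=> /(_ 0%N). Qed.

Lemma smooth_partial a f : smooth f -> smooth (partial a f).
Proof. by move=> sf k; have [_ h] := sf k.+1; exact: h. Qed.

Lemma partialB a f g : (forall z, differentiable f z) -> (forall z, differentiable g z) ->
  partial a (fun z => f z - g z) = (fun z => partial a f z - partial a g z).
Proof.
move=> df dg; apply/funext => z; rewrite /partial.
by rewrite (@deriveB _ _ _ f g)//; exact: diff_derivable.
Qed.

Lemma CkB k f g : Ck k f -> Ck k g -> Ck k (fun z => f z - g z).
Proof.
elim: k f g => [f g cf cg|k IH f g [df pf] [dg pg]] /=.
  by move=> z; exact: (@continuousB _ _ _ f g z (cf z) (cg z)).
split=> [z|a]; first exact: differentiableB.
by rewrite partialB//; exact: (IH _ _ (pf a) (pg a)).
Qed.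

Lemma smoothB f g : smooth f -> smooth g -> smooth (fun z => f z - g z).
Proof. by move=> sf sg k; exact: CkB. Qed.

Lemma smooth_curl (L : 'I_m -> 'rV[R]_m -> R) a b : (forall a, smooth (L a)) ->
  smooth (curl L a b).
Proof. by move=> sL; apply: smoothB; exact: smooth_partial. Qed.

Lemma derive_coords f z v : differentiable f z ->
  'D_v f z = \sum_(a < m) v 0 a * partial a f z.
Proof.
move=> df; rewrite deriveE// {1}(row_sum_delta v) linear_sum/=.
by apply: eq_bigr => a _; rewrite linearZ/= /partial deriveE.
Qed.

Lemma is_derive_line f z v (s : R) : differentiable f (z + s *: v) ->
  is_derive s 1 (fun r : R => f (z + r *: v)) ('D_v f (z + s *: v)).
Proof.
move=> df; have dv : derivable f (z + s *: v) v by exact: diff_derivable.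
have E : (fun h : R => h^-1 *: (((fun r : R => f (z + r *: v)) \o shift s) (h *: 1) - f (z + s *: v)))
   = (fun h : R => h^-1 *: ((f \o shift (z + s *: v)) (h *: v) - f (z + s *: v))).
  apply/funext => h /=; congr (_ *: (f _ - _)).
  by rewrite [h *: 1]mulr1 scalerDl addrCA.
by split; rewrite /derivable /derive/= E.
Qed.

Lemma MVT01 (h h' : R -> R) : (forall s : R, is_derive s 1 h (h' s)) -> forall r : R, 0 < r ->
  exists2 s : R, 0 < s < r & h r - h 0 = h' s * r.
Proof.
move=> dh r r0.
have ch : {within `[0, r], continuous h}.
  by apply: derivable_within_continuous => s _; have [] := dh s.
have [c] := MVT r0 (fun s _ => dh s) ch.
by rewrite in_itv/= subr0 => c01 ->; exists c.
Qed.

(** The closed ball of the sup norm. Taylor constants are uniform on it, and by tightness the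
    sampled paths stay in such a ball with probability close to 1. *)
Definition cube (C : R) x := forall c, `|x 0 c| <= C.

Lemma cube_segment C x v (s : R) : cube C x -> cube C (x + v) -> 0 <= s <= 1 ->
  cube C (x + s *: v).
Proof.
move=> hx hy /andP[s0 s1] c; have := hx c; have := hy c; rewrite !mxE !ler_norml.
move=> /andP[h1 h2] /andP[h3 h4]; apply/andP; split; nra.
Qed.

Definition dist1 v : R := \sum_(c < m) `|v 0 c|.

Lemma dist1_ge0 v : 0 <= dist1 v.
Proof. by apply: sumr_ge0. Qed.

Lemma dist1_coord v c : `|v 0 c| <= dist1 v.
Proof. by rewrite /dist1 (bigD1 c)//= lerDl sumr_ge0. Qed.

Lemma dist1Z (s : R) v : dist1 (s *: v) = `|s| * dist1 v.
Proof. by rewrite /dist1 big_distrr/=; apply: eq_bigr => c _; rewrite mxE normrM. Qed.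

Lemma bounded_cube g (C : R) : continuous g ->
  exists2 K : R, 0 < K & forall x, cube C x -> `|g x| <= K.
Proof.
move=> cg.
have cA : compact [set x : 'rV[R]_m | forall c, `[- C, C]%classic (x 0 c)].
  by apply: (@rV_compact R m (fun=> `[- C, C]%classic)) => c; exact: segment_compact.
have /compact_bounded : compact (g @` [set x : 'rV[R]_m | forall c, `[- C, C]%classic (x 0 c)]).
  by apply: continuous_compact => //; exact: continuous_subspaceT.
move=> /pinfty_ex_gt0[K K0 HK]; exists K => // x hx; apply: HK => /=.
by exists x => // c; rewrite /= in_itv/= -ler_norml.
Qed.

Lemma bounded_cube_fin (J : finType) (g : J -> 'rV[R]_m -> R) (C : R) :
  (forall j, continuous (g j)) ->
  exists2 K : R, 0 < K & forall j x, cube C x -> `|g j x| <= K.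
Proof.
move=> cg; have /choice[K HK] : forall j, exists K : R, 0 < K /\ forall x, cube C x -> `|g j x| <= K.
  by move=> j; have [K K0 HK] := bounded_cube C (cg j); exists K.
(* The summand 1 keeps the bound positive when [J] is empty. *)
exists (1 + \sum_j K j); first by rewrite ltr_pwDl ?sumr_ge0// => j _; exact/ltW/(HK j).1.
move=> j x hx; apply: le_trans ((HK j).2 x hx) _.
rewrite (bigD1 j)//= addrCA lerDl addr_ge0// sumr_ge0// => i _; exact/ltW/(HK i).1.
Qed.

Lemma mean_value f x v : (forall z, differentiable f z) ->
  exists2 s : R, 0 < s < 1 & f (x + v) - f x = \sum_(a < m) v 0 a * partial a f (x + s *: v).
Proof.
move=> df; have [] := MVT01 (h := fun s => f (x + s *: v)) (h' := fun s => 'D_v f (x + s *: v)) _ ltr01.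
  by move=> s; exact: is_derive_line.
move=> s s01; rewrite scale1r scale0r addr0 mulr1 => E; exists s => //.
by rewrite E derive_coords.
Qed.

Lemma lipschitz_cube (J : finType) (g : J -> 'rV[R]_m -> R) (C : R) :
  (forall j, smooth (g j)) ->
  exists2 K : R, 0 < K & forall j x v, cube C x -> cube C (x + v) ->
    `|g j (x + v) - g j x| <= K * dist1 v.
Proof.
move=> sg.
have [|K K0 HK] := @bounded_cube_fin (J * 'I_m)%type (fun ja => partial ja.2 (g ja.1)) C.
  by move=> ja; exact/smooth_continuous/smooth_partial.
exists K => // j x v hx hy.
have [z|s /andP[s0 s1] ->] := @mean_value (g j) x v; first exact: smooth_differentiable.
apply: (le_trans (ler_norm_sum _ _ _)).
rewrite /dist1 big_distrr/=; apply: ler_sum => a _; rewrite normrM mulrC ler_wpM2r//.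
by apply: (HK (j, a)); apply: cube_segment => //; rewrite !ltW.
Qed.

Lemma taylor1 g (C : R) : smooth g ->
  exists2 K : R, 0 < K & forall x v, cube C x -> cube C (x + v) ->
    `|g (x + v) - g x - \sum_(c < m) partial c g x * v 0 c| <= K * (dist1 v * dist1 v).
Proof.
move=> sg; have [|K K0 HK] := @lipschitz_cube _ (fun c => partial c g) C.
  by move=> c; exact: smooth_partial.
exists K => // x v hx hy.
have [z|s /andP[s0 s1] ->] := @mean_value g x v; first exact: smooth_differentiable.
rewrite -sumrB; apply: (le_trans (ler_norm_sum _ _ _)).
rewrite mulrA [in leRHS]/dist1 big_distrr/=; apply: ler_sum => a _.
rewrite mulrC -mulrBl normrM ler_wpM2r//.
have hs : cube C (x + s *: v) by apply: cube_segment => //; rewrite !ltW.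
apply: (le_trans (HK a x _ hx hs)); rewrite dist1Z gtr0_norm// mulrA ler_wpM2r ?dist1_ge0//.
by rewrite ler_piMr// ltW.
Qed.

(** The averaged gradient absorbs the second-order terms of the Taylor expansion. That the error is
    of third order is the reason why Stratonovich integrals obey the ordinary chain rule. *)
Lemma trapezoid_rule g (C : R) : smooth g ->
  exists2 K : R, 0 < K & forall x v, cube C x -> cube C (x + v) ->
    `|g (x + v) - g x - \sum_(c < m) 2^-1 * (partial c g x + partial c g (x + v)) * v 0 c|
      <= K * (dist1 v * (dist1 v * dist1 v)).
Proof.
move=> sg.
have [|K K0 HK] := @lipschitz_cube ('I_m * 'I_m)%type (fun ce => partial ce.2 (partial ce.1 g)) C.
  by move=> c; do 2!apply: smooth_partial.
exists K => // x v hx hy.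
pose p1 s := \sum_(c < m) v 0 c * partial c g (x + s *: v).
pose p2 s := \sum_(c < m) v 0 c * \sum_(e < m) v 0 e * partial e (partial c g) (x + s *: v).
have d1 (s : R) : is_derive s 1 (fun s => g (x + s *: v)) (p1 s).
  by rewrite /p1 -derive_coords; [apply: is_derive_line|]; exact: smooth_differentiable.
have d2 (s : R) : is_derive s 1 p1 (p2 s).
  have -> : p1 = \sum_(c < m) (fun s : R => v 0 c *: partial c g (x + s *: v)).
    by apply/funext => r; rewrite fct_sumE.
  rewrite /p2; apply: is_derive_sum => c.
  apply: is_deriveZ; rewrite -derive_coords; last exact/smooth_differentiable/smooth_partial.
  by apply: is_derive_line; exact/smooth_differentiable/smooth_partial.
(* The error of the rule on the segment from [x] to x + s v. By the mean value theorem its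
   derivative at s is s/2 times a difference of two values of [p2], so a Lipschitz bound on the
   second derivatives of [g] suffices. *)
pose psi (s : R) := g (x + s *: v) - g x - (2^-1 * s) * (p1 0 + p1 s).
pose psi' (s : R) := p1 s - (2^-1 * s * p2 s + 2^-1 * (p1 0 + p1 s)).
have d3 (s : R) : is_derive s 1 psi (psi' s).
  have e1 : is_derive s 1 (fun s : R => 2^-1 * s) (2^-1).
    by apply: is_derive_eq; rewrite /= ?scaler0 ?add0r ?addr0; exact: mulr1.
  have e2 : is_derive s 1 (fun s : R => p1 0 + p1 s) (p2 s).
    by have := is_deriveD (is_derive_cst (p1 0) s 1) (d2 s); rewrite add0r.
  have e3 := is_deriveM e1 e2.
  have e4 := d1 s.
  rewrite /psi /psi'.
  apply: is_derive_eq; rewrite subr0.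
  by congr (_ - (_ + _)); rewrite /GRing.scale/= mulrC.
have [s /andP[s0 s1]] := MVT01 d3 ltr01.
have -> : psi 0 = 0 by rewrite /psi scale0r addr0 subrr mulr0 mul0r subr0.
rewrite subr0 mulr1.
have -> : psi 1 = g (x + v) - g x - \sum_(c < m) 2^-1 * (partial c g x + partial c g (x + v)) * v 0 c.
  rewrite /psi scale1r mulr1; congr (_ - _ - _).
  rewrite /p1 -big_split/= big_distrr/=; apply: eq_bigr => c _.
  by rewrite scale0r addr0 scale1r; ring.
move=> ->.
have [r /andP[r0 rs] p1E] := MVT01 d2 s0.
have -> : psi' s = 2^-1 * s * (p2 r - p2 s).
  move: p1E; rewrite /psi'; move: (p1 s) (p1 0) (p2 r) (p2 s) => A B C' E AB.
  have -> : A = B + C' * s by rewrite -AB addrC subrK.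
  by field.
have K1 : `|p2 r - p2 s| <= K * (dist1 v * (dist1 v * dist1 v)).
  rewrite /p2 -sumrB; apply: (le_trans (ler_norm_sum _ _ _)).
  apply: (@le_trans _ _ (\sum_(c < m) `|v 0 c| * (K * (dist1 v * dist1 v)))); last first.
    by rewrite -big_distrl/= -/(dist1 v) mulrCA.
  apply: ler_sum => c _; rewrite -mulrBr normrM ler_wpM2l//.
  rewrite -sumrB; apply: (le_trans (ler_norm_sum _ _ _)).
  apply: (@le_trans _ _ (\sum_(c < m) `|v 0 c| * (K * dist1 v))); last first.
    by rewrite -big_distrl/= -/(dist1 v) mulrCA.
  apply: ler_sum => e _; rewrite -mulrBr normrM ler_wpM2l//.
  have hr : cube C (x + r *: v) by apply: cube_segment => //; lra.
  have hs : cube C (x + s *: v) by apply: cube_segment => //; lra.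
  have xrs : x + r *: v = x + s *: v + (r - s) *: v.
    by rewrite scalerBl -!addrA; congr (_ + _); rewrite addrCA subrr addr0.
  rewrite xrs; apply: (le_trans (HK (c, e) _ _ hs _)); first by rewrite -xrs.
  rewrite dist1Z mulrA ler_wpM2r ?dist1_ge0// ler_piMr ?ltW//.
  by rewrite ltr_norml; apply/andP; split; lra.
rewrite normrM; apply: le_trans K1; rewrite ler_piMl// ger0_norm ?mulr_ge0//; lra.
Qed.

(** Schwarz's theorem. The mean value theorem, applied in either order of the variables, writes one
    and the same second difference of [f] as h^2 times a mixed derivative near [z]; both mixed
    derivatives are continuous at [z]. *)
Lemma partialC a b f : smooth f -> partial a (partial b f) = partial b (partial a f).
Proof.
move=> sf; apply/funext => z; apply/eqP; rewrite -subr_eq0 -normr_le0 leNgt; apply/negP.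
set e := `|_| => e0.
pose da : 'rV[R]_m := delta_mx 0 a; pose db : 'rV[R]_m := delta_mx 0 b.
have key (c1 c2 : 'I_m) (h : R) : 0 < h -> exists s r : R, [/\ 0 < s < h, 0 < r < h &
    f (z + h *: delta_mx 0 c1 + h *: delta_mx 0 c2) - f (z + h *: delta_mx 0 c1)
     - f (z + h *: delta_mx 0 c2) + f z =
    partial c2 (partial c1 f) (z + s *: delta_mx 0 c1 + r *: delta_mx 0 c2) * h * h].
  move=> h0.
  pose G (s : R) := f (z + h *: delta_mx 0 c2 + s *: delta_mx 0 c1) - f (z + s *: delta_mx 0 c1).
  pose G' (s : R) := partial c1 f (z + h *: delta_mx 0 c2 + s *: delta_mx 0 c1)
     - partial c1 f (z + s *: delta_mx 0 c1).
  have dG (s : R) : is_derive s 1 G (G' s).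
    by apply: is_deriveB; apply: is_derive_line; exact: smooth_differentiable.
  have [s s0h GE] := MVT01 dG h0.
  have dF (r : R) : is_derive r 1 (fun r : R => partial c1 f (z + s *: delta_mx 0 c1 + r *: delta_mx 0 c2))
      (partial c2 (partial c1 f) (z + s *: delta_mx 0 c1 + r *: delta_mx 0 c2)).
    by apply: is_derive_line; exact/smooth_differentiable/smooth_partial.
  have [r r0h FE] := MVT01 dF h0.
  exists s, r; split => //; rewrite -FE.
  have -> : partial c1 f (z + s *: delta_mx 0 c1 + h *: delta_mx 0 c2)
      - partial c1 f (z + s *: delta_mx 0 c1 + 0 *: delta_mx 0 c2) = G' s.
    by rewrite scale0r addr0 /G' addrAC.
  by rewrite -GE /G !scale0r !addr0 [z + h *: delta_mx 0 c2 + _]addrAC; ring.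
have e20 : 0 < e / 2 by rewrite divr_gt0.
have near_eq c1 c2 : exists2 D : R, 0 < D & forall s r h : R, 0 < s < h -> 0 < r < h -> h < D ->
    `|partial c2 (partial c1 f) z -
      partial c2 (partial c1 f) (z + s *: delta_mx 0 c1 + r *: delta_mx 0 c2)| < e / 2.
  have /(_ z) := smooth_continuous (smooth_partial c2 (smooth_partial c1 sf)).
  move=> /cvgrPdist_lt /(_ _ e20) /nbhs_ballP[D /= D0 HD].
  (* The two displacements may affect the same coordinate, so each gets half of [D]. *)
  exists (D / 2); first by rewrite divr_gt0.
  move=> s r h /andP[s0 sh] /andP[r0 rh] hD; apply: HD; split => // i j.
  rewrite /ball/= !mxE (ord1 i) -addrA opprD addNKr.
  rewrite normrN; apply: le_lt_trans (ler_normD _ _) _.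
  rewrite !normrM (gtr0_norm s0) (gtr0_norm r0).
  have b01 (o : bool) : `|o%:R : R| <= 1 by case: o; rewrite ?normr1 ?normr0.
  have := b01 ((0 == 0 :> 'I_1) && (j == c1)); have := b01 ((0 == 0 :> 'I_1) && (j == c2)).
  move=> h1 h2; nra.
have [D1 D10 H1] := near_eq a b; have [D2 D20 H2] := near_eq b a.
have [h [h0 hD1 hD2]] : exists h : R, [/\ 0 < h, h < D1 & h < D2].
  exists (Num.min D1 D2 / 2); have h0 : 0 < Num.min D1 D2 by rewrite lt_min D10.
  have h1 : Num.min D1 D2 <= D1 by rewrite ge_min lexx.
  have h2 : Num.min D1 D2 <= D2 by rewrite ge_min lexx orbT.
  by split; lra.
have [s [r [sh rh E1]]] := key a b h h0; have [s' [r' [sh' rh' E2]]] := key b a h h0.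
have := H1 _ _ _ sh rh hD1; have := H2 _ _ _ sh' rh' hD2.
have : partial b (partial a f) (z + s *: delta_mx 0 a + r *: delta_mx 0 b) =
       partial a (partial b f) (z + s' *: delta_mx 0 b + r' *: delta_mx 0 a).
  move: E1 E2; rewrite [z + h *: delta_mx 0 b + _]addrAC.
  set A := partial b _ _; set B := partial a _ _ => E1 E2.
  have hh : h != 0 by rewrite gt_eqF.
  have cancel (x y c : R) : c = x * h * h -> c = y * h * h -> x = y.
    by move=> -> /(mulIf hh)/(mulIf hh).
  apply: (cancel _ _ _ _ E2); rewrite -E1; congr (_ + _).
  by rewrite -!addrA; congr (_ + _); rewrite addrC.
move=> ->; set p := partial a (partial b f) (_ + _) => h2 h1.
have tri (A B q : R) : `|A - B| <= `|A - q| + `|B - q|.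
  by rewrite (distrC B); exact: ler_distD.
have := ltrD h2 h1; rewrite -splitr => /(le_lt_trans (tri _ _ _)).
by rewrite -/e ltxx.
Qed.

End Smooth.

(** * Closure properties of continuous semimartingales *)

Section Paths.
Context {R : realType} {d : measure_display} {T : measurableType d}.
Variable P : probability T R.
Implicit Types X Y : R -> T -> R.

Lemma ae2 (A B C : T -> Prop) : (forall w, A w -> B w -> C w) ->
  {ae P, forall w, A w} -> {ae P, forall w, B w} -> {ae P, forall w, C w}.
Proof.
move=> h nA nB; apply: negligibleS (negligibleU nA nB) => w /= nC.
apply: contrapT => /not_orP[/contrapT a /contrapT b]; exact: nC (h w a b).
Qed.

Lemma continuous_paths_cst (f : T -> R) : continuous_paths P (fun _ => f).
Proof. by apply: aeW => w; apply: continuous_subspaceT => x; exact: cvg_cst. Qed.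

Lemma continuous_pathsD X Y : continuous_paths P X -> continuous_paths P Y ->
  continuous_paths P (fun t w => X t w + Y t w).
Proof. by apply: ae2 => w cx cy x; apply: cvgD; [exact: cx|exact: cy]. Qed.

Lemma continuous_pathsM X Y : continuous_paths P X -> continuous_paths P Y ->
  continuous_paths P (fun t w => X t w * Y t w).
Proof. by apply: ae2 => w cx cy x; apply: cvgM; [exact: cx|exact: cy]. Qed.

Lemma ae_forall_fin (J : finType) (Q : J -> T -> Prop) :
  (forall j, {ae P, forall w, Q j w}) -> {ae P, forall w, forall j, Q j w}.
Proof.
move=> h; have : P.-negligible (\big[setU/set0]_(j : J) [set w | ~ Q j w]).
  by elim/big_ind : _ => [|A B nA nB|j _]; [exact: negligible_set0|exact: negligibleU|exact: h].
apply: negligibleS => w /= /existsNP[j nq].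
by rewrite -bigcup_seq/=; exists j => //=; rewrite mem_index_enum.
Qed.

Lemma continuous_paths_comp m (Z : R -> T -> 'rV[R]_m) (g : 'rV[R]_m -> R) : continuous g ->
  (forall c, continuous_paths P (fun t w => Z t w 0 c)) ->
  continuous_paths P (fun t w => g (Z t w)).
Proof.
move=> cg cZ; have := ae_forall_fin cZ; apply: filterS => w cw x.
apply: (continuous_comp (f := Z ^~ w : subspace `[0, +oo[ -> _) (g := g)); last exact: cg.
apply/cvg_ballP => e e0.
have : forall c : 'I_m, \forall y \near (x : subspace `[0, +oo[), ball (Z x w 0 c) e (Z y w 0 c).
  by move=> c; have /cvg_ballP := cw c x; apply.
move=> /filter_forall; apply: filterS => y h; split => // i j.
by rewrite (ord1 i); exact: h.
Qed.

End Paths.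

Section Closure.
Context {R : realType} {d : measure_display} {T : measurableType d}.
Variables (P : probability T R) (W : R -> T -> R).
Hypothesis mW : forall t : R, 0 <= t -> measurable_fun [set: T] (W t).
Implicit Types (X Y : R -> T -> R).
Local Notation CS := (continuous_semimartingale P W).

(** Arrays are indexed here by all pairs of a partition and an adapted integrand bounded by 1, under
    the filter [globally], for which an eventual bound is a bound for every index. Tightness of this
    single array is the good integrator property. *)
Lemma good_integratorP X : adapted P W X ->
  (forall (t : R) (I : Type) (Fil : set_system I) (FF : Filter Fil) (sq : I -> seq R)
     (h : I -> nat -> T -> R), 0 <= t -> (forall nu, itv_partition 0 t (sq nu)) ->
     adp P W t sq h -> tight P Fil h ->
     tight P Fil (csum (fun nu j w => h nu j w * inc t sq X nu j w))) ->
  good_integrator P W X.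
Proof.
move=> aX H t e t0 e0.
pose I := {sh : seq R * (nat -> T -> R) | [/\ itv_partition 0 t sh.1,
  adapted_steps P W t sh.1 sh.2 & forall k w, `|sh.2 k w| <= 1]}.
pose sq (nu : I) := (sval nu).1; pose h (nu : I) := (sval nu).2.
have vsq nu : itv_partition 0 t (sq nu) by have [] := svalP nu.
have ah : adp P W t sq h by move=> nu; have [] := svalP nu.
have FF : Filter (globally [set: I]) by exact: globally_filter.
have th : tight P (globally [set: I]) h.
  apply: (@tight_le _ _ _ _ _ _ FF _ (fun _ _ _ => 1)); last exact: tight_cst.
  by move=> nu j w; rewrite normr1; have [_ _] := svalP nu; apply.
have [C C0 HC] := H t I _ FF sq h t0 vsq ah th e e0.
exists C => s h0 ps mh0 h01.
(* Extended by 0, the integrand is adapted at every index; beyond the partition nothing was assumed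
   of [h0]. *)
pose h1 k := if (k < size s)%N then h0 k else fun=> 0.
have ah1 : adapted_steps P W t s h1.
  by move=> k; rewrite /h1; case: ifP => ks; [exact: mh0|exact: measurable_wrt_cst].
have h11 k w : `|h1 k w| <= 1.
  by rewrite /h1; case: ifP => ks; rewrite ?normr0 ?ler01.
pose nu : I := exist _ (s, h1) (And3 ps ah1 h11).
have := HC nu Logic.I; rewrite /outer_le.
set B := [set w | _] => HB; set A := [set w | _].
have E w : \sum_(0 <= k < size s) h0 k w * (X (pt t s k.+1) w - X (pt t s k) w) =
    step_integral X t s h1 (size s) w.
  rewrite /step_integral big_nat_cond [RHS]big_nat_cond; apply: eq_bigr => k /andP[/andP[_ ks] _].
  by rewrite /h1 ks.
have BA : A = [set w | C < `|step_integral X t s h1 (size s) w|].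
  by apply/funext => w; rewrite /A /mkset -E.
rewrite -mu_ext_measurable; last first.
  rewrite BA; apply: measurable_cst_lt; apply: measurableT_comp => //.
  apply: (measurable_wrt_filtration (P := P) mW (t := pt t s (size s))).
  exact: step_integral_adapted.
apply: le_trans HB; apply: mu_extS => w; rewrite BA => hw.
by exists (size s).
Qed.

Lemma continuous_semimartingale_cst (c : R) : CS (fun _ _ => c).
Proof.
have a : adapted P W (fun _ _ => c) by move=> t _; exact: measurable_wrt_cst.
split => //; first exact: continuous_paths_cst.
apply: good_integratorP => // t I Fil FF sq h t0 ps ah th.
apply: (tight_eq _ (small_tight (small0 P (Fil := Fil)))).
apply/funext => nu; apply/funext => l; apply/funext => w.
by rewrite /csum big1// => k _; rewrite /inc subrr mulr0.
Qed.

Lemma continuous_semimartingaleD X Y : CS X -> CS Y -> CS (fun t w => X t w + Y t w).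
Proof.
move=> sX sY; have [aX cX _] := sX; have [aY cY _] := sY.
have a : adapted P W (fun t w => X t w + Y t w).
  by move=> t t0; apply: measurable_wrtD; [exact: aX|exact: aY].
split => //; first exact: continuous_pathsD.
apply: good_integratorP => // t I Fil FF sq h t0 ps ah th.
pose proof (tight_integral mW t0 ps sX ah th) as hX; pose proof (tight_integral mW t0 ps sY ah th) as hY.
apply: tight_eq (tight_csumD hX hY).
apply/funext => nu; apply/funext => l; apply/funext => w.
by rewrite /csum; apply: eq_bigr => k _; rewrite /inc; ring.
Qed.

(** The increment of X Y is exactly Y dX + X dY + dX dY, and the last term sums to a tight
    bracket. *)
Lemma continuous_semimartingaleM X Y : CS X -> CS Y -> CS (fun t w => X t w * Y t w).
Proof.
move=> sX sY; have [aX cX _] := sX; have [aY cY _] := sY.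
have a : adapted P W (fun t w => X t w * Y t w).
  by move=> t t0; apply: measurable_wrtM; [exact: aX|exact: aY].
split => //; first exact: continuous_pathsM.
apply: good_integratorP => // t I Fil FF sq h t0 ps ah th.
pose proof (tight_integral mW t0 ps sX (adpM ah (adp_smp ps aY)) (tightM th (tight_smp mW ps sY))) as h1.
pose proof (tight_integral mW t0 ps sY (adpM ah (adp_smp ps aX)) (tightM th (tight_smp mW ps sX))) as h2.
pose proof (tight_csum_bracket mW t0 ps sX sY th) as h3.
apply: tight_eq (tight_csumD (tight_csumD h1 h2) h3).
apply/funext => nu; apply/funext => l; apply/funext => w.
by rewrite /csum; apply: eq_bigr => k _; rewrite /inc /smp; ring.
Qed.

Lemma continuous_semimartingale_sum (J : Type) (r : seq J) (F : J -> R -> T -> R) :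
  (forall j, CS (F j)) -> CS (fun t w => \sum_(j <- r) F j t w).
Proof.
move=> sF; elim: r => [|x r IH].
  have := continuous_semimartingale_cst 0; congr (CS _).
  by apply/funext => t; apply/funext => w; rewrite big_nil.
have := continuous_semimartingaleD (sF x) IH; congr (CS _).
by apply/funext => t; apply/funext => w; rewrite big_cons.
Qed.

End Closure.

(** * Smooth functions of semimartingales *)

Section SmoothFunctions.
Context {R : realType} {d : measure_display} {T : measurableType d}.
Variables (P : probability T R) (W : R -> T -> R).
Hypothesis mW : forall t : R, 0 <= t -> measurable_fun [set: T] (W t).
Context {m : nat} (Z : R -> T -> 'rV[R]_m).
Local Notation CS := (continuous_semimartingale P W).
Hypothesis sZ : forall c, CS (fun t w => Z t w 0 c).

Lemma adapted_comp (g : 'rV[R]_m -> R) : continuous g ->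
  adapted P W (fun t w => g (Z t w)).
Proof.
move=> cg t t0; apply: measurable_wrt_continuous => // a.
by have [aZ _ _] := sZ a; exact: aZ.
Qed.

Lemma continuous_paths_comp_semimartingale (g : 'rV[R]_m -> R) : continuous g ->
  continuous_paths P (fun t w => g (Z t w)).
Proof. by move=> cg; apply: continuous_paths_comp => // a; have [] := sZ a. Qed.

Section FixedPartitions.
Context {I : Type} (Fil : set_system I) {FF : Filter Fil}.
Variables (t : R) (sq : I -> seq R).
Hypothesis t0 : 0 <= t.
Hypothesis vsq : forall nu, itv_partition 0 t (sq nu).
Local Notation tau nu j := (pt t (sq nu) j).

(** Taylor bounds have a constant that depends on the cube visited by the path. Dividing by [q]
    turns such a bound into a tight coefficient. Where [q] vanishes the bound forces [r] to vanish
    too, so the convention 0^-1 = 0 is harmless. *)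
Lemma tight_remainder (r q : I -> nat -> T -> R) :
  (forall C : R, exists2 K : R, 0 < K & forall nu j w,
     cube C (Z (tau nu j) w) -> cube C (Z (tau nu j.+1) w) ->
     `|r nu j w| <= K * `|q nu j w|) ->
  tight P Fil (fun nu j w => r nu j w / q nu j w) /\
  forall nu j w, r nu j w = r nu j w / q nu j w * q nu j w.
Proof.
move=> H; split; last first.
  move=> nu j w; have [q0|q0] := eqVneq (q nu j w) 0; last by rewrite divfK.
  pose C := dist1 (Z (tau nu j) w) + dist1 (Z (tau nu j.+1) w).
  have [K K0 HK] := H C; have := HK nu j w.
  rewrite q0 normr0 !mulr0 normr_le0 => h; apply/eqP/h => c.
    by apply: (le_trans (dist1_coord _ _)); rewrite /C lerDl dist1_ge0.
  by apply: (le_trans (dist1_coord _ _)); rewrite /C lerDr dist1_ge0.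
move=> eta eta0.
have tZ : tight P Fil (fun nu j w => \sum_(c < m) `|Z (tau nu j) w 0 c|).
  apply: (@tight_sum _ _ _ _ _ _ FF _ _ (fun c nu j w => `|Z (tau nu j) w 0 c|)) => c.
  apply: (tight_norm (a := fun nu j w => Z (tau nu j) w 0 c)).
  exact: (tight_smp mW vsq (sZ c)).
have [C C0 HC] := tZ _ eta0; have [K K0 HK] := H C.
exists K => //; move: HC; apply: filterS => nu; apply: outer_leS => w [j hj].
apply: contrapT => /forallNP nC; move: hj; apply/negP; rewrite -leNgt.
have cC k : cube C (Z (tau nu k) w).
  move=> c; have /= /negP := nC k; rewrite -leNgt; apply: le_trans.
  by apply: le_trans (ler_norm _); exact: dist1_coord.
have := HK nu j w (cC j) (cC j.+1) => h.
have [q0|q0] := eqVneq (q nu j w) 0; first by rewrite q0 invr0 mulr0 normr0 ltW.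
by rewrite normrM normfV ler_pdivrMr// normr_gt0.
Qed.

Definition dz1 : I -> nat -> T -> R :=
  fun nu j w => dist1 (Z (tau nu j.+1) w - Z (tau nu j) w).

Lemma dz1_sqr nu j w : dz1 nu j w * dz1 nu j w = \sum_(c < m) \sum_(e < m)
  `|inc t sq (fun t w => Z t w 0 c) nu j w * inc t sq (fun t w => Z t w 0 e) nu j w|.
Proof.
rewrite /dz1 /dist1 big_distrl/=; apply: eq_bigr => c _.
rewrite big_distrr/=; apply: eq_bigr => e _.
by rewrite normrM /inc !mxE.
Qed.

Lemma tight_dz1_sqr : tight P Fil (csum (fun nu j w => `|dz1 nu j w * dz1 nu j w|)).
Proof.
have h : tight P Fil (csum (fun nu j w => \sum_(c < m) \sum_(e < m)
  `|inc t sq (fun t w => Z t w 0 c) nu j w * inc t sq (fun t w => Z t w 0 e) nu j w|)).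
  apply: tight_csum_sum => c; apply: tight_csum_sum => e.
  exact: (tight_bracket mW t0 vsq (sZ c) (sZ e)).
apply: tight_eq h; apply/funext => nu; apply/funext => l; apply/funext => w.
apply: eq_bigr => k _; rewrite -dz1_sqr ger0_norm//.
by rewrite mulr_ge0 ?dist1_ge0.
Qed.

Lemma tight_continuous (g : 'rV[R]_m -> R) : continuous g ->
  tight P Fil (smp t sq (fun t w => g (Z t w))).
Proof.
move=> cg; apply: (tight_process mW (p := fun nu j => tau nu j) (X := fun t w => g (Z t w)) (t := t)).
- exact: adapted_comp.
- exact: continuous_paths_comp_semimartingale.
by move=> nu j; rewrite pt_ge0 ?pt_le_end.
Qed.

Lemma cubeP_shift (nu : I) j w (C : R) : cube C (Z (tau nu j.+1) w) ->
  cube C (Z (tau nu j) w + (Z (tau nu j.+1) w - Z (tau nu j) w)).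
Proof. by rewrite addrC subrK. Qed.

(** In the first-order Taylor formula the linear part is an integral against the coordinates of [Z]
    with adapted integrand, and the remainder is a tight multiple of squared increments, whose sums
    are tight. *)
Lemma tight_integral_comp (g : 'rV[R]_m -> R) h : smooth g ->
  adp P W t sq h -> tight P Fil h ->
  tight P Fil (csum (fun nu j w => h nu j w * inc t sq (fun t w => g (Z t w)) nu j w)).
Proof.
move=> sg ah th.
pose r nu j w := inc t sq (fun t w => g (Z t w)) nu j w -
  \sum_(c < m) partial c g (Z (tau nu j) w) * inc t sq (fun t w => Z t w 0 c) nu j w.
have [tr rE] : tight P Fil (fun nu j w => r nu j w / (dz1 nu j w * dz1 nu j w)) /\
  forall nu j w, r nu j w = r nu j w / (dz1 nu j w * dz1 nu j w) * (dz1 nu j w * dz1 nu j w).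
  apply: tight_remainder => C; have [K K0 HK] := taylor1 C sg.
  exists K => // nu j w cj cj1; have := HK _ _ cj (cubeP_shift cj1).
  rewrite [Z (tau nu j) w + _]addrC subrK => h1.
  rewrite [`|dz1 _ _ _ * _|]ger0_norm ?mulr_ge0 ?dist1_ge0//; apply: le_trans h1.
  rewrite le_eqVlt; apply/orP; left; apply/eqP; congr (`|_ - _|).
  by apply: eq_bigr => c _; rewrite /inc !mxE.
have h1 : tight P Fil (csum (fun nu j w => \sum_(c < m)
    h nu j w * partial c g (Z (tau nu j) w) * inc t sq (fun t w => Z t w 0 c) nu j w)).
  apply: tight_csum_sum => c; apply: (tight_integral mW t0 vsq (sZ c)).
    apply: adpM => //; apply: (adp_smp vsq (X := fun t w => partial c g (Z t w))).
    exact: (adapted_comp (smooth_continuous (smooth_partial c sg))).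
  apply: tightM => //; apply: (tight_continuous (g := partial c g)).
  exact/smooth_continuous/smooth_partial.
pose proof (tight_csum (tightM th tr) tight_dz1_sqr) as h2.
apply: tight_eq (tight_csumD h1 h2).
apply/funext => nu; apply/funext => l; apply/funext => w; apply: eq_bigr => k _.
rewrite -[h nu k w * _ * _]mulrA -rE /r.
under eq_bigr do rewrite -mulrA.
by rewrite -big_distrr/= -mulrDr addrC subrK.
Qed.

(** The remainder is a tight coefficient times the cube of the increment: one factor is small, the
    sum of the squares is tight. The estimate is in absolute values, so the weight may involve the
    right end of the step, as trapezoidal weights do. *)
Lemma small_trapezoid (g : 'rV[R]_m -> R) (h : I -> nat -> T -> R) : smooth g -> tight P Fil h ->
  (forall D : R, 0 < D -> \forall nu \near Fil, forall j, tau nu j.+1 - tau nu j < D) ->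
  small P Fil (csum (fun nu j w => h nu j w * (inc t sq (fun t w => g (Z t w)) nu j w
    - \sum_(c < m) 2^-1 * (partial c g (Z (tau nu j) w) + partial c g (Z (tau nu j.+1) w))
       * inc t sq (fun t w => Z t w 0 c) nu j w))).
Proof.
move=> sg th mesh.
pose r nu j w := inc t sq (fun t w => g (Z t w)) nu j w
    - \sum_(c < m) 2^-1 * (partial c g (Z (tau nu j) w) + partial c g (Z (tau nu j.+1) w))
       * inc t sq (fun t w => Z t w 0 c) nu j w.
pose q nu j w := dz1 nu j w * (dz1 nu j w * dz1 nu j w).
have [tr rE] : tight P Fil (fun nu j w => r nu j w / q nu j w) /\
  forall nu j w, r nu j w = r nu j w / q nu j w * q nu j w.
  apply: tight_remainder => C; have [K K0 HK] := trapezoid_rule C sg.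
  exists K => // nu j w cj cj1; have := HK _ _ cj (cubeP_shift cj1).
  rewrite [Z (tau nu j) w + _]addrC subrK => h1.
  rewrite [`|q _ _ _|]ger0_norm ?mulr_ge0 ?dist1_ge0//; apply: le_trans h1.
  rewrite le_eqVlt; apply/orP; left; apply/eqP; congr (`|_ - _|).
  by apply: eq_bigr => c _; rewrite /inc !mxE.
have sd : small P Fil dz1.
  apply: (small_eq (a := fun nu j w => \sum_(c < m) `|inc t sq (fun t w => Z t w 0 c) nu j w|)).
    apply/funext => nu; apply/funext => l; apply/funext => w.
    by apply: eq_bigr => c _; rewrite /inc !mxE.
  apply: small_sum => c; apply: small_le (small_inc mW vsq (sZ c) mesh) => nu j w.
  by rewrite normr_id.
pose proof (small_csum (smallM (tightM th tr) sd) tight_dz1_sqr) as h2.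
apply: small_eq h2.
apply/funext => nu; apply/funext => l; apply/funext => w; apply: eq_bigr => k _.
by rewrite -2!mulrA -rE.
Qed.

End FixedPartitions.

Lemma continuous_semimartingale_comp (g : 'rV[R]_m -> R) : smooth g ->
  CS (fun t w => g (Z t w)).
Proof.
move=> sg; have cg := smooth_continuous sg; split.
- exact: adapted_comp.
- exact: continuous_paths_comp_semimartingale.
apply: good_integratorP => //; first exact: adapted_comp.
by move=> t I Fil FF sq h t0 vsq ah th; exact: tight_integral_comp.
Qed.

End SmoothFunctions.

(** * Brownian motion is a good integrator *)

Section NormalMoments.
Context {R : realType}.
Local Notation mu := (@lebesgue_measure R).
Implicit Types (s x : R).

(** The Radon-Nikodym density of the normal law agrees almost everywhere with [normal_pdf], both
    having the same integral over every measurable set. *)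
Lemma integral_normal_prob (m s : R) (f : R -> \bar R) : (forall x, (0 <= f x)%E) ->
  measurable_fun [set: R] f ->
  (\int[normal_prob m s]_x f x = \int[mu]_x (f x * (normal_pdf m s x)%:E))%E.
Proof.
move=> f0 mf.
have dom := normal_prob_dominates m s.
rewrite -(Radon_Nikodym_SigmaFinite.change_of_variables dom f0 measurableT mf).
have iRN := Radon_Nikodym_SigmaFinite.f_integrable dom.
have mpdf : measurable_fun [set: R] (fun x => (normal_pdf m s x)%:E).
  by apply/measurable_EFinP; exact: measurable_normal_pdf.
apply: ge0_ae_eq_integral => //.
- by apply: emeasurable_funM => //; exact: measurable_int iRN.
- exact: emeasurable_funM.
- by move=> x _; rewrite mule_ge0 ?Radon_Nikodym_SigmaFinite.f_ge0.
- by move=> x _; rewrite mule_ge0 ?lee_fin ?normal_pdf_ge0.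
apply: ae_eqe_mul2l; apply: integral_ae_eq => //.
move=> E _ mE; rewrite -Radon_Nikodym_SigmaFinite.f_integral//.
Qed.

Lemma normal_prob_opp s (B : set R) : s != 0 -> measurable B ->
  normal_prob 0 s ((-%R : R -> R) @^-1` B) = normal_prob 0 s B.
Proof.
move=> s0 mB; rewrite {1}/normal_prob.
transitivity (\int[mu]_(x in (-%R : R -> measurableTypeR R) @^-1` B)
   (((fun y => (normal_pdf 0 s y)%:E) \o (-%R : R -> measurableTypeR R)) x))%E.
  apply: eq_integral => x _ /=; rewrite !normal_pdfE// /normal_fun.
  by rewrite !subr0 sqrrN.
rewrite -ge0_integral_pushforward//=.
- by apply: eq_measure_integral => /= A mA _; exact: lebesgue_measureN.
- by apply/measurable_EFinP; apply: measurable_funTS; exact: measurable_normal_pdf.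
- by move=> y _; rewrite lee_fin normal_pdf_ge0.
Qed.

Let halve (a b : R) : a != 0 -> - b / (a *+ 2) = 2 * (- b / (2 * a *+ 2)).
Proof. by move=> a0; rewrite -(mulr_natr a 2) -(mulr_natr (2 * a) 2); field. Qed.

Let quarter (a b : R) : a != 0 -> b / (4 * a) = - (- b / (2 * a *+ 2)).
Proof. by move=> a0; rewrite -(mulr_natr (2 * a) 2); field. Qed.

(** A crude constant avoids computing a Gaussian integral: the integrand is dominated by a multiple
    of the normal density with deviation s' = sqrt 2 s. Its exponential factor E satisfies E^2 =
    exp(-x^2/(2 s^2)), and 1 + y <= exp y gives x^2 E <= 4 s^2. The peaks differ by sqrt 2 <= 2,
    whence 8 = 4 * 2. *)
Lemma normal_second_moment s : 0 < s ->
  (\int[normal_prob 0 s]_x (x ^+ 2)%:E <= (8 * s ^+ 2)%:E)%E.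
Proof.
move=> s0; rewrite integral_normal_prob//; last 2 first.
  by move=> x; rewrite lee_fin sqr_ge0.
  by apply/measurable_EFinP; exact: measurable_funX.
pose s' := Num.sqrt 2 * s.
have s'0 : 0 < s' by rewrite mulr_gt0// sqrtr_gt0.
have s'2 : s' ^+ 2 = 2 * s ^+ 2 by rewrite exprMn sqr_sqrtr.
have s20 : s ^+ 2 != 0 by rewrite gt_eqF// exprn_gt0.
have le1 x : x ^+ 2 * normal_pdf 0 s x <= 8 * s ^+ 2 * normal_pdf 0 s' x.
  rewrite !normal_pdfE ?gt_eqF//.
  have pk : normal_peak s <= 2 * normal_peak s'.
    rewrite /normal_peak s'2.
    have -> : 2 * s ^+ 2 * pi *+ 2 = 2 * (s ^+ 2 * pi *+ 2) :> R by rewrite mulrnAr mulrA.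
    rewrite sqrtrM//.
    have B0 : 0 < s ^+ 2 * pi *+ 2 :> R by rewrite pmulrn_lgt0// mulr_gt0 ?pi_gt0// exprn_gt0.
    have Q0 : 0 < Num.sqrt (s ^+ 2 * pi *+ 2) by rewrite sqrtr_gt0.
    have r2 : Num.sqrt 2 <= 2 :> R.
      by rewrite -[leRHS]ger0_norm// -sqrtr_sqr ler_sqrt// expr2; lra.
    have r0 : 0 < Num.sqrt 2 :> R by rewrite sqrtr_gt0.
    rewrite ler_pdivlMr ?mulr_gt0// mulrCA mulVf ?gt_eqF// mulr1 //.
  have E0 := expR_gt0 (- (x - 0) ^+ 2 / (s' ^+ 2 *+ 2)).
  rewrite -/(normal_fun 0 s' x) in E0.
  have EE : normal_fun 0 s x = normal_fun 0 s' x ^+ 2.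
    rewrite /normal_fun s'2 subr0 -expRM_natl; congr expR.
    exact: halve.
  have xE : x ^+ 2 * normal_fun 0 s' x <= 4 * s ^+ 2.
    have := expR_ge1Dx (x ^+ 2 / (4 * s ^+ 2)).
    have -> : expR (x ^+ 2 / (4 * s ^+ 2)) = (normal_fun 0 s' x)^-1.
      rewrite /normal_fun -expRN s'2 subr0; congr expR.
      exact: quarter.
    move=> h; have s40 : 0 < 4 * s ^+ 2 by rewrite mulr_gt0// exprn_gt0.
    have : x ^+ 2 / (4 * s ^+ 2) <= (normal_fun 0 s' x)^-1.
      by apply: le_trans h; rewrite lerDr.
    by rewrite ler_pdivrMr// mulrC ler_pdivlMr.
  rewrite EE.
  have p0 := normal_peak_ge0 s; have p0' := normal_peak_ge0 s'.
  move: (normal_fun 0 s' x) (normal_peak s) (normal_peak s') E0 xE pk p0 p0' => E p p' E0 xE pk p0 p0'.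
  have h1 : x ^+ 2 * E ^+ 2 <= 4 * s ^+ 2 * E by rewrite expr2 mulrA ler_pM2r.
  have h2 : p * (x ^+ 2 * E ^+ 2) <= 2 * p' * (4 * s ^+ 2 * E).
    by apply: ler_pM => //; rewrite mulr_ge0 ?sqr_ge0.
  by rewrite [leLHS](_ : _ = p * (x ^+ 2 * E ^+ 2)) ?[leRHS](_ : _ = 2 * p' * (4 * s ^+ 2 * E))//; ring.
apply: (@le_trans _ _ (\int[mu]_x ((8 * s ^+ 2)%:E * (normal_pdf 0 s' x)%:E))%E).
  apply: ge0_le_integral => //.
  - by move=> x _; rewrite -EFinM lee_fin mulr_ge0 ?sqr_ge0 ?normal_pdf_ge0.
  - apply/measurable_EFinP; apply: measurable_funM; first exact: measurable_funX.
    exact: measurable_normal_pdf.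
  - by apply/measurable_EFinP; apply: measurable_funM => //; exact: measurable_normal_pdf.
  - by move=> x _; rewrite -!EFinM lee_fin.
rewrite ge0_integralZl//.
- by rewrite integral_normal_pdf mule1.
- by apply/measurable_EFinP; exact: measurable_normal_pdf.
- by move=> x _; rewrite lee_fin normal_pdf_ge0.
- by rewrite lee_fin mulr_ge0// sqr_ge0.
Qed.

End NormalMoments.

(** * Second moments of elementary integrals against Brownian motion *)

Section BrownianIntegrator.
Context {R : realType} {d : measure_display} {T : measurableType d}.
Variables (P : probability T R) (W : R -> T -> R).
Hypothesis hW : brownian P W.
Implicit Types (s t : R).

Lemma brownian_measurable t : 0 <= t -> measurable_fun [set: T] (W t).
Proof. by have [h _ _ _ _] := hW; exact: h. Qed.

Lemma measure_eq_negligible (A B : set T) : measurable A -> measurable B ->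
  P.-negligible (A `\` B) -> P.-negligible (B `\` A) -> P A = P B.
Proof.
have key (C D : set T) : measurable C -> measurable D -> P.-negligible (C `\` D) -> (P C <= P D)%E.
  move=> mC mD nCD; rewrite -!mu_ext_measurable//.
  apply: (@le_trans _ _ (mu_ext P (D `|` (C `\` D)))).
    by apply: mu_extS => w Cw; have [Dw|Dw] := pselect (D w); [left|right].
  by apply: (le_trans (mu_extU _ _ _)); rewrite (mu_ext_negligible nCD) adde0.
by move=> mA mB nAB nBA; apply/eqP; rewrite eq_le !key.
Qed.

(* Every event of the augmented filtration is a past event up to a null set. *)
Lemma filtration_past s A : filtration P W s A -> exists A', [/\ past W s A',
  P.-negligible (A `\` A') & P.-negligible (A' `\` A)].
Proof.
pose C := [set A | exists A', [/\ past W s A',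
  P.-negligible (A `\` A') & P.-negligible (A' `\` A)]].
have sC : sigma_algebra setT C.
  have [p0 pC pU] := smallest_sigma_algebra [set: T] [set A | exists2 s0 : R, 0 <= s0 <= s &
        exists2 B : set R, measurable B & A = W s0 @^-1` B].
  split.
  - by exists set0; split; [exact: p0|rewrite setD0; exact: negligible_set0|rewrite setD0; exact: negligible_set0].
  - move=> B [B' [pB n1 n2]]; exists (setT `\` B'); split; first exact: pC.
      by apply: negligibleS n2 => w [[_ Bw] /= h]; split => //; apply: contrapT => B'w; exact: h.
    by apply: negligibleS n1 => w [[_ Bw] /= h]; split => //; apply: contrapT => B'w; exact: h.
  - move=> F FC; have /choice[F' HF] := FC.
    exists (\bigcup_i F' i); split.
    + by apply: pU => i; have [] := HF i.
    + have nn : P.-negligible (\bigcup_i (F i `\` F' i)).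
        by apply: negligible_bigcup => i; have [] := HF i.
      by apply: negligibleS nn => w [[i _ Fw] h]; exists i => //; split => // F'w; apply: h; exists i.
    + have nn : P.-negligible (\bigcup_i (F' i `\` F i)).
        by apply: negligible_bigcup => i; have [] := HF i.
      by apply: negligibleS nn => w [[i _ Fw] h]; exists i => //; split => // F'w; apply: h; exists i.
apply: (smallest_sub sC) => B [pB|[mB B0]].
  by exists B; rewrite setDv; split => //; exact: negligible_set0.
have [p0 _ _] := smallest_sigma_algebra [set: T] [set A | exists2 s0 : R, 0 <= s0 <= s &
        exists2 B : set R, measurable B & A = W s0 @^-1` B].
exists set0; split; [exact: p0|rewrite setD0; exact/negligibleP|rewrite set0D; exact: negligible_set0].
Qed.

Variables (s t : R).
Hypotheses (s0 : 0 <= s) (st : s < t).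

Let D w := W t w - W s w.

Let mD : measurable_fun [set: T] D.
Proof. by apply: measurable_funB; apply: brownian_measurable => //; exact: ltW (le_lt_trans s0 st). Qed.

Let mW' := brownian_measurable.

Lemma increment_independent A B : filtration P W s A -> measurable B ->
  P (A `&` D @^-1` B) = (P A * P (D @^-1` B))%E.
Proof.
move=> fA mB; have [A' [pA' n1 n2]] := filtration_past fA.
have mA := filtration_measurable mW' fA; have mA' := past_measurable mW' pA'.
have mDB : measurable (D @^-1` B) by rewrite -[X in measurable X]setTI; exact: mD.
have [_ _ _ ind _] := hW.
rewrite (measure_eq_negligible mA mA' n1 n2).
rewrite (@measure_eq_negligible _ (A' `&` D @^-1` B)).
- exact: ind.
- exact: measurableI.
- exact: measurableI.
- by apply: negligibleS n1 => w [[Aw Bw] h]; split => // A'w; exact: h.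
- by apply: negligibleS n2 => w [[Aw Bw] h]; split => // A'w; exact: h.
Qed.

Lemma increment_opp B : measurable B -> P (D @^-1` ((-%R : R -> R) @^-1` B)) = P (D @^-1` B).
Proof.
move=> mB; have [_ _ _ _ nrm] := hW.
have mB' : measurable ((-%R : R -> R) @^-1` B).
  by rewrite -[X in measurable X]setTI; exact: oppr_measurable.
rewrite [LHS](nrm _ _ s0 st _ mB') [RHS](nrm _ _ s0 st _ mB).
by apply: normal_prob_opp => //; rewrite gt_eqF// sqrtr_gt0 subr_gt0.
Qed.

(** By independence both joint laws are the product of the law of (S, h) with that of [D], which is
    symmetric. This stands in for the vanishing expectation of the cross term S h D: only
    nonnegative integrands occur, so no integrability has to be checked. *)
Lemma increment_symmetric (S h : T -> R) (f : (R * R) * R -> \bar R) :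
  measurable_wrt (filtration P W s) S -> measurable_wrt (filtration P W s) h ->
  measurable_fun [set: (R * R) * R] f -> (forall y, (0 <= f y)%E) ->
  (\int[P]_w f ((S w, h w), D w) = \int[P]_w f ((S w, h w), (- D w)%R))%E.
Proof.
move=> fS fh mf f0.
have mS := measurable_wrt_filtration mW' fS; have mh := measurable_wrt_filtration mW' fh.
have mSh : measurable_fun [set: T] (fun w => (S w, h w)) by exact: measurable_fun_pair.
have mphi : measurable_fun [set: T] (fun w => ((S w, h w), D w)) by exact: measurable_fun_pair.
have mpsi : measurable_fun [set: T] (fun w => ((S w, h w), - D w)).
  by apply: measurable_fun_pair => //; apply: measurableT_comp.
pose Sh : {mfun T >-> (R * R)%type} := mfun_Sub (mem_set mSh).
pose X : {mfun T >-> R} := mfun_Sub (mem_set mD).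
pose phi : {mfun T >-> ((R * R) * R)%type} := mfun_Sub (mem_set mphi).
pose psi : {mfun T >-> ((R * R) * R)%type} := mfun_Sub (mem_set mpsi).
have fSh A : measurable A -> filtration P W s (Sh @^-1` A).
  move=> mA; have : @measurable_fun _ _ (g_sigma_algebraType (past W s `|` [set A | measurable A /\ P A = 0%E])) (R * R)%type setT (fun w => (S w, h w)).
    by apply: measurable_fun_pair; exact/measurable_wrtP.
  by move=> /(_ measurableT A mA); rewrite setTI.
have E1 Y : measurable Y -> distribution P phi Y = (distribution P Sh \x distribution P X)%E Y.
  have H A B : measurable A -> measurable B -> distribution P phi (A `*` B) =
      (distribution P Sh A * distribution P X B)%E.
    by move=> mA mB; apply: increment_independent => //; exact: fSh.
  by move=> mY; rewrite -(product_measure_unique H mY).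
have E2 Y : measurable Y -> distribution P psi Y = (distribution P Sh \x distribution P X)%E Y.
  have H A B : measurable A -> measurable B -> distribution P psi (A `*` B) =
      (distribution P Sh A * distribution P X B)%E.
    move=> mA mB; rewrite -[distribution P X B]increment_opp//.
    apply: increment_independent; first exact: fSh.
    by rewrite -[X in measurable X]setTI; exact: oppr_measurable.
  by move=> mY; rewrite -(product_measure_unique H mY).
transitivity (\int[distribution P phi]_y f y)%E.
  by rewrite ge0_integral_distribution.
transitivity (\int[distribution P psi]_y f y)%E; last first.
  by rewrite ge0_integral_distribution.
by apply: eq_measure_integral => Y mY _; rewrite /= E1 ?E2.
Qed.

Lemma increment_second_moment : (\int[P]_w (D w ^+ 2)%:E <= (8 * (t - s))%:E)%E.
Proof.
have mD' : @measurable_fun _ _ T (measurableTypeR R) setT D by exact: mD.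
pose X : {mfun T >-> measurableTypeR R} := @mfun_Sub _ _ T (measurableTypeR R) D (mem_set mD').
have mx2 : measurable_fun [set: R] (fun x : R => (x ^+ 2)%:E).
  by apply/measurable_EFinP; exact: measurable_funX.
rewrite (_ : (\int[P]_w _)%E = (\int[distribution P X]_y (y ^+ 2)%:E)%E); last first.
  by rewrite ge0_integral_distribution// => y; rewrite lee_fin sqr_ge0.
have [_ _ _ _ nrm] := hW.
have -> : (\int[distribution P X]_y (y ^+ 2)%:E =
    \int[normal_prob 0 (Num.sqrt (t - s))]_y (y ^+ 2)%:E)%E.
  by apply: eq_measure_integral => A mA _; exact: (nrm _ _ s0 st A mA).
have ts : 0 < t - s by rewrite subr_gt0.
have := @normal_second_moment R (Num.sqrt (t - s)).
by rewrite sqrtr_gt0 (sqr_sqrtr (ltW ts)) => /(_ ts).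
Qed.

(** Twice the moment is the sum of those with [D] and with -D, and (S + h D)^2 + (S - h D)^2 = 2 S^2
    + 2 h^2 D^2, where h^2 <= 1. Induction over the partition then bounds the second moment of an
    elementary integral by 8 times the elapsed time. *)
Lemma second_moment_step (S h : T -> R) (r : R) :
  measurable_wrt (filtration P W s) S -> measurable_wrt (filtration P W s) h ->
  (forall w, `|h w| <= 1) -> (\int[P]_w (S w ^+ 2)%:E <= r%:E)%E ->
  (\int[P]_w ((S w + h w * D w) ^+ 2)%:E <= (r + 8 * (t - s))%:E)%E.
Proof.
move=> fS fh h1 Sr.
have mS := measurable_wrt_filtration mW' fS; have mh := measurable_wrt_filtration mW' fh.
pose f (y : (R * R) * R) : \bar R := ((y.1.1 + y.1.2 * y.2) ^+ 2)%:E.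
have mf : measurable_fun [set: (R * R) * R] f.
  apply/measurable_EFinP; apply: measurable_funX; apply: measurable_funD.
    by apply: (measurableT_comp measurable_fst); exact: measurable_fst.
  apply: measurable_funM; last exact: measurable_snd.
  by apply: (measurableT_comp measurable_snd); exact: measurable_fst.
have f0 y : (0 <= f y)%E by rewrite lee_fin sqr_ge0.
have E := increment_symmetric fS fh mf f0.
set a := (\int[P]_w _)%E; have aE : a = (\int[P]_w f ((S w, h w), D w))%E by [].
have mp : measurable_fun [set: T] (fun w => f ((S w, h w), D w)).
  by apply: measurableT_comp => //; apply: measurable_fun_pair => //; exact: measurable_fun_pair.
have mn : measurable_fun [set: T] (fun w => f ((S w, h w), - D w)).
  apply: measurableT_comp => //; apply: measurable_fun_pair; first exact: measurable_fun_pair.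
  exact: measurableT_comp.
have mS2 : measurable_fun [set: T] (fun w => (S w ^+ 2)%:E).
  by apply/measurable_EFinP; exact: measurable_funX.
have mD2 : measurable_fun [set: T] (fun w => (D w ^+ 2)%:E).
  by apply/measurable_EFinP; exact: measurable_funX.
have : (a + a <= ((r + 8 * (t - s)) + (r + 8 * (t - s)))%:E)%E.
  rewrite {2}aE E aE -ge0_integralD//.
  apply: (@le_trans _ _ (\int[P]_w (((S w ^+ 2)%:E + (D w ^+ 2)%:E) + ((S w ^+ 2)%:E + (D w ^+ 2)%:E)))%E).
    apply: ge0_le_integral => //.
    - by move=> w _; rewrite adde_ge0.
    - exact: emeasurable_funD.
    - by do 2 apply: emeasurable_funD => //.
    move=> w _; rewrite /f /= -!EFinD lee_fin.
    have h2 : h w ^+ 2 <= 1 by have := h1 w; rewrite ler_norml => /andP[]; nra.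
    have : h w ^+ 2 * D w ^+ 2 <= D w ^+ 2 by rewrite ler_piMl ?sqr_ge0.
    by move: (S w) (h w) (D w) => S' h' D'; nra.
  have g0 : (forall w, 0 <= (S w ^+ 2)%:E + (D w ^+ 2)%:E)%E.
    by move=> w; rewrite -EFinD lee_fin addr_ge0 ?sqr_ge0.
  rewrite ge0_integralD//; [|exact: emeasurable_funD|exact: emeasurable_funD].
  have : (\int[P]_w ((S w ^+ 2)%:E + (D w ^+ 2)%:E) <= (r + 8 * (t - s))%:E)%E.
    rewrite ge0_integralD//; [|by move=> w _; rewrite lee_fin sqr_ge0|by move=> w _; rewrite lee_fin sqr_ge0].
    by rewrite EFinD leeD// increment_second_moment.
  by move=> h3; rewrite [leRHS]EFinD; apply: leeD.
have : (0 <= a)%E by apply: integral_ge0 => w _; rewrite lee_fin sqr_ge0.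
by case: (a) => [x| |] //=; rewrite ?leye_eq// -!EFinD !lee_fin; lra.
Qed.

End BrownianIntegrator.

Section BrownianSemimartingale.
Context {R : realType} {d : measure_display} {T : measurableType d}.
Variables (P : probability T R) (W : R -> T -> R).
Hypothesis hW : brownian P W.
Let mW := brownian_measurable hW.

Lemma brownian_adapted : adapted P W W.
Proof.
move=> t t0 B mB; apply: sub_gen_smallest; left; apply: sub_gen_smallest.
by exists t => /=; [rewrite t0 lexx|exists B].
Qed.

Lemma brownian_good_integrator : good_integrator P W W.
Proof.
(* Chebyshev's inequality with C = 1 + 8 t / e: C^2 P(A) <= 8 t <= C e <= C^2 e, the last step
   because C >= 1. *)
move=> t e t0 e0; exists (1 + 8 * t / e) => s h0 ps mh0 h01.
pose h k := if (k < size s)%N then h0 k else fun=> 0.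
have ah : adapted_steps P W t s h.
  by move=> k; rewrite /h; case: ifP => ks; [exact: mh0|exact: measurable_wrt_cst].
have h1 k w : `|h k w| <= 1 by rewrite /h; case: ifP => ks; rewrite ?normr0 ?ler01.
have aS := step_integral_adapted brownian_adapted ps ah.
have mom l : (\int[P]_w (step_integral W t s h l w ^+ 2)%:E <= (8 * pt t s l)%:E)%E.
  elim: l => [|l IH].
    rewrite pt0 mulr0; under eq_integral do rewrite /step_integral big_nil expr0n/=.
    by rewrite integral0.
  have [ls|ls] := ltnP l (size s); last first.
    rewrite (pt_size ps (leqW ls)); rewrite (pt_size ps ls) in IH.
    under eq_integral do rewrite (step_integral_stop _ _ _ ps (leqW ls)) -(step_integral_stop _ _ _ ps ls).
    exact: IH.
  under eq_integral do rewrite /step_integral big_nat_recr//=.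
  have := second_moment_step hW (pt_ge0 l ps) (pt_ltS ps ls) (aS l) (ah l) (h1 l) IH.
  by rewrite -mulrDr subrKC.
set A := [set w | _].
have AE : A = [set w | 1 + 8 * t / e < `|step_integral W t s h (size s) w|].
  apply/funext => w; rewrite /A /mkset; congr (is_true (_ < `|_|)).
  rewrite /step_integral big_nat_cond [RHS]big_nat_cond; apply: eq_bigr => k /andP[/andP[_ ks] _].
  by rewrite /h ks.
have mS := measurable_wrt_filtration mW (aS (size s)).
have mA : measurable A by rewrite AE; apply: measurable_cst_lt; exact: measurableT_comp.
have mS2 : measurable_fun [set: T] (fun w => (step_integral W t s h (size s) w ^+ 2)%:E).
  by apply/measurable_EFinP; exact: measurable_funX.
have S20 w : (0 <= (step_integral W t s h (size s) w ^+ 2)%:E)%E by rewrite lee_fin sqr_ge0.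
pose C := 1 + 8 * t / e.
have C1 : 1 <= C.
  by rewrite /C lerDl; apply: divr_ge0; [exact: mulr_ge0|exact: ltW].
have h2 : ((C ^+ 2)%:E * P A <= (8 * t)%:E)%E.
  rewrite -integral_cst//.
  apply: (@le_trans _ _ (\int[P]_(w in A) (step_integral W t s h (size s) w ^+ 2)%:E)%E).
    apply: ge0_le_integral => //.
    - by move=> w _; rewrite lee_fin sqr_ge0.
    - exact: measurable_funTS.
    move=> w; rewrite AE /= -/C => hw; rewrite lee_fin -[leRHS]real_normK ?num_real//.
    by apply: lerXn2r; rewrite ?nnegrE ?normr_ge0 ?(le_trans ler01 C1) ?ltW.
  apply: (@le_trans _ _ (\int[P]_w (step_integral W t s h (size s) w ^+ 2)%:E)%E).
    by apply: ge0_subset_integral.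
  by have := mom (size s); rewrite (pt_size ps (leqnn _)).
have PAfin : P A \is a fin_num by exact: fin_num_measure.
move: h2; rewrite -(fineK PAfin) -EFinM !lee_fin => h2.
have C8 : 8 * t <= C * e.
  have -> : C * e = e + 8 * t by rewrite /C; field; rewrite gt_eqF.
  by rewrite lerDr ltW.
have p0 : 0 <= fine (P A) by rewrite fine_ge0.
have : C ^+ 2 * fine (P A) <= C ^+ 2 * e.
  apply: (le_trans h2); apply: (le_trans C8); rewrite expr2 -mulrA ler_peMl//.
  by rewrite mulr_ge0 ?ltW// (lt_le_trans ltr01).
by rewrite ler_pM2l// exprn_gt0// (lt_le_trans ltr01).
Qed.

Lemma brownian_semimartingale : continuous_semimartingale P W W.
Proof.
split; [exact: brownian_adapted| |exact: brownian_good_integrator].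
by have [] := hW.
Qed.

End BrownianSemimartingale.

(** * Associativity of the Stratonovich integral *)

Section BlockIdentity.
Context {R : realType}.
Variables (u f y : nat -> R).

(* The increments over a block starting at b of the process
   u_b n / 2 + (u - u_b) n / 4 - (u - u_b) (f - f_b) (y - y_b) / 4, where n is
   the discrete Levy area of f and y. *)
Definition block_inc (b : nat) (n : nat -> R) (j : nat) : R :=
  2^-1 * u b * (f j - f b) * (y j.+1 - y j)
  - (2^-1 * u b * (y j - y b) + 2^-1 * (u j - u b) * (y j - y b)) * (f j.+1 - f j)
  + (4^-1 * n j - 4^-1 * (f j - f b) * (y j - y b)) * (u j.+1 - u j)
  - 2^-1 * (y j - y b) * ((u j.+1 - u j) * (f j.+1 - f j))
  - (4^-1 * (u j - u b) + 4^-1 * (u j.+1 - u j)) * ((f j.+1 - f j) * (y j.+1 - y j)).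

Definition area_inc (b j : nat) : R :=
  (f j - f b) * (y j.+1 - y j) - (y j - y b) * (f j.+1 - f j).

(** The discrete Levy area of [f] and [y] is twice the gap between the fine and the one-step
    trapezoidal sums of f dy. Therefore the right side, the fine sum weighted by the mean of [u]
    minus the one-step sum of u f dy, is the end value of the process whose increments [block_inc]
    lists. The area is prescribed for i < l only, because [block_area] restarts at 0 where the next
    block begins. *)
Lemma block_identity (b l : nat) (n : nat -> R) :
  (forall i, (i < l)%N -> n (b + i)%N = \sum_(0 <= j < i) area_inc b (b + j)) ->
  \sum_(0 <= j < l) block_inc b n (b + j) =
  2^-1 * (u b + u (b + l)%N) *
    (\sum_(0 <= j < l) 2^-1 * (f (b + j)%N + f (b + j).+1) * (y (b + j).+1 - y (b + j)%N))
  - 2^-1 * (u b * f b + u (b + l)%N * f (b + l)%N) * (y (b + l)%N - y b).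
Proof.
move=> hn.
have area i : \sum_(0 <= j < i) area_inc b (b + j) =
   2 * (\sum_(0 <= j < i) 2^-1 * (f (b + j)%N + f (b + j).+1) * (y (b + j).+1 - y (b + j)%N))
   - (f b + f (b + i)%N) * (y (b + i)%N - y b).
  elim: i => [|i IH]; first by rewrite !big_nil addn0; ring.
  by rewrite !big_nat_recr//= IH addnS /area_inc; field.
elim: l hn => [_|l IH hn]; first by rewrite !big_nil addn0; ring.
rewrite !big_nat_recr//= IH; last by move=> i il; apply: hn; rewrite ltnS ltnW.
rewrite /block_inc hn// area addnS.
by field.
Qed.

End BlockIdentity.

(** * Equidistant refinements and the mesh filter *)

Section Refinement.
Context {R : realType}.
Implicit Types (t : R) (s : seq R).

Definition refined_pt t s (r j : nat) : R :=
  pt t s (j %/ r.+1) + (j %% r.+1)%:R / r.+1%:R * (pt t s (j %/ r.+1).+1 - pt t s (j %/ r.+1)).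

Definition refine t s (r : nat) : seq R :=
  [seq refined_pt t s r j | j <- iota 1 (size s * r.+1)].

Lemma size_refine t s r : size (refine t s r) = (size s * r.+1)%N.
Proof. by rewrite size_map size_iota. Qed.

Lemma pt_refine t s r j : itv_partition 0 t s -> pt t (refine t s r) j = refined_pt t s r j.
Proof.
move=> ps; have [js|js] := leqP j (size s * r.+1)%N.
  case: j js => [_|j js]; first by rewrite /refined_pt div0n mod0n mul0r mul0r addr0.
  by rewrite /pt /= (nth_map 0%N) ?size_iota// nth_iota// add1n.
rewrite {1}/pt nth_default; last by rewrite /= size_refine.
rewrite /refined_pt.
have kj : (size s <= j %/ r.+1)%N by rewrite leq_divRL// ltnW.
by rewrite !(pt_size ps) ?leqW// subrr mulr0 addr0.
Qed.

Lemma refined_pt_block t s r k i : (i <= r)%N ->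
  refined_pt t s r (k * r.+1 + i) = pt t s k + i%:R / r.+1%:R * (pt t s k.+1 - pt t s k).
Proof.
by move=> ir; rewrite /refined_pt divnMDl// modnMDl divn_small// modn_small// addn0.
Qed.

Lemma refined_pt_coarse t s r k : refined_pt t s r (k * r.+1) = pt t s k.
Proof. by rewrite -[(k * r.+1)%N]addn0 refined_pt_block// mul0r mul0r addr0. Qed.

Lemma refined_pt_inc t s r j :
  refined_pt t s r j.+1 - refined_pt t s r j =
  (pt t s (j %/ r.+1).+1 - pt t s (j %/ r.+1)) / r.+1%:R.
Proof.
have rj : (j %% r.+1 <= r)%N by rewrite -ltnS ltn_mod.
have r0 : r.+1%:R != 0 :> R by rewrite pnatr_eq0.
rewrite [in refined_pt _ _ _ j.+1](divn_eq j r.+1) -addnS.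
rewrite [in X in _ - X](divn_eq j r.+1) [X in _ - X]refined_pt_block//.
move: rj; rewrite leq_eqVlt => /predU1P[->|rj].
  rewrite -mulSnr refined_pt_coarse.
  move: (pt t s _) (pt t s _) => a b; rewrite -[r%:R](addrK 1) natr1.
  by move: (r.+1%:R) r0 => c c0; field.
rewrite refined_pt_block// -[(j %% r.+1).+1%:R]natr1.
move: (pt t s _) (pt t s _) ((j %% r.+1)%:R) => a b k.
by move: (r.+1%:R) r0 => c c0; field.
Qed.

Lemma refine_partition t s r : itv_partition 0 t s -> itv_partition 0 t (refine t s r).
Proof.
move=> ps; split.
  apply/(pathP t) => j js; rewrite size_refine in js.
  rewrite -/(pt t (refine t s r) j) (_ : nth t (refine t s r) j = pt t (refine t s r) j.+1)//.
  rewrite !pt_refine// -subr_gt0 refined_pt_inc divr_gt0// subr_gt0.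
  by apply: pt_ltS => //; rewrite ltn_divLR.
rewrite (last_nth t) size_refine -/(pt t (refine t s r) _) pt_refine// refined_pt_coarse.
by rewrite (pt_size ps).
Qed.

Lemma partition_take t s l : itv_partition 0 t s -> (l <= size s)%N ->
  itv_partition 0 (pt t s l) (take l s).
Proof.
move=> [ps _] ls; split.
  by move: ps; rewrite -{1}(cat_take_drop l s) cat_path => /andP[].
rewrite (last_nth t) size_takel// /pt; case: l ls => [//|l ls] /=.
by rewrite nth_take.
Qed.

Lemma pt_take t s l j : (l <= size s)%N -> (j <= l)%N -> pt (pt t s l) (take l s) j = pt t s j.
Proof.
move=> ls jl; rewrite {1}/pt; case: j jl => [//|j jl] /=.
by rewrite nth_take// (set_nth_default t)// (leq_trans jl).
Qed.

End Refinement.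

Section MeshFilter.
Context {R : realType}.
Variable t : R.

(** The index type is a parameter because refinements are filtered by the mesh of their coarse
    partition, the number of subdivisions being left free. *)
Definition mesh_filter {J : Type} (sq : J -> seq R) : set_system J :=
  [set A | exists2 D : R, 0 < D &
    forall nu, (forall k, pt t (sq nu) k.+1 - pt t (sq nu) k < D) -> A nu].

Global Instance mesh_filter_filter {J : Type} (sq : J -> seq R) : Filter (mesh_filter sq).
Proof.
split.
- by exists 1.
- move=> A B [D D0 HD] [E E0 HE]; exists (Num.min D E); first by rewrite lt_min D0.
  move=> nu h; split; [apply: HD|apply: HE] => k; have := h k.
    by rewrite lt_min => /andP[].
  by rewrite lt_min => /andP[].
- by move=> A B AB [D D0 HD]; exists D => // nu /HD; exact: AB.
Qed.

Lemma mesh_filter_mesh {J : Type} (sq : J -> seq R) (D : R) : 0 < D ->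
  \forall nu \near mesh_filter sq, forall j, pt t (sq nu) j.+1 - pt t (sq nu) j < D.
Proof. by move=> D0; exists D. Qed.

End MeshFilter.

Section Stratonovich.
Context {R : realType} {d : measure_display} {T : measurableType d}.
Variables (P : probability T R) (t : R).
Implicit Types (X Y : R -> T -> R) (I : T -> R).

Definition partitions : Type := {s : seq R | itv_partition 0 t s}.
Definition psq (nu : partitions) : seq R := sval nu.

Lemma psqP nu : itv_partition 0 t (psq nu).
Proof. exact: svalP. Qed.

Lemma small_stratonovich X Y I : 0 <= t ->
  small P (mesh_filter t psq) (fun nu _ w => trapezoidal_sum X Y t (psq nu) w - I w) ->
  stratonovich P X Y t I.
Proof.
(* [small] concerns a strict inequality, [stratonovich] a large one; e / 2 bridges the two. *)
move=> t0 H e eta e0 eta0; have e20 : 0 < e / 2 by rewrite divr_gt0.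
have [D D0 HD] := H _ _ e20 eta0; exists D => // s ps mesh.
have mk k : pt t s k.+1 - pt t s k < D.
  have [ks|ks] := ltnP k (size s); first exact: mesh.
  by rewrite !(pt_size ps) ?leqW// subrr.
have := HD (exist _ s ps) mk; apply: outer_leS => w /= h; exists 0%N.
by apply: lt_le_trans h; rewrite ltr_pdivrMr// ltr_pMr// ltr1n.
Qed.

End Stratonovich.

(** * Comparison of coarse sums with refined ones *)

Section Associativity.
Context {R : realType} {d : measure_display} {T : measurableType d}.
Variables (P : probability T R) (W : R -> T -> R).
Hypothesis mW : forall t : R, 0 <= t -> measurable_fun [set: T] (W t).
Variable t : R.
Hypothesis t0 : 0 <= t.
Implicit Types (X Y : R -> T -> R).
Local Notation CS := (continuous_semimartingale P W).

(* [(s, r)] stands for [s] with every interval cut into [r.+1] equal parts. *)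
Definition refinements : Type := (partitions t * nat)%type.
Definition rsq (nu : refinements) : seq R := refine t (psq nu.1) nu.2.
Local Notation Fil := (mesh_filter t (fun nu : refinements => psq nu.1)).

Definition base (nu : refinements) (j : nat) : nat := (j %/ nu.2.+1 * nu.2.+1)%N.

Lemma rsqP nu : itv_partition 0 t (rsq nu).
Proof. exact/refine_partition/psqP. Qed.

Lemma base_le nu j : (base nu j <= j)%N.
Proof. exact: leq_divM. Qed.

Lemma pt_rsq nu j : pt t (rsq nu) j = refined_pt t (psq nu.1) nu.2 j.
Proof. by apply: pt_refine; exact: psqP. Qed.

Lemma rsq_mesh (D : R) : 0 < D -> \forall nu \near Fil,
  forall j, pt t (rsq nu) j.+1 - pt t (rsq nu) j < D.
Proof.
move=> D0; exists D => // nu h j; rewrite !pt_rsq refined_pt_inc.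
apply: le_lt_trans (h (j %/ nu.2.+1)%N); rewrite ler_pdivrMr// ler_peMr ?ler1n//.
by rewrite subr_ge0 pt_leS//; exact: psqP.
Qed.

Lemma base_mesh (D : R) : 0 < D -> \forall nu \near Fil,
  forall j, `|pt t (rsq nu) j - pt t (rsq nu) (base nu j)| < D.
Proof.
move=> D0; exists D => // nu h j; rewrite !pt_rsq /base refined_pt_coarse.
rewrite {1}(divn_eq j nu.2.+1) refined_pt_block; last by rewrite -ltnS ltn_mod.
rewrite addrC addKr; have := h (j %/ nu.2.+1)%N.
have : 0 <= pt t (psq nu.1) (j %/ nu.2.+1).+1 - pt t (psq nu.1) (j %/ nu.2.+1).
  by rewrite subr_ge0 pt_leS//; exact: psqP.
move: (_ - _) => x x0 xD.
have q0 : 0 <= (j %% nu.2.+1)%:R / nu.2.+1%:R :> R by rewrite divr_ge0.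
rewrite ger0_norm ?mulr_ge0//; apply: le_lt_trans xD.
by rewrite ler_piMl// ler_pdivrMr// mul1r ler_nat ltnW// ltn_mod.
Qed.

Local Notation rsmp := (smp t rsq).
Local Notation rinc := (inc t rsq).

Definition disp X : refinements -> nat -> T -> R :=
  fun nu j w => rsmp X nu j w - rsmp X nu (base nu j) w.

Lemma small_disp X : CS X -> small P Fil (disp X).
Proof.
move=> [aX cX _].
apply: (small_process_diff mW (p := fun nu j => pt t (rsq nu) j)
  (q := fun nu j => pt t (rsq nu) (base nu j)) (t := t)) => //.
- by move=> nu j; rewrite pt_ge0 ?pt_le_end//; exact: rsqP.
- by move=> nu j; rewrite pt_ge0 ?pt_le_end//; exact: rsqP.
exact: base_mesh.
Qed.

Lemma adp_disp X : adapted P W X -> adp P W t rsq (disp X).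
Proof.
move=> aX; apply: adpB; first exact: (adp_smp rsqP).
exact: (adp_reindex rsqP base_le (adp_smp rsqP aX)).
Qed.

Variables (U F Y : R -> T -> R).
Hypotheses (sU : CS U) (sF : CS F) (sY : CS Y).

Definition area : refinements -> nat -> T -> R := fun nu l w =>
  csum (fun nu j w => disp F nu j w * rinc Y nu j w) nu l w
  - csum (fun nu j w => disp Y nu j w * rinc F nu j w) nu l w.

Definition block_area : refinements -> nat -> T -> R := fun nu j w =>
  area nu j w - area nu (base nu j) w.

(** Both halves integrate the displacement since the last coarse point, which is adapted and,
    whatever the number of subdivisions, small by the coarse mesh alone. *)
Lemma small_area : small P Fil area.
Proof.
have [[aF _ _] [aY _ _]] := (sF, sY).
by apply: smallB; apply: (small_integral mW t0 rsqP) => //;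
  [exact: adp_disp|exact: small_disp|exact: adp_disp|exact: small_disp].
Qed.

Lemma small_block_area : small P Fil block_area.
Proof. by apply: smallB; [|apply: (small_reindex base)]; exact: small_area. Qed.

Lemma adp_area : adp P W t rsq area.
Proof.
have [[aF _ _] [aY _ _]] := (sF, sY).
by apply: adpB; apply: (adp_csum_inc rsqP) => //; exact: adp_disp.
Qed.

Lemma adp_block_area : adp P W t rsq block_area.
Proof.
by apply: adpB; [exact: adp_area|exact: (adp_reindex rsqP base_le adp_area)].
Qed.

Definition path_seq X nu w : nat -> R := fun j => X (pt t (rsq nu) j) w.

Definition block_err : refinements -> nat -> T -> R := fun nu j w =>
  block_inc (path_seq U nu w) (path_seq F nu w) (path_seq Y nu w) (base nu j)
    (fun j => block_area nu j w) j.

(** The terms of [block_inc] are grouped by integrator. Against single increments the coefficients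
    are small and known at the left end of the step, so the good integrator property applies; the
    two terms with products of increments are brackets with small coefficients. *)
Lemma small_block_err : small P Fil (csum block_err).
Proof.
have [aU _ _] := sU; have [aF _ _] := sF; have [aY _ _] := sY.
pose Ub : refinements -> nat -> T -> R := fun nu j w => rsmp U nu (base nu j) w.
have aUb : adp P W t rsq Ub by exact: (adp_reindex rsqP base_le (adp_smp rsqP aU)).
have tUb : tight P Fil Ub by apply: (tight_reindex base); exact: (tight_smp mW rsqP sU).
have sdU := small_disp sU; have sdF := small_disp sF; have sdY := small_disp sY.
have siU : small P Fil (rinc U) by apply: (small_inc mW rsqP sU); exact: rsq_mesh.
have h1 : small P Fil (csum (fun nu j w => (2^-1 * Ub nu j w * disp F nu j w) * rinc Y nu j w)).
  apply: (small_integral mW t0 rsqP sY).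
    by apply: adpM; [apply: adpM => //; exact: adp_cst|exact: adp_disp].
  by apply: smallM => //; apply: tightM => //; exact: tight_cst.
have h2 : small P Fil (csum (fun nu j w =>
    (- (2^-1 * Ub nu j w * disp Y nu j w + 2^-1 * disp U nu j w * disp Y nu j w)) * rinc F nu j w)).
  apply: (small_integral mW t0 rsqP sF).
    apply: adpN; apply: adpD; (apply: adpM; [apply: adpM; [exact: adp_cst|]|exact: adp_disp]) => //.
    exact: adp_disp.
  apply: smallN; apply: smallD.
    by apply: smallM => //; apply: tightM tUb; exact: tight_cst.
  by apply: smallM => //; apply: tightM; [exact: tight_cst|exact: small_tight].
have h3 : small P Fil (csum (fun nu j w =>
    (4^-1 * block_area nu j w - 4^-1 * disp F nu j w * disp Y nu j w) * rinc U nu j w)).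
  apply: (small_integral mW t0 rsqP sU).
    apply: adpB; first by apply: adpM; [exact: adp_cst|exact: adp_block_area].
    apply: adpM; last exact: adp_disp.
    by apply: adpM; [exact: adp_cst|exact: adp_disp].
  apply: smallB; first by apply: smallM; [exact: tight_cst|exact: small_block_area].
  by apply: smallM => //; apply: tightM; [exact: tight_cst|exact: small_tight].
have h4 : small P Fil (csum (fun nu j w => (- (2^-1 * disp Y nu j w)) * (rinc U nu j w * rinc F nu j w))).
  apply: (small_bracket mW t0 rsqP sU sF); apply: smallN.
  by apply: smallM => //; exact: tight_cst.
have h5 : small P Fil (csum (fun nu j w =>
    (- (4^-1 * disp U nu j w + 4^-1 * rinc U nu j w)) * (rinc F nu j w * rinc Y nu j w))).
  apply: (small_bracket mW t0 rsqP sF sY); apply: smallN.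
  by apply: smallD; apply: smallM => //; exact: tight_cst.
apply: small_eq (small_csumD (small_csumD (small_csumD (small_csumD h1 h2) h3) h4) h5).
apply/funext => nu; apply/funext => l; apply/funext => w; apply: eq_bigr => j _.
by rewrite /block_err /block_inc /path_seq /Ub /disp /smp /inc; ring.
Qed.

Definition coarse (nu : refinements) (k : nat) : nat := (k * nu.2.+1)%N.

Definition fine_integral (nu : refinements) (k : nat) (w : T) : R :=
  \sum_(0 <= j < coarse nu k)
    2^-1 * (rsmp F nu j w + rsmp F nu j.+1 w) * (rsmp Y nu j.+1 w - rsmp Y nu j w).

Lemma base_coarse nu k i : (i <= nu.2)%N -> base nu (coarse nu k + i) = coarse nu k.
Proof. by move=> ir; rewrite /base /coarse divnMDl// divn_small// addn0. Qed.

Lemma pt_coarse nu k : pt t (rsq nu) (coarse nu k) = pt t (psq nu.1) k.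
Proof. by rewrite pt_rsq refined_pt_coarse. Qed.

Lemma block_sum nu k w :
  \sum_(0 <= i < nu.2.+1) block_err nu (coarse nu k + i) w =
  2^-1 * (U (pt t (psq nu.1) k) w + U (pt t (psq nu.1) k.+1) w)
     * (fine_integral nu k.+1 w - fine_integral nu k w)
  - 2^-1 * (U (pt t (psq nu.1) k) w * F (pt t (psq nu.1) k) w
      + U (pt t (psq nu.1) k.+1) w * F (pt t (psq nu.1) k.+1) w)
    * (Y (pt t (psq nu.1) k.+1) w - Y (pt t (psq nu.1) k) w).
Proof.
pose b := coarse nu k; pose r := nu.2.+1.
have cS : coarse nu k.+1 = (b + r)%N by rewrite /coarse mulSnr.
have shift (G : nat -> R) i : \sum_(b <= j < b + i) G j = \sum_(0 <= j < i) G (b + j)%N.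
  by rewrite -{1}[b]add0n big_addn addKn; apply: eq_bigr => j _; rewrite addnC.
have E : \sum_(0 <= i < r) block_err nu (b + i)%N w =
    \sum_(0 <= i < r) block_inc (path_seq U nu w) (path_seq F nu w) (path_seq Y nu w) b
      (fun j => block_area nu j w) (b + i).
  rewrite big_nat_cond [RHS]big_nat_cond; apply: eq_bigr => i /andP[/andP[_ ir] _].
  by rewrite /block_err base_coarse.
rewrite E block_identity; last first.
  (* Subtracting the area accumulated up to the base leaves the area of the current block. *)
  move=> i ir; rewrite /block_area base_coarse// /area -/b.
  rewrite /csum -!sumrB (big_cat_nat (n := b)) ?leq_addr//= addrAC.
  rewrite subrr add0r shift; apply: eq_big_nat => j /andP[_ ji].
  have jr : (j <= nu.2)%N by rewrite -ltnS (ltn_trans ji ir).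
  by rewrite /area_inc /disp base_coarse.
rewrite -[in LHS]cS /path_seq !pt_coarse; congr (_ * _ - _).
rewrite /fine_integral cS [X in _ = X - _](big_cat_nat (n := b)) ?leq_addr//= addrAC subrr add0r.
by rewrite shift; apply: eq_bigr => j _; rewrite /smp.
Qed.

Lemma block_total nu w : csum block_err nu (coarse nu (size (psq nu.1))) w =
  \sum_(0 <= k < size (psq nu.1))
    2^-1 * (U (pt t (psq nu.1) k) w + U (pt t (psq nu.1) k.+1) w)
     * (fine_integral nu k.+1 w - fine_integral nu k w)
  - trapezoidal_sum (fun s w => U s w * F s w) Y t (psq nu.1) w.
Proof.
rewrite /csum /coarse big_nat_mul /trapezoidal_sum -sumrB; apply: eq_bigr => k _.
rewrite -block_sum -{1}[(k * _)%N]add0n big_addn.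
rewrite (_ : (k.+1 * nu.2.+1 - k * nu.2.+1 = nu.2.+1)%N); last by rewrite mulSnr addnC addnK.
by apply: eq_bigr => i _; rewrite addnC.
Qed.

Variable I : R -> T -> R.
Hypothesis hI : forall s : R, 0 <= s <= t -> stratonovich P F Y s (I s).

(** A refinement cut off at a coarse point is a partition of the shorter interval, to which the
    definition of the integral up to that point applies. *)
Lemma fine_integral_trapezoid nu k : (k <= size (psq nu.1))%N ->
  fine_integral nu k = trapezoidal_sum F Y (pt t (psq nu.1) k) (take (coarse nu k) (rsq nu)).
Proof.
move=> ks; apply/funext => w; have cs : (coarse nu k <= size (rsq nu))%N.
  by rewrite size_refine leq_mul2r ks orbT.
rewrite /fine_integral /trapezoidal_sum size_takel//.
rewrite big_nat_cond [RHS]big_nat_cond; apply: eq_bigr => j /andP[/andP[_ js] _].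
by rewrite -(pt_coarse nu k) !pt_take// ltnW.
Qed.

Lemma fine_integral_cvg (s : partitions t) (e eta : R) : 0 < e -> 0 < eta ->
  exists r, forall k, (k <= size (psq s))%N ->
    outer_le P [set w | e <= `|fine_integral (s, r) k w - I (pt t (psq s) k) w|] eta.
Proof.
move=> e0 eta0.
have ps : itv_partition 0 t (psq s) := psqP s.
have Ik k : 0 <= pt t (psq s) k <= t by rewrite pt_ge0 ?pt_le_end.
have /choice[D HD] : forall k, exists D : R, 0 < D /\ forall s', itv_partition 0 (pt t (psq s) k) s' ->
    (forall j, (j < size s')%N -> pt (pt t (psq s) k) s' j.+1 - pt (pt t (psq s) k) s' j < D) ->
    outer_le P [set w | e <= `|trapezoidal_sum F Y (pt t (psq s) k) s' w - I (pt t (psq s) k) w|] eta.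
  by move=> k; have [D D0 HD] := hI (Ik k) e0 eta0; exists D.
have [D0 [D00 D0le]] : exists D0 : R, 0 < D0 /\ forall k, (k <= size (psq s))%N -> D0 <= D k.
  elim: (size (psq s)) => [|n [D0 [D00 IH]]].
    by exists (D 0%N); split; [exact: (HD _).1|move=> k; rewrite leqn0 => /eqP->].
  exists (Num.min D0 (D n.+1)); rewrite lt_min D00 (HD _).1; split => // k.
  rewrite leq_eqVlt => /predU1P[->|kn]; first by rewrite ge_min lexx orbT.
  by rewrite ge_min IH.
(* With r = floor(t / D0) every refined step is at most t / (r+1) < D0; [D0] serves the finitely
   many coarse points at once. *)
exists (Num.truncn (t / D0)) => k ks.
have cs : (coarse (s, Num.truncn (t / D0)) k <= size (rsq (s, Num.truncn (t / D0))))%N.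
  by rewrite size_refine leq_mul2r ks orbT.
rewrite fine_integral_trapezoid//; apply: (HD k).2.
  rewrite -(pt_coarse (s, Num.truncn (t / D0)) k).
  exact: partition_take (rsqP _) cs.
move=> j; rewrite size_takel// => jc; rewrite -(pt_coarse (s, Num.truncn (t / D0)) k) !pt_take//; last exact: ltnW.
rewrite !pt_rsq refined_pt_inc; apply: lt_le_trans (D0le _ ks).
rewrite ltr_pdivrMr//; apply: (@le_lt_trans _ _ t).
  rewrite lerBlDr (le_trans (pt_le_end _ ps))// lerDl; exact: pt_ge0.
by rewrite mulrC -ltr_pdivrMr//; exact: truncnS_gt.
Qed.

(** The order of choices matters: the coarse mesh makes the block error small for all refinements,
    and only then, with the partition fixed, is [r] taken so large that the fine sums are close to
    [I] at every coarse point. *)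
Lemma stratonovich_assoc : small P (mesh_filter t (@psq R t)) (fun nu _ w =>
  \sum_(0 <= k < size (psq nu)) 2^-1 * (U (pt t (psq nu) k) w + U (pt t (psq nu) k.+1) w)
     * (I (pt t (psq nu) k.+1) w - I (pt t (psq nu) k) w)
  - trapezoidal_sum (fun s w => U s w * F s w) Y t (psq nu) w).
Proof.
move=> e eta e0 eta0.
have e20 : 0 < e / 2 by rewrite divr_gt0.
have eta20 : 0 < eta / 2 by rewrite divr_gt0.
have eta40 : 0 < eta / 2 / 2 by rewrite divr_gt0.
have [D D0 HD] := small_block_err e20 eta40.
have [aU cU _] := sU.
have [C C0 HC] := paths_bounded (fun s => adapted_measurable mW aU (s := s)) cU t eta40.
exists D => // s mesh.
have ps : itv_partition 0 t (psq s) := psqP s.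
(* There are at most [K] terms, each with a weight at most [C] and an increment of [I] off by at
   most 2 e'; so the total is at most 2 C K e' = e / 2. *)
pose K := (size (psq s)).+1; pose e' := e / 2 / (2 * C * K%:R).
have K0 : 0 < K%:R :> R by rewrite ltr0n.
have e'0 : 0 < e' by rewrite !divr_gt0// !mulr_gt0.
have eta'0 : 0 < eta / 2 / K%:R by rewrite divr_gt0.
have [r Hr] := fine_integral_cvg s e'0 eta'0.
have h1 := HD (s, r) mesh.
pose Bk k := if (k <= size (psq s))%N
  then [set w | e' <= `|fine_integral (s, r) k w - I (pt t (psq s) k) w|] else set0.
have hB : outer_le P (\big[setU/set0]_(k <- iota 0 K) Bk k) (eta / 2).
  apply: (le_trans (@mu_ext_sum _ _ _ P _ (iota 0 K) Bk (eta / 2 / K%:R) _)).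
    move=> k; rewrite /Bk; case: ifP => ks; first exact: Hr.
    by rewrite mu_ext0// lee_fin ltW.
  by rewrite size_iota lee_fin -[_ *+ K]mulr_natr divfK// gt_eqF.
apply: outer_leS (outer_leU (outer_leU h1 HC) hB) => w [_ /= hw].
apply: contrapT => /not_orP[/not_orP[/forallNP n1 n2] n3].
have Ub k : `|U (pt t (psq s) k) w| <= C.
  rewrite leNgt; apply/negP => hC; apply: n2; exists (pt t (psq s) k) => //.
  by rewrite pt_ge0 ?pt_le_end.
have Ib k : (k <= size (psq s))%N -> `|fine_integral (s, r) k w - I (pt t (psq s) k) w| <= e'.
  move=> ks; rewrite leNgt; apply/negP => hC; apply: n3.
  rewrite -bigcup_seq; exists k; first by change (is_true (k \in iota 0 K)); rewrite mem_iota.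
  by rewrite /Bk ks /= ltW.
have := n1 (coarse (s, r) (size (psq s))); rewrite block_total /= => /negP; rewrite -leNgt => h2.
move: hw; apply/negP; rewrite -leNgt.
set A := \sum_(0 <= k < _) _; set B := trapezoidal_sum _ _ _ _ _.
move: h2; set A' := \sum_(0 <= k < _) _ => h2.
have AA : `|A - A'| <= e / 2.
  rewrite /A /A' -sumrB; apply: (le_trans (ler_norm_sum _ _ _)).
  apply: (@le_trans _ _ (\sum_(0 <= k < size (psq s)) C * (2 * e'))).
    rewrite big_nat_cond [leRHS]big_nat_cond; apply: ler_sum => k /andP[/andP[_ ks] _].
    rewrite -mulrBr normrM; apply: ler_pM => //.
      rewrite normrM ger0_norm// ler_pdivrMl//; apply: (le_trans (ler_normD _ _)).
      by have := Ub k; have := Ub k.+1; lra.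
    have := Ib _ (ltnW ks); have := Ib _ ks.
    set a := fine_integral _ _ _; set b := fine_integral _ _ _; set c := I _ _; set c' := I _ _.
    move=> h3 h4.
    have -> : c - c' - (a - b) = - (a - c) + (b - c') by ring.
    by apply: (le_trans (ler_normD _ _)); rewrite normrN; lra.
  rewrite sumr_const_nat subn0 -[_ *+ size _]mulr_natr.
  have p2 : 0 <= C * (2 * e') by apply: mulr_ge0; [exact: ltW|apply: mulr_ge0 => //; exact: ltW].
  apply: (@le_trans _ _ (C * (2 * e') * K%:R)); first by apply: ler_wpM2l => //; rewrite ler_nat.
  rewrite /e' le_eqVlt; apply/orP; left; apply/eqP.
  by move: (K%:R) K0 => K' K'0; field; rewrite !gt_eqF.
have -> : A - B = (A - A') + (A' - B) by ring.
by apply: (le_trans (ler_normD _ _)); lra.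
Qed.

End Associativity.

(** * Closed 2-forms along fields *)

Section Geometry.
Context {R : realType} {m : nat}.
Implicit Types (f : 'rV[R]_m -> R) (z u v y : 'rV[R]_m) (L : 'I_m -> 'rV[R]_m -> R).

Lemma dzE (a : 'I_m) z u : dz a z u = u 0 a.
Proof.
have dI : derivable (@id 'rV[R]_m) z u by exact: derivable_id.
have /(congr1 (fun x : 'rV[R]_m => x 0 a)) := derive_mx dI.
by rewrite derive_id mxE.
Qed.

(** By skew-symmetry of the curl the two terms of the wedge product contribute equally, which
    absorbs the factor 1/2. *)
Lemma half_curl_formE L z u v :
  half_curl_form L z u v = \sum_(a < m) \sum_(b < m) curl L a b z * u 0 a * v 0 b.
Proof.
rewrite /half_curl_form; apply: (@mulfI _ (2 : R)) => //; rewrite mulVKf//.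
have two (x : R) : 2 * x = x + x by ring.
rewrite two [X in _ = X + _]exchange_big -big_split/=; apply: eq_bigr => a _.
rewrite -big_split/=; apply: eq_bigr => b _; rewrite /wedge !dzE /curl.
by move: (partial a (L b) z) (partial b (L a) z) => p q; ring.
Qed.

Lemma oneformE L z u : oneform L z u = \sum_(a < m) L a z * u 0 a.
Proof. by apply: eq_bigr => a _; rewrite dzE. Qed.

Lemma derive_oneform L z u v : (forall a, smooth (L a)) ->
  'D_u (fun y => oneform L y v) z = \sum_(a < m) \sum_(b < m) u 0 a * v 0 b * partial a (L b) z.
Proof.
move=> sL; rewrite (_ : (fun y => _) = \sum_(b < m) (v 0 b \*: L b)); last first.
  by apply/funext => y; rewrite oneformE fct_sumE; apply: eq_bigr => b _; rewrite mulrC.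
have dL b : derivable (L b) z u by apply: diff_derivable; exact: smooth_differentiable.
rewrite derive_sum => [|b]; last exact: derivableZ.
rewrite exchange_big; apply: eq_bigr => b _ /=.
rewrite deriveZ// derive_coords; last exact: smooth_differentiable.
by rewrite scaler_sumr; apply: eq_bigr => a _; move: (partial a (L b) z) => p; rewrite /GRing.scale/=; ring.
Qed.

Lemma extd1_oneform L : (forall a, smooth (L a)) -> extd1 (oneform L) = half_curl_form L.
Proof.
move=> sL; apply/funext => z; apply/funext => u; apply/funext => v.
rewrite /extd1 !derive_oneform// half_curl_formE [X in _ - X]exchange_big -sumrB.
apply: eq_bigr => a _; rewrite -sumrB; apply: eq_bigr => b _ /=.
by rewrite /curl; move: (partial a (L b) z) (partial b (L a) z) => p q; ring.
Qed.

Lemma partial_curl L a b c z : (forall a, smooth (L a)) ->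
  partial c (curl L a b) z = partial c (partial a (L b)) z - partial c (partial b (L a)) z.
Proof.
by move=> sL; rewrite /curl partialB// => y; apply: smooth_differentiable; exact: smooth_partial.
Qed.

(* [d (d theta) = 0] in coordinates. *)
Lemma partial_curl_cyclic L a b c z : (forall a, smooth (L a)) ->
  partial c (curl L a b) z = partial b (curl L a c) z - partial a (curl L b c) z.
Proof.
move=> sL; rewrite !partial_curl// (partialC c a)// (partialC c b)// (partialC b a)//.
move: (partial a (partial c (L b)) z) (partial b (partial c (L a)) z).
by move: (partial a (partial b (L c)) z) => p q r; ring.
Qed.

Lemma curl_antisymmetrized_derivative L z u v c : (forall a, smooth (L a)) ->
  \sum_(a < m) (u 0 a * 'D_v (curl L a c) z - v 0 a * 'D_u (curl L a c) z)
  = \sum_(a < m) \sum_(b < m) u 0 a * v 0 b * partial c (curl L a b) z.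
Proof.
move=> sL; have dL a b : differentiable (curl L a b) z.
  by apply: smooth_differentiable; exact: smooth_curl.
under eq_bigr do rewrite !derive_coords// !big_distrr/=.
rewrite sumrB [X in _ - X]exchange_big -sumrB; apply: eq_bigr => a _.
rewrite -sumrB; apply: eq_bigr => b _ /=.
rewrite (partial_curl_cyclic a b c)//.
by move: (partial a (curl L b c) z) (partial b (curl L a c) z) => p q; ring.
Qed.

Lemma hessian_symmetric f z u v : smooth f ->
  \sum_(a < m) (u 0 a * 'D_v (partial a f) z - v 0 a * 'D_u (partial a f) z) = 0.
Proof.
move=> sf; have df a : differentiable (partial a f) z.
  by apply: smooth_differentiable; exact: smooth_partial.
under eq_bigr do rewrite !derive_coords// !big_distrr/=.
rewrite sumrB [X in _ - X]exchange_big -sumrB big1// => a _.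
rewrite -sumrB big1// => b _ /=.
by rewrite (partialC a b)//; move: (partial b _ z) => p; ring.
Qed.

Lemma curl_skew L a b z : curl L a b z = - curl L b a z.
Proof. by rewrite /curl opprB. Qed.

(** The right side is the derivative of M_ab u^a v^b when z, u, v move with velocities y, u', v';
    the left side is the antisymmetrized contraction of the linearized flux. Closedness of the
    2-form matches the terms in [y], skew-symmetry moves u' into the first slot. *)
Lemma curl_total_derivative L z u v y u' v' : (forall a, smooth (L a)) ->
  \sum_(a < m) (u 0 a * \sum_(b < m) ('D_v (curl L a b) z * y 0 b + curl L a b z * v' 0 b)
              - v 0 a * \sum_(b < m) ('D_u (curl L a b) z * y 0 b + curl L a b z * u' 0 b))
  = \sum_(a < m) \sum_(b < m) ('D_y (curl L a b) z * u 0 a * v 0 b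
      + curl L a b z * u' 0 a * v 0 b + curl L a b z * u 0 a * v' 0 b).
Proof.
move=> sL.
transitivity (\sum_(c < m) y 0 c * (\sum_(a < m) \sum_(b < m) u 0 a * v 0 b * partial c (curl L a b) z)
  + \sum_(a < m) \sum_(b < m) (curl L a b z * u' 0 a * v 0 b + curl L a b z * u 0 a * v' 0 b)).
  under [X in _ = X + _]eq_bigr do rewrite -curl_antisymmetrized_derivative// big_distrr/=.
  rewrite exchange_big/=.
  under [X in _ = _ + X]eq_bigr do rewrite big_split/=.
  rewrite [X in _ = _ + X]big_split/= [X in _ = _ + (X + _)]exchange_big/=.
  rewrite -!big_split/=; apply: eq_bigr => a _.
  rewrite -!big_split/= !big_distrr/= -sumrB; apply: eq_bigr => b _ /=.
  rewrite (curl_skew L b a).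
  by move: (curl L a b z) ('D_v (curl L a b) z) ('D_u (curl L a b) z) => p q r; ring.
under eq_bigr do rewrite big_distrr/=.
rewrite exchange_big/= -big_split/=; apply: eq_bigr => a _.
under eq_bigr do rewrite big_distrr/=.
rewrite exchange_big/= -big_split/=; apply: eq_bigr => b _.
rewrite derive_coords; last by apply: smooth_differentiable; exact: smooth_curl.
by rewrite !big_distrl/= -!addrA; congr (_ + _); apply: eq_bigr => c _; move: (partial c _ z) => p; ring.
Qed.

Lemma is_derive_comp n f (z : 'rV[R]_n -> 'rV[R]_m) (x h : 'rV[R]_n) :
  differentiable z x -> differentiable f (z x) ->
  is_derive x h (fun p => f (z p)) ('D_('D_h z x) f (z x)).
Proof.
move=> dz df; have dfz : differentiable (f \o z) x by exact: differentiable_comp.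
split; first exact: diff_derivable.
by rewrite (deriveE h dfz) (deriveE _ df) (deriveE h dz) diff_comp.
Qed.

(** The Leibniz rule for a total derivative, which also acts on the arguments [U] and [V] of the
    form. The result has the shape produced by [curl_total_derivative]. *)
Lemma derive_curl_along n L (z U V : 'rV[R]_n -> 'rV[R]_m) (x h : 'rV[R]_n) :
  (forall a, smooth (L a)) -> differentiable z x -> differentiable U x -> differentiable V x ->
  'D_h (fun p : 'rV[R]_n => half_curl_form L (z p) (U p) (V p)) x =
  \sum_(a < m) \sum_(b < m) ('D_('D_h z x) (curl L a b) (z x) * U x 0 a * V x 0 b
      + curl L a b (z x) * 'D_h U x 0 a * V x 0 b + curl L a b (z x) * U x 0 a * 'D_h V x 0 b).
Proof.
move=> sL dz dU dV.
have coord (Z : 'rV[R]_n -> 'rV[R]_m) a : differentiable Z x ->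
    is_derive x h (fun p => Z p 0 a) ('D_h Z x 0 a).
  move=> dZ; have dvZ : derivable Z x h by exact: diff_derivable.
  have := derive_mx dvZ => ->; rewrite mxE; apply: derivableP.
  by move/derivable_mxP : dvZ; exact.
have comp a b : is_derive x h (fun p => curl L a b (z p)) ('D_('D_h z x) (curl L a b) (z x)).
  by apply: is_derive_comp => //; apply: smooth_differentiable; exact: smooth_curl.
rewrite (_ : (fun p => _) = \sum_(a < m) \sum_(b < m)
    ((fun p => curl L a b (z p)) * (fun p => U p 0 a) * (fun p => V p 0 b))); last first.
  apply/funext => p; rewrite half_curl_formE fct_sumE; apply: eq_bigr => a _.
  by rewrite fct_sumE.
apply: derive_val; apply: is_derive_sum => a; apply: is_derive_sum => b.
apply: is_derive_eq; first exact: (is_deriveM (is_deriveM (comp a b) (coord U a dU)) (coord V b dV)).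
rewrite [X in X *: _ + _](_ : _ = curl L a b (z x) * U x 0 a)//.
move: (curl L a b (z x)) ('D_('D_h z x) _ (z x) : R) ('D_h U x 0 a) ('D_h V x 0 b) => c q r s.
by rewrite /GRing.scale/=; ring.
Qed.

End Geometry.

(** * Chain rule and time integrals *)

Section Trapezoid.
Context {R : realType} {d : measure_display} {T : measurableType d}.
Variables (P : probability T R) (W : R -> T -> R).
Hypothesis mW : forall t : R, 0 <= t -> measurable_fun [set: T] (W t).
Variable t : R.
Hypothesis t0 : 0 <= t.
Implicit Types (X Y Z U V F : R -> T -> R) (S : partitions t -> T -> R).
Local Notation CS := (continuous_semimartingale P W).
Local Notation Fil := (mesh_filter t (@psq R t)).

Definition vanishing S := small P Fil (fun nu _ => S nu).

Definition trap X Y : partitions t -> T -> R := fun nu => trapezoidal_sum X Y t (psq nu).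

Lemma vanishing_ae S S' : (forall nu, {ae P, forall w, S nu w = S' nu w}) ->
  vanishing S -> vanishing S'.
Proof.
move=> h sS e eta e0 eta0; have := sS e eta e0 eta0; apply: filterS => nu hnu.
apply: outer_leS (outer_le_negligible (h nu) hnu) => w [_ hj].
by have [E|nE] := pselect (S nu w = S' nu w); [left; exists 0%N; rewrite E|right].
Qed.

Lemma vanishing_eq S S' : (forall nu w, S nu w = S' nu w) -> vanishing S -> vanishing S'.
Proof. by move=> h; apply: vanishing_ae => nu; exact: aeW. Qed.

Lemma vanishing_last a : small P Fil (csum a) ->
  vanishing (fun nu w => csum a nu (size (psq nu)) w).
Proof. exact: (small_reindex (fun nu _ => size (psq nu))). Qed.

Lemma vanishingD S S' : vanishing S -> vanishing S' -> vanishing (fun nu w => S nu w + S' nu w).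
Proof. by move=> h h'; apply: smallD. Qed.

Lemma vanishingB S S' : vanishing S -> vanishing S' -> vanishing (fun nu w => S nu w - S' nu w).
Proof. by move=> h h'; apply: smallB. Qed.

Lemma vanishingN S : vanishing S -> vanishing (fun nu w => - S nu w).
Proof. by move=> h; apply: smallN. Qed.

Lemma vanishing_sum (J : Type) (r : seq J) (S : J -> partitions t -> T -> R) :
  (forall j, vanishing (S j)) -> vanishing (fun nu w => \sum_(j <- r) S j nu w).
Proof. by move=> h; apply: small_sum. Qed.

Lemma trap_sum (J : Type) (r : seq J) (F : J -> R -> T -> R) Y nu w :
  trap (fun s w => \sum_(j <- r) F j s w) Y nu w = \sum_(j <- r) trap (F j) Y nu w.
Proof.
rewrite /trap /trapezoidal_sum exchange_big; apply: eq_bigr => k _.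
by rewrite -big_split/= big_distrr/= big_distrl.
Qed.

Lemma trapB X X' Y nu w :
  trap (fun s w => X s w - X' s w) Y nu w = trap X Y nu w - trap X' Y nu w.
Proof. by rewrite /trap /trapezoidal_sum -sumrB; apply: eq_bigr => k _; ring. Qed.

Lemma trap_eq X X' Y nu w : (forall s : R, 0 <= s -> X s w = X' s w) ->
  trap X Y nu w = trap X' Y nu w.
Proof.
move=> h; apply: eq_bigr => k _; rewrite !h//; apply: pt_ge0; exact: psqP.
Qed.

(** Exact on every partition: trapezoidal weights are symmetric in the two ends of a step, so the
    products of increments cancel and no bracket is left. *)
Lemma trap_product X Y nu w :
  trap X Y nu w + trap Y X nu w = X t w * Y t w - X 0 w * Y 0 w.
Proof.
have ps : itv_partition 0 t (psq nu) := psqP nu.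
rewrite /trap /trapezoidal_sum -big_split/=.
rewrite (@telescope_sumr_eq _ _ _ (fun k => X (pt t (psq nu) k) w * Y (pt t (psq nu) k) w))//.
  by rewrite (pt_size ps (leqnn _)).
by move=> k _; field.
Qed.

(** The product of two averages differs from the average of the products by -1/4 dX dY, which
    against dZ is of third order. *)
Lemma vanishing_third_order X Y Z : CS X -> CS Y -> CS Z -> vanishing (fun nu w =>
  \sum_(0 <= k < size (psq nu)) 2^-1 * (X (pt t (psq nu) k) w + X (pt t (psq nu) k.+1) w)
     * (2^-1 * (Y (pt t (psq nu) k) w + Y (pt t (psq nu) k.+1) w))
     * (Z (pt t (psq nu) k.+1) w - Z (pt t (psq nu) k) w)
  - trap (fun s w => X s w * Y s w) Z nu w).
Proof.
move=> sX sY sZ.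
have vsq nu : itv_partition 0 t (psq nu) := @psqP R t nu.
have sa : small P Fil (fun nu j w => - 4^-1 * inc t (@psq R t) X nu j w).
  apply: smallM; first exact: tight_cst.
  by apply: (small_inc mW vsq sX) => D; exact: mesh_filter_mesh.
apply: vanishing_eq (vanishing_last (small_bracket mW t0 vsq sY sZ sa)) => nu w.
rewrite /trap /trapezoidal_sum -sumrB; apply: eq_bigr => k _; rewrite /inc.
by field.
Qed.

(** [small_trapezoid], with the average of [X] as weight, replaces the increment of g(z) by averaged
    partial derivatives; the product of the two averages is then merged into one by
    [vanishing_third_order]. *)
Lemma vanishing_chain_rule m (z : R -> T -> 'rV[R]_m) (g : 'rV[R]_m -> R) X :
  (forall c, CS (fun s w => z s w 0 c)) -> smooth g -> CS X ->
  vanishing (fun nu w => trap X (fun s w => g (z s w)) nu w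
    - \sum_(c < m) trap (fun s w => X s w * partial c g (z s w)) (fun s w => z s w 0 c) nu w).
Proof.
move=> sz sg sX.
have vsq nu : itv_partition 0 t (psq nu) := @psqP R t nu.
pose avg nu j w := 2^-1 * (X (pt t (@psq R t nu) j) w + X (pt t (psq nu) j.+1) w).
have tavg : tight P Fil avg.
  apply: tightM; first exact: tight_cst.
  have tX : tight P Fil (smp t (@psq R t) X) .
    by apply: (tight_smp mW vsq sX).
  exact: (tightD tX (tight_reindex (fun _ j => j.+1) tX)).
have mesh (D : R) : 0 < D -> \forall nu \near Fil, forall j, pt t (psq nu) j.+1 - pt t (psq nu) j < D.
  exact: mesh_filter_mesh.
pose proof (vanishing_last (small_trapezoid mW sz t0 vsq sg tavg mesh)) as h1.
have sp c : CS (fun s w => partial c g (z s w)).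
  by apply: continuous_semimartingale_comp => //; exact: smooth_partial.
have h2 := vanishing_sum (index_enum 'I_m) (fun c => vanishing_third_order sX (sp c) (sz c)).
apply: vanishing_eq (vanishingD h1 h2) => nu w; rewrite sumrB addrA; congr (_ - _).
rewrite /csum exchange_big -big_split/=; apply: eq_bigr => k _.
rewrite /avg /inc mulrBr -addrA -[RHS]addr0; congr (_ + _); apply/eqP.
rewrite addrC subr_eq0 big_distrr; apply/eqP; apply: eq_bigr => c _ /=.
by rewrite !mulrA.
Qed.

(** Integration by parts between [G] and U V is exact, and the increment of U V splits exactly into
    averages times increments. Only merging these averages with that of [G] costs third-order
    terms. *)
Lemma vanishing_product_rule (G U V : R -> T -> R) : CS G -> CS U -> CS V -> vanishing (fun nu w =>
  G t w * (U t w * V t w) - G 0 w * (U 0 w * V 0 w)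
  - (trap (fun s w => U s w * V s w) G nu w + trap (fun s w => G s w * U s w) V nu w
     + trap (fun s w => G s w * V s w) U nu w)).
Proof.
move=> sG sU sV.
apply: vanishing_eq (vanishingD (vanishing_third_order sG sU sV) (vanishing_third_order sG sV sU)) => nu w.
rewrite -(trap_product G (fun s w => U s w * V s w) nu w).
have -> : trap G (fun s w => U s w * V s w) nu w =
    \sum_(0 <= k < size (psq nu)) 2^-1 * (G (pt t (psq nu) k) w + G (pt t (psq nu) k.+1) w)
     * (2^-1 * (U (pt t (psq nu) k) w + U (pt t (psq nu) k.+1) w))
     * (V (pt t (psq nu) k.+1) w - V (pt t (psq nu) k) w)
  + \sum_(0 <= k < size (psq nu)) 2^-1 * (G (pt t (psq nu) k) w + G (pt t (psq nu) k.+1) w)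
     * (2^-1 * (V (pt t (psq nu) k) w + V (pt t (psq nu) k.+1) w))
     * (U (pt t (psq nu) k.+1) w - U (pt t (psq nu) k) w).
  by rewrite -big_split/=; apply: eq_bigr => k _; field.
move: (\sum_(0 <= k < _) _) (\sum_(0 <= k < _) _) => A B.
by move: (trap _ G nu w) (trap _ V nu w) (trap _ U nu w) => p q r; ring.
Qed.

End Trapezoid.

(** * Time integrals as limits of trapezoidal sums *)

Section TimeIntegral.
Context {R : realType}.
Implicit Types f : R -> R.
Local Notation mu := (@lebesgue_measure R).

Lemma Rintegral_itv_cst (a b c : R) : a <= b -> \int[mu]_(_ in `]a, b]) c = c * (b - a).
Proof.
move=> ab; rewrite Rintegral_cst//.
transitivity (c * fine (lebesgue_measure (`]a, b]%classic : set R))) => //.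
rewrite lebesgue_measure_itv/= lte_fin.
have [//|ba] := ltP a b; have -> : a = b by apply/eqP; rewrite eq_le ab.
by rewrite subrr.
Qed.

Lemma within_continuous_integrable f (b : R) : {within `[0, +oo[, continuous f} ->
  mu.-integrable `[0, b] (EFin \o f).
Proof.
move=> cf; apply: continuous_compact_integrable; first exact: segment_compact.
by apply: continuous_subspaceW cf => s /=; rewrite !in_itv/= => /andP[-> _].
Qed.

Lemma trapezoid_time f (a b e : R) : {within `[0, +oo[, continuous f} -> 0 <= a <= b ->
  (forall s r : R, a <= s <= b -> a <= r <= b -> `|f s - f r| <= e) ->
  `|2^-1 * (f a + f b) * (b - a) - (\int[mu]_(s in `[0, b]) f s - \int[mu]_(s in `[0, a]) f s)|
    <= e * (b - a).
Proof.
move=> cf /andP[a0 ab] osc; have b0 := le_trans a0 ab.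
have If := within_continuous_integrable b cf.
rewrite Rintegral_itvB//= ?bnd_simp//.
have Iab (g : R -> R) : {within `[0, +oo[, continuous g} -> mu.-integrable `]a, b] (EFin \o g).
  move=> cg; apply: integrableS (within_continuous_integrable b cg) => //= s /=.
  by rewrite !in_itv/= => /andP[/ltW ar ->]; rewrite (le_trans a0 ar).
have Ifab := Iab _ cf.
have Ic (c : R) : mu.-integrable `]a, b] (EFin \o fun=> c).
  by apply: Iab; apply: continuous_subspaceT => x; exact: cvg_cst.
rewrite -(Rintegral_itv_cst (2^-1 * (f a + f b)) ab) -(RintegralB _ (Ic _) Ifab)//.
have Id : mu.-integrable `]a, b] (EFin \o (fun s => 2^-1 * (f a + f b) - f s)).
  exact: (integrableB _ (Ic _) Ifab).
apply: (le_trans (le_normr_Rintegral _ Id)) => //.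
rewrite -Rintegral_itv_cst//; apply: le_Rintegral => //; first exact: integrable_norm Id.
move=> s /=; rewrite in_itv/= => /andP[/ltW ar sb].
have h1 := osc a s; have h2 := osc b s.
have {}h1 := h1 (introT andP (conj (lexx a) ab)) (introT andP (conj ar sb)).
have {}h2 := h2 (introT andP (conj ab (lexx b))) (introT andP (conj ar sb)).
have -> : 2^-1 * (f a + f b) - f s = 2^-1 * (f a - f s) + 2^-1 * (f b - f s) by field.
move: (f a - f s : R) (f b - f s : R) h1 h2 => p q h1 h2.
by apply: (le_trans (ler_normD _ _)); rewrite !normrM [`|2^-1|]ger0_norm//; lra.
Qed.

End TimeIntegral.

Section Time.
Context {R : realType} {d : measure_display} {T : measurableType d}.
Variables (P : probability T R) (W : R -> T -> R).
Hypothesis mW : forall t : R, 0 <= t -> measurable_fun [set: T] (W t).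
Local Notation CS := (continuous_semimartingale P W).

Definition time : R -> T -> R := fun s _ => s.

Lemma continuous_semimartingale_time : CS time.
Proof.
split=> [t _||t e t0 e0].
- exact: measurable_wrt_cst.
- by apply: aeW => w; apply: continuous_subspaceT => x; exact: cvg_id.
(* Elementary integrals against time are bounded by its total variation [t], so the event is
   empty. *)
exists t => s h ps ah h1; rewrite (_ : [set w | _] = set0) ?measure0 ?lee_fin ?ltW//.
rewrite -subset0 => w /=; apply/negP; rewrite -leNgt.
apply: (le_trans (ler_norm_sum _ _ _)).
apply: (@le_trans _ _ (\sum_(0 <= k < size s) (pt t s k.+1 - pt t s k))).
  apply: ler_sum => k _; have d0 : 0 <= pt t s k.+1 - pt t s k by rewrite subr_ge0 pt_leS.
  by rewrite normrM /time (ger0_norm d0) ler_piMl.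
by rewrite telescope_sumr// (pt_size ps (leqnn _)) pt0 subr0.
Qed.

Lemma time_integral_trapezoid (F : R -> T -> R) (t : R) : CS F -> 0 <= t ->
  vanishing P (fun nu w => trap (t := t) F time nu w - time_integral F t w).
Proof.
move=> [aF cF _] t0 e eta e0 eta0.
(* The denominator is t + 1 rather than [t] in order to include t = 0. *)
have e1 : 0 < e / (t + 1) by rewrite divr_gt0// ltr_wpDl.
have mF (s : R) : 0 <= s -> measurable_fun setT (F s) by apply: (adapted_measurable mW aF).
have [D D0 HD] := paths_modulus mF cF t e1 eta0.
exists D => // nu mesh; apply: outer_leS (outer_le_negligible cF HD) => w [_ hw].
apply: contrapT => /not_orP[/forallNP h1 /contrapT cw].
have ps : itv_partition 0 t (psq nu) := psqP nu.
have tau k : 0 <= pt t (psq nu) k <= t by rewrite pt_ge0 ?pt_le_end.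
have osc s r : 0 <= s <= t -> 0 <= r <= t -> `|s - r| < D -> `|F s w - F r w| <= e / (t + 1).
  move=> hs hr sr; rewrite leNgt; apply/negP => lt; apply: (h1 s); exists r; split => //.
have step j : `|\sum_(0 <= k < j) 2^-1 * (F (pt t (psq nu) k) w + F (pt t (psq nu) k.+1) w)
      * (pt t (psq nu) k.+1 - pt t (psq nu) k) - time_integral F (pt t (psq nu) j) w|
    <= e / (t + 1) * pt t (psq nu) j.
  elim: j => [|j IH].
    rewrite big_nil pt0 mulr0 /time_integral set_itv1 Rintegral_set1 subr0 normr0//.
  have jj := pt_leS j ps; have := @trapezoid_time R (F ^~ w) _ _ (e / (t + 1)) cw.
  move=> /(_ (pt t (psq nu) j) (pt t (psq nu) j.+1)); rewrite jj pt_ge0// => /(_ isT).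
  have h s : pt t (psq nu) j <= s <= pt t (psq nu) j.+1 -> 0 <= s <= t.
    by move=> /andP[js sj]; rewrite (le_trans _ js) ?pt_ge0// (le_trans sj)// pt_le_end.
  have h2 s r : pt t (psq nu) j <= s <= pt t (psq nu) j.+1 ->
      pt t (psq nu) j <= r <= pt t (psq nu) j.+1 -> `|F s w - F r w| <= e / (t + 1).
    move=> hs hr; apply: osc; [exact: h|exact: h|].
    by have := mesh j; rewrite ltr_norml; lra.
  move=> /(_ h2) st; rewrite big_nat_recr//=.
  have {}st : `|2^-1 * (F (pt t (psq nu) j) w + F (pt t (psq nu) j.+1) w)
      * (pt t (psq nu) j.+1 - pt t (psq nu) j)
      - (time_integral F (pt t (psq nu) j.+1) w - time_integral F (pt t (psq nu) j) w)|
    <= e / (t + 1) * (pt t (psq nu) j.+1 - pt t (psq nu) j) by exact: st.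
  move: IH st; move: (\sum_(0 <= k < j) _) (time_integral F _ w) (time_integral F _ w) => A B C.
  move: (2^-1 * _ * _) (e / _) => E e' IH st.
  have -> : A + E - B = (A - C) + (E - (B - C)) by ring.
  apply: (le_trans (ler_normD _ _)).
  have -> : e' * pt t (psq nu) j.+1 = e' * pt t (psq nu) j + e' * (pt t (psq nu) j.+1 - pt t (psq nu) j) by ring.
  exact: lerD.
move: hw; apply/negP; rewrite -leNgt.
have := step (size (psq nu)); rewrite (pt_size ps (leqnn _)).
move/le_trans; apply; rewrite -mulrA ler_piMr ?(ltW e0)// ler_pdivrMl ?mulr1 ?ltr_wpDl//.
by rewrite lerDl.
Qed.

Lemma time_integral_stratonovich (F : R -> T -> R) (t : R) : CS F -> 0 <= t ->
  stratonovich P F time t (time_integral F t).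
Proof. by move=> sF t0; apply: small_stratonovich => //; exact: time_integral_trapezoid. Qed.

End Time.

(** * The conservation law *)

Section Weighted.
Context {R : realType} {d : measure_display} {T : measurableType d} {t : R}.
Implicit Types (X U I : R -> T -> R) (nu : partitions t).

(** The same sum as in [trap], named apart because [I] is an integral as a function of its upper
    limit. Linearity in [I] allows a whole integrated equation to be contracted term by term. *)
Definition weighted U I nu w : R :=
  \sum_(0 <= k < size (psq nu)) 2^-1 * (U (pt t (psq nu) k) w + U (pt t (psq nu) k.+1) w)
     * (I (pt t (psq nu) k.+1) w - I (pt t (psq nu) k) w).

Lemma weightedD U I I' nu w :
  weighted U (fun s w => I s w + I' s w) nu w = weighted U I nu w + weighted U I' nu w.
Proof. by rewrite /weighted -big_split; apply: eq_bigr => k _ /=; ring. Qed.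

Lemma weightedB U I I' nu w :
  weighted U (fun s w => I s w - I' s w) nu w = weighted U I nu w - weighted U I' nu w.
Proof. by rewrite /weighted -sumrB; apply: eq_bigr => k _ /=; ring. Qed.

Lemma weighted_sum (J : Type) (r : seq J) U (I : J -> R -> T -> R) nu w :
  weighted U (fun s w => \sum_(j <- r) I j s w) nu w = \sum_(j <- r) weighted U (I j) nu w.
Proof.
rewrite /weighted exchange_big; apply: eq_bigr => k _ /=.
by rewrite -sumrB big_distrr.
Qed.

Lemma weighted_eq0 U I nu w : (forall k, I (pt t (psq nu) k) w = 0) -> weighted U I nu w = 0.
Proof. by move=> h; apply: big1 => k _; rewrite !h subrr mulr0. Qed.

Lemma trapN X Y nu w : trap (fun s w => - X s w) Y nu w = - trap X Y nu w.
Proof. by rewrite /trap /trapezoidal_sum -sumrN; apply: eq_bigr => k _; ring. Qed.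

End Weighted.

(** * Exact identities between trapezoidal sums *)

Section TrapIdentities.
Context {R : realType} {d : measure_display} {T : measurableType d} {t : R} {n m : nat}.
Implicit Types (nu : partitions t) (w : T) (L : 'I_m -> 'rV[R]_m -> R).
Variables (z u v : R -> T -> 'rV[R]_m) (zx ux vx : 'I_n -> R -> T -> 'rV[R]_m).

Lemma trap_curl_derivative L nu w : (forall a, smooth (L a)) ->
  \sum_(a < m) \sum_(b < m)
    (trap (fun s w => u s w 0 a * 'D_(v s w) (curl L a b) (z s w)) (fun s w => z s w 0 b) nu w
   - trap (fun s w => v s w 0 a * 'D_(u s w) (curl L a b) (z s w)) (fun s w => z s w 0 b) nu w)
  = \sum_(a < m) \sum_(b < m) \sum_(c < m)
     trap (fun s w => u s w 0 a * v s w 0 b * partial c (curl L a b) (z s w))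
       (fun s w => z s w 0 c) nu w.
Proof.
move=> sL; rewrite exchange_big /=.
transitivity (\sum_(c < m) \sum_(a < m) \sum_(b < m)
     trap (fun s w => u s w 0 a * v s w 0 b * partial c (curl L a b) (z s w))
       (fun s w => z s w 0 c) nu w).
  apply: eq_bigr => c _.
  under eq_bigr do rewrite -trapB.
  rewrite -trap_sum.
  under eq_bigr do rewrite -trap_sum.
  rewrite -trap_sum; apply: trap_eq => s _.
  exact: curl_antisymmetrized_derivative.
rewrite exchange_big; apply: eq_bigr => a _; exact: exchange_big.
Qed.

Lemma trap_curl_skew L nu w :
  - (\sum_(a < m) \sum_(b < m)
    trap (fun s w => v s w 0 a * curl L a b (z s w)) (fun s w => u s w 0 b) nu w)
  = \sum_(a < m) \sum_(b < m)
    trap (fun s w => curl L a b (z s w) * v s w 0 b) (fun s w => u s w 0 a) nu w.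
Proof.
rewrite exchange_big -sumrN; apply: eq_bigr => a _; rewrite -sumrN; apply: eq_bigr => b _.
by rewrite -trapN; apply: trap_eq => s _; rewrite (curl_skew L a b) mulNr mulrC.
Qed.

Definition curl_flux L i s w : R :=
  \sum_(a < m) \sum_(b < m) ('D_(zx i s w) (curl L a b) (z s w) * u s w 0 a * v s w 0 b
      + curl L a b (z s w) * ux i s w 0 a * v s w 0 b + curl L a b (z s w) * u s w 0 a * vx i s w 0 b).

Lemma trap_curl_flux (L : 'I_n -> 'I_m -> 'rV[R]_m -> R) Y nu w :
  (forall i a, smooth (L i a)) ->
  \sum_(a < m) (trap (fun s w => u s w 0 a * \sum_(i < n) \sum_(b < m)
        ('D_(v s w) (curl (L i) a b) (z s w) * zx i s w 0 b
         + curl (L i) a b (z s w) * vx i s w 0 b)) Y nu w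
    - trap (fun s w => v s w 0 a * \sum_(i < n) \sum_(b < m)
        ('D_(u s w) (curl (L i) a b) (z s w) * zx i s w 0 b
         + curl (L i) a b (z s w) * ux i s w 0 b)) Y nu w)
  = trap (fun s w => \sum_(i < n) curl_flux (L i) i s w) Y nu w.
Proof.
move=> sL; under eq_bigr do rewrite -trapB.
rewrite -trap_sum; apply: trap_eq => s _.
under eq_bigr do rewrite !big_distrr -sumrB/=.
rewrite exchange_big; apply: eq_bigr => i _; exact: curl_total_derivative.
Qed.

Lemma trap_hessian (f : 'rV[R]_m -> R) Y nu w : smooth f ->
  \sum_(a < m) (trap (fun s w => u s w 0 a * 'D_(v s w) (partial a f) (z s w)) Y nu w
    - trap (fun s w => v s w 0 a * 'D_(u s w) (partial a f) (z s w)) Y nu w) = 0.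
Proof.
move=> sf; under eq_bigr do rewrite -trapB.
rewrite -trap_sum (trap_eq (X' := fun _ _ => 0)) => [|s _]; last exact: hessian_symmetric.
by apply: big1 => k _; rewrite addr0 mulr0 mul0r.
Qed.

Lemma sum_system (A A' B B' : 'I_m -> 'I_m -> R) (C C' D D' E E' F F' : 'I_m -> R) :
  \sum_(a < m) (\sum_(b < m) (A a b + B a b) + C a + D a - E a - F a
    - (\sum_(b < m) (A' a b + B' a b) + C' a + D' a - E' a - F' a))
  = \sum_(a < m) \sum_(b < m) (A a b - A' a b) + \sum_(a < m) \sum_(b < m) B a b
    + - (\sum_(a < m) \sum_(b < m) B' a b) + \sum_(a < m) (C a - C' a)
    + \sum_(a < m) (D a - D' a) - \sum_(a < m) (E a - E' a) - \sum_(a < m) (F a - F' a).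
Proof.
rewrite -sumrN -!big_split/= -!sumrB; apply: eq_bigr => a _.
rewrite !big_split/= sumrN.
move: (\sum_(b < m) A a b) (\sum_(b < m) B a b) (\sum_(b < m) A' a b) (\sum_(b < m) B' a b).
by move=> p q p' q'; ring.
Qed.

(** Trapezoidal sums are linear in the integrand, so the pointwise identities for curls and Hessians
    apply on each partition, before any limit. On the right stand the sums of the chain rule for
    M_ab u^a v^b and the two fluxes. *)
Lemma trap_antisymmetrized_system (L0 : 'I_m -> 'rV[R]_m -> R)
    (L Lt : 'I_n -> 'I_m -> 'rV[R]_m -> R) (H Ht : 'rV[R]_m -> R) (Y W : R -> T -> R) nu w :
  (forall a, smooth (L0 a)) -> (forall i a, smooth (L i a)) -> (forall i a, smooth (Lt i a)) ->
  smooth H -> smooth Ht ->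
  \sum_(a < m)
    (\sum_(b < m) (trap (fun s w => u s w 0 a * 'D_(v s w) (curl L0 a b) (z s w))
                    (fun s w => z s w 0 b) nu w
                + trap (fun s w => u s w 0 a * curl L0 a b (z s w)) (fun s w => v s w 0 b) nu w)
    + trap (fun s w => u s w 0 a * \sum_(i < n) \sum_(b < m)
            ('D_(v s w) (curl (L i) a b) (z s w) * zx i s w 0 b
             + curl (L i) a b (z s w) * vx i s w 0 b)) Y nu w
    + trap (fun s w => u s w 0 a * \sum_(i < n) \sum_(b < m)
            ('D_(v s w) (curl (Lt i) a b) (z s w) * zx i s w 0 b
             + curl (Lt i) a b (z s w) * vx i s w 0 b)) W nu w
    - trap (fun s w => u s w 0 a * 'D_(v s w) (partial a H) (z s w)) Y nu w
    - trap (fun s w => u s w 0 a * 'D_(v s w) (partial a Ht) (z s w)) W nu w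
    - (\sum_(b < m) (trap (fun s w => v s w 0 a * 'D_(u s w) (curl L0 a b) (z s w))
                    (fun s w => z s w 0 b) nu w
                + trap (fun s w => v s w 0 a * curl L0 a b (z s w)) (fun s w => u s w 0 b) nu w)
    + trap (fun s w => v s w 0 a * \sum_(i < n) \sum_(b < m)
            ('D_(u s w) (curl (L i) a b) (z s w) * zx i s w 0 b
             + curl (L i) a b (z s w) * ux i s w 0 b)) Y nu w
    + trap (fun s w => v s w 0 a * \sum_(i < n) \sum_(b < m)
            ('D_(u s w) (curl (Lt i) a b) (z s w) * zx i s w 0 b
             + curl (Lt i) a b (z s w) * ux i s w 0 b)) W nu w
    - trap (fun s w => v s w 0 a * 'D_(u s w) (partial a H) (z s w)) Y nu w
    - trap (fun s w => v s w 0 a * 'D_(u s w) (partial a Ht) (z s w)) W nu w))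
  = \sum_(a < m) \sum_(b < m)
      (\sum_(c < m) trap (fun s w => u s w 0 a * v s w 0 b * partial c (curl L0 a b) (z s w))
         (fun s w => z s w 0 c) nu w
      + trap (fun s w => u s w 0 a * curl L0 a b (z s w)) (fun s w => v s w 0 b) nu w
      + trap (fun s w => curl L0 a b (z s w) * v s w 0 b) (fun s w => u s w 0 a) nu w)
    + trap (fun s w => \sum_(i < n) curl_flux (L i) i s w) Y nu w
    + trap (fun s w => \sum_(i < n) curl_flux (Lt i) i s w) W nu w.
Proof.
move=> sL0 sL sLt sH sHt; rewrite sum_system trap_curl_derivative// trap_curl_skew.
rewrite !trap_curl_flux// !trap_hessian// !subr0 -!big_split/=.
congr (_ + _ + _); apply: eq_bigr => a _; by rewrite -!big_split.
Qed.

End TrapIdentities.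

(** * From the linearized system to the conservation law *)

Section ConservationLaw.
Context {R : realType} {d : measure_display} {T : measurableType d} {n m : nat}.
Variables (P : probability T R) (W : R -> T -> R).
Hypothesis hW : brownian P W.
Variables (L0 : 'I_m -> 'rV[R]_m -> R) (L Lt : 'I_n -> 'I_m -> 'rV[R]_m -> R).
Variables (H Ht : 'rV[R]_m -> R).
Hypothesis sL0 : forall a, smooth (L0 a).
Hypothesis sL : forall i a, smooth (L i a).
Hypothesis sLt : forall i a, smooth (Lt i a).
Hypotheses (sH : smooth H) (sHt : smooth Ht).
Local Notation rfield := ('rV[R]_n -> R -> T -> 'rV[R]_m).
Variable z : rfield.
Hypothesis hz : regular_field P W z.
Local Notation CS := (continuous_semimartingale P W).
Let mW : forall t : R, 0 <= t -> measurable_fun [set: T] (W t).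
Proof. exact: brownian_measurable hW. Qed.
Let sW : CS W. Proof. exact: brownian_semimartingale. Qed.
Let sT : CS time. Proof. exact: continuous_semimartingale_time. Qed.
Variables (x : 'rV[R]_n) (t : R).
Hypothesis t0 : 0 <= t.

Lemma continuous_semimartingale_derive (Z V : R -> T -> 'rV[R]_m) (g : 'rV[R]_m -> R) :
  smooth g -> (forall c, CS (fun s w => Z s w 0 c)) -> (forall c, CS (fun s w => V s w 0 c)) ->
  CS (fun s w => 'D_(V s w) g (Z s w)).
Proof.
move=> sg sZ sV.
rewrite (_ : (fun s w => _) = fun s w => \sum_(c < m) V s w 0 c * partial c g (Z s w)).
  apply: continuous_semimartingale_sum => // c; apply: continuous_semimartingaleM => //.
  by apply: continuous_semimartingale_comp => //; exact: smooth_partial.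
by apply/funext => s; apply/funext => w; apply: derive_coords; exact: smooth_differentiable.
Qed.

(** The integrated equation holds almost surely at every point of a partition, so its sum weighted
    by [X] is exactly 0; associativity then replaces each weighted integral by a trapezoidal sum. *)
Lemma weighted_linearized_system (V : rfield) (X : R -> T -> R) (a : 'I_m) :
  first_variation P W L0 L Lt H Ht z V -> CS X ->
  vanishing P (fun (nu : partitions t) w =>
    \sum_(b < m) (trap (fun s w => X s w * 'D_(V x s w) (curl L0 a b) (z x s w))
                    (fun s w => z x s w 0 b) nu w
                + trap (fun s w => X s w * curl L0 a b (z x s w)) (fun s w => V x s w 0 b) nu w)
    + trap (fun s w => X s w * \sum_(i < n) \sum_(b < m)
            ('D_(V x s w) (curl (L i) a b) (z x s w) * xder i z x s w 0 b
             + curl (L i) a b (z x s w) * xder i V x s w 0 b)) time nu w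
    + trap (fun s w => X s w * \sum_(i < n) \sum_(b < m)
            ('D_(V x s w) (curl (Lt i) a b) (z x s w) * xder i z x s w 0 b
             + curl (Lt i) a b (z x s w) * xder i V x s w 0 b)) W nu w
    - trap (fun s w => X s w * 'D_(V x s w) (partial a H) (z x s w)) time nu w
    - trap (fun s w => X s w * 'D_(V x s w) (partial a Ht) (z x s w)) W nu w).
Proof.
move=> [[_ rV] lV] sX.
have alg (S S' a1 a2 a3 a4 b1 b2 b3 b4 : R) : S + a1 + a2 - a3 - a4 = 0 ->
    - (S - S' + (a1 - b1) + (a2 - b2) - (a3 - b3) - (a4 - b4)) = S' + b1 + b2 - b3 - b4.
  by move=> h; apply/eqP; rewrite -subr_eq0 -[in eqbRHS]oppr0 -[in eqbRHS]h; apply/eqP; ring.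
have [_ rz] := hz.
have sz c : CS (fun s w => z x s w 0 c) by have [] := rz x c.
have szx i c : CS (fun s w => xder i z x s w 0 c) by have [_] := rz x c; exact.
have sV c : CS (fun s w => V x s w 0 c) by have [] := rV x c.
have sVx i c : CS (fun s w => xder i V x s w 0 c) by have [_] := rV x c; exact.
have sD g : smooth g -> CS (fun s w => 'D_(V x s w) g (z x s w)).
  by move=> sg; exact: continuous_semimartingale_derive.
have sC g : smooth g -> CS (fun s w => g (z x s w)).
  by move=> sg; exact: continuous_semimartingale_comp.
set DM := fun b s w => 'D_(V x s w) (curl L0 a b) (z x s w).
set MM := fun b s w => curl L0 a b (z x s w).
set FK := fun s w => \sum_(i < n) \sum_(b < m)
            ('D_(V x s w) (curl (L i) a b) (z x s w) * xder i z x s w 0 b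
             + curl (L i) a b (z x s w) * xder i V x s w 0 b).
set FKt := fun s w => \sum_(i < n) \sum_(b < m)
            ('D_(V x s w) (curl (Lt i) a b) (z x s w) * xder i z x s w 0 b
             + curl (Lt i) a b (z x s w) * xder i V x s w 0 b).
set DH := fun s w => 'D_(V x s w) (partial a H) (z x s w).
set DHt := fun s w => 'D_(V x s w) (partial a Ht) (z x s w).
have sDM b : CS (DM b) by apply: sD; exact: smooth_curl.
have sMM b : CS (MM b) by apply: sC; exact: smooth_curl.
have sF (K : 'I_n -> 'I_m -> 'rV[R]_m -> R) : (forall i a, smooth (K i a)) ->
    CS (fun s w => \sum_(i < n) \sum_(b < m)
            ('D_(V x s w) (curl (K i) a b) (z x s w) * xder i z x s w 0 b
             + curl (K i) a b (z x s w) * xder i V x s w 0 b)).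
  move=> sK; apply: continuous_semimartingale_sum => // i.
  apply: continuous_semimartingale_sum => // b; apply: continuous_semimartingaleD => //.
    by apply: continuous_semimartingaleM => //; apply: sD; exact: smooth_curl.
  by apply: continuous_semimartingaleM => //; apply: sC; exact: smooth_curl.
have sFK : CS FK by exact: sF.
have sFKt : CS FKt by exact: sF.
have sDH : CS DH by apply: sD; exact: smooth_partial.
have sDHt : CS DHt by apply: sD; exact: smooth_partial.
(* One choice of the integrals for all upper limits; the zeros at negative times are
   placeholders. *)
have /choice[Q HQ] : forall s : R, exists Q : ('I_m -> T -> R) * ('I_m -> T -> R) * (T -> R) * (T -> R),
    0 <= s -> [/\ forall b, stratonovich P (DM b) (fun s w => z x s w 0 b) s (Q.1.1.1 b),
      forall b, stratonovich P (MM b) (fun s w => V x s w 0 b) s (Q.1.1.2 b),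
      stratonovich P FKt W s Q.1.2, stratonovich P DHt W s Q.2 &
      {ae P, forall w, \sum_(b < m) (Q.1.1.1 b w + Q.1.1.2 b w) + time_integral FK s w + Q.1.2 w
        = time_integral DH s w + Q.2 w}].
  move=> s; have [s0|ns] := pselect (0 <= s); last by exists (fun=> 0, fun=> 0, cst 0, cst 0) => /ns.
  have [I [I' [J [JH h]]]] := lV x a s s0.
  by exists (I, I', J, JH) => _.
pose I b s := (Q s).1.1.1 b; pose I' b s := (Q s).1.1.2 b.
pose J s := (Q s).1.2; pose JH s := (Q s).2.
have assoc F Y Z : CS F -> CS Y -> (forall s : R, 0 <= s <= t -> stratonovich P F Y s (Z s)) ->
    vanishing P (fun (nu : partitions t) w =>
      weighted X Z nu w - trap (fun s w => X s w * F s w) Y nu w).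
  by move=> sF' sY hZ; exact: (stratonovich_assoc mW t0 sX sF' sY hZ).
have aI b : vanishing P (fun (nu : partitions t) w => weighted X (I b) nu w
    - trap (fun s w => X s w * DM b s w) (fun s w => z x s w 0 b) nu w).
  by apply: assoc => // s /andP[s0 _]; have [] := HQ s s0.
have aI' b : vanishing P (fun (nu : partitions t) w => weighted X (I' b) nu w
    - trap (fun s w => X s w * MM b s w) (fun s w => V x s w 0 b) nu w).
  by apply: assoc => // s /andP[s0 _]; have [] := HQ s s0.
have aJ : vanishing P (fun (nu : partitions t) w => weighted X J nu w
    - trap (fun s w => X s w * FKt s w) W nu w).
  by apply: assoc => // s /andP[s0 _]; have [] := HQ s s0.
have aJH : vanishing P (fun (nu : partitions t) w => weighted X JH nu w
    - trap (fun s w => X s w * DHt s w) W nu w).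
  by apply: assoc => // s /andP[s0 _]; have [] := HQ s s0.
have aT F : CS F -> vanishing P (fun (nu : partitions t) w => weighted X (time_integral F) nu w
    - trap (fun s w => X s w * F s w) time nu w).
  move=> sF'; apply: assoc => // s /andP[s0 _]; exact: (time_integral_stratonovich mW).
have h1 := vanishing_sum (index_enum 'I_m) (fun b => vanishingD (aI b) (aI' b)).
have h2 := vanishingB (vanishingB (vanishingD (vanishingD h1 (aT _ sFK)) aJ) (aT _ sDH)) aJH.
apply: vanishing_ae (vanishingN h2) => nu.
(* The null set of the system depends on the time, but a partition has only countably many
   points. *)
have hE : {ae P, forall w, forall k, \sum_(b < m) (I b (pt t (psq nu) k) w + I' b (pt t (psq nu) k) w)
    + time_integral FK (pt t (psq nu) k) w + J (pt t (psq nu) k) w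
    - time_integral DH (pt t (psq nu) k) w - JH (pt t (psq nu) k) w = 0}.
  apply: ae_foralln => k.
  have p0 : 0 <= pt t (psq nu) k by apply: pt_ge0; exact: psqP.
  have [_ _ _ _] := HQ _ p0; apply: filterS => w hw.
  by apply/eqP; rewrite -addrA -opprD subr_eq0; apply/eqP.
apply: filterS hE => w hE.
have E0 : \sum_(b < m) (weighted X (I b) nu w + weighted X (I' b) nu w)
    + weighted X (time_integral FK) nu w + weighted X J nu w
    - weighted X (time_integral DH) nu w - weighted X JH nu w = 0.
  transitivity (weighted X (fun s w => \sum_(b < m) (I b s w + I' b s w)
    + time_integral FK s w + J s w - time_integral DH s w - JH s w) nu w); last exact: weighted_eq0.
  rewrite !weightedB !weightedD weighted_sum; congr (_ + _ + _ - _ - _).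
  by apply: eq_bigr => b _; rewrite weightedD.
have -> : \sum_i (weighted X (I i) nu w
      - trap (fun s w => X s w * DM i s w) (fun s w => z x s w 0 i) nu w
      + (weighted X (I' i) nu w
      - trap (fun s w => X s w * MM i s w) (fun s w => V x s w 0 i) nu w))
    = \sum_(b < m) (weighted X (I b) nu w + weighted X (I' b) nu w)
    - \sum_(b < m) (trap (fun s w => X s w * DM b s w) (fun s w => z x s w 0 b) nu w
      + trap (fun s w => X s w * MM b s w) (fun s w => V x s w 0 b) nu w).
  by rewrite -sumrB; apply: eq_bigr => b _; rewrite opprD addrACA.
exact: alg E0.
Qed.

Lemma continuous_semimartingale_flux (K : 'I_n -> 'I_m -> 'rV[R]_m -> R)
    (Z U V : R -> T -> 'rV[R]_m) (Zx Ux Vx : 'I_n -> R -> T -> 'rV[R]_m) :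
  (forall i a, smooth (K i a)) ->
  (forall c, CS (fun s w => Z s w 0 c)) -> (forall c, CS (fun s w => U s w 0 c)) ->
  (forall c, CS (fun s w => V s w 0 c)) -> (forall i c, CS (fun s w => Zx i s w 0 c)) ->
  (forall i c, CS (fun s w => Ux i s w 0 c)) -> (forall i c, CS (fun s w => Vx i s w 0 c)) ->
  CS (fun s w => \sum_(i < n) curl_flux Z U V Zx Ux Vx (K i) i s w).
Proof.
move=> sK sZ sU sV sZx sUx sVx.
have sC i a b : CS (fun s w => curl (K i) a b (Z s w)).
  by apply: continuous_semimartingale_comp => //; exact: smooth_curl.
apply: continuous_semimartingale_sum => // i; apply: continuous_semimartingale_sum => // a.
apply: continuous_semimartingale_sum => // b.
have sD : CS (fun s w => 'D_(Zx i s w) (curl (K i) a b) (Z s w)).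
  by apply: continuous_semimartingale_derive => //; exact: smooth_curl.
by do 2?apply: continuous_semimartingaleD => //; do 2!apply: continuous_semimartingaleM => //.
Qed.

(** Differentiability in the space variable fails only on a null set common to all times, so the
    identity holds simultaneously at all s >= 0 and may be used under a time integral. *)
Lemma xder_along (K : 'I_n -> 'I_m -> 'rV[R]_m -> R) (U V : rfield) :
  (forall i a, smooth (K i a)) -> regular_field P W U -> regular_field P W V ->
  {ae P, forall w, forall s : R, 0 <= s ->
    \sum_(i < n) xder i (along (half_curl_form (K i)) z U V) x s w
    = \sum_(i < n) curl_flux (fun s w => z x s w) (fun s w => U x s w) (fun s w => V x s w)
        (fun i s w => xder i z x s w) (fun i s w => xder i U x s w)
        (fun i s w => xder i V x s w) (K i) i s w}.
Proof.
move=> sK [dU _] [dV _]; have [dz _] := hz.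
apply: ae2 (ae2 _ dz dU) dV => [w|w h1 h2]; last by exact: (conj h1 h2).
move=> [hz' hU] hV s s0; apply: eq_bigr => i _.
by apply: derive_curl_along => //; [exact: hz'|exact: hU|exact: hV].
Qed.

Lemma vanishing_structural_law (U V : rfield) :
  first_variation P W L0 L Lt H Ht z U -> first_variation P W L0 L Lt H Ht z V ->
  vanishing P (fun (nu : partitions t) w =>
    (along (half_curl_form L0) z U V x t w - along (half_curl_form L0) z U V x 0 w)
    + time_integral (fun s w => \sum_(i < n) xder i (along (half_curl_form (L i)) z U V) x s w) t w
    + trap (fun s w => \sum_(i < n) xder i (along (half_curl_form (Lt i)) z U V) x s w) W nu w).
Proof.
move=> fU fV.
(* [S] collects the sums against z, U and V, common to the contracted systems and the chain rule;
   [p] and [q] are the flux sums against time and [W], [c] is the time integral that replaces [p],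
   and A - B is the increment of omega. *)
have alg (S p q A B c : R) : S + p + q + (A - B - S) - (p - c) = A - B + c + q by ring.
have [rU _] := fU; have [rV _] := fV.
have [_ rz] := hz; have [_ rU'] := rU; have [_ rV'] := rV.
have sz c : CS (fun s w => z x s w 0 c) by have [] := rz x c.
have szx i c : CS (fun s w => xder i z x s w 0 c) by have [_] := rz x c; exact.
have sU c : CS (fun s w => U x s w 0 c) by have [] := rU' x c.
have sUx i c : CS (fun s w => xder i U x s w 0 c) by have [_] := rU' x c; exact.
have sV c : CS (fun s w => V x s w 0 c) by have [] := rV' x c.
have sVx i c : CS (fun s w => xder i V x s w 0 c) by have [_] := rV' x c; exact.
pose z' s w := z x s w; pose u s w := U x s w; pose v s w := V x s w.
pose zx i s w := xder i z x s w; pose ux i s w := xder i U x s w; pose vx i s w := xder i V x s w.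
pose kap s w := \sum_(i < n) curl_flux z' u v zx ux vx (L i) i s w.
pose kapt s w := \sum_(i < n) curl_flux z' u v zx ux vx (Lt i) i s w.
have skap : CS kap.
  exact: (@continuous_semimartingale_flux L z' u v zx ux vx sL sz sU sV szx sUx sVx).
pose M a b s w := curl L0 a b (z' s w).
have sM a b : CS (M a b) by apply: continuous_semimartingale_comp => //; exact: smooth_curl.
have tot := vanishing_sum (index_enum 'I_m) (fun a =>
  vanishingB (weighted_linearized_system a fV (sU a)) (weighted_linearized_system a fU (sV a))).
have chain a b : vanishing P (fun (nu : partitions t) w =>
    M a b t w * (u t w 0 a * v t w 0 b) - M a b 0 w * (u 0 w 0 a * v 0 w 0 b)
    - (\sum_(c < m) trap (fun s w => u s w 0 a * v s w 0 b * partial c (curl L0 a b) (z' s w))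
         (fun s w => z' s w 0 c) nu w
      + trap (fun s w => u s w 0 a * M a b s w) (fun s w => v s w 0 b) nu w
      + trap (fun s w => M a b s w * v s w 0 b) (fun s w => u s w 0 a) nu w)).
  have suv : CS (fun s w => u s w 0 a * v s w 0 b) by exact: continuous_semimartingaleM.
  have h1 := vanishing_product_rule mW t0 (sM a b) (sU a) (sV b).
  have h2 := vanishing_chain_rule mW t0 sz (smooth_curl a b sL0) suv.
  apply: vanishing_eq (vanishingD h1 h2) => nu w.
  rewrite (trap_eq (X := fun s w => M a b s w * U x s w 0 a) (X' := fun s w => u s w 0 a * M a b s w));
    last by move=> s _; rewrite mulrC.
  rewrite -/(M a b) -/u -/v -/z'.
  move: (\sum_(c < m) _) => S.
  move: (trap _ (M a b) nu w) => q.
  move: (trap (fun s w => u s w 0 a * M a b s w) _ nu w) => p.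
  move: (trap (fun s w => M a b s w * v s w 0 b) _ nu w) => r.
  ring.
have ctot := vanishing_sum (index_enum 'I_m) (fun a => vanishing_sum (index_enum 'I_m) (chain a)).
have time_part := time_integral_trapezoid mW skap t0.
apply: vanishing_ae (vanishingB (vanishingD tot ctot) time_part) => nu.
apply: ae2 (xder_along sL rU rV) (xder_along sLt rU rV) => w hK hKt.
have -> : time_integral (fun s w => \sum_(i < n) xder i (along (half_curl_form (L i)) z U V) x s w) t w
    = time_integral kap t w.
  apply: eq_Rintegral => s; rewrite inE/= in_itv/= => /andP[s0 _]; exact: hK.
have -> : trap (fun s w => \sum_(i < n) xder i (along (half_curl_form (Lt i)) z U V) x s w) W nu w
    = trap kapt W nu w by apply: trap_eq => s s0; exact: hKt.
have E := @trap_antisymmetrized_system _ _ _ _ _ _ z' u v zx ux vx L0 L Lt H Ht time W nu w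
  sL0 sL sLt sH sHt.
rewrite [X in X + _ - _]E /along !half_curl_formE.
under [X in _ + X - _]eq_bigr do rewrite sumrB.
rewrite sumrB.
have Ms (s : R) : \sum_(a < m) \sum_(b < m) curl L0 a b (z x s w) * U x s w 0 a * V x s w 0 b
    = \sum_(a < m) \sum_(b < m) M a b s w * (u s w 0 a * v s w 0 b).
  by apply: eq_bigr => a _; apply: eq_bigr => b _; rewrite mulrA.
rewrite !Ms; under [X in _ + (X - _) - _]eq_bigr do rewrite sumrB.
rewrite sumrB -/kap -/kapt.
exact: alg.
Qed.

End ConservationLaw.

Theorem mainTheorem2 (R : realType) (d : measure_display)
    (T : measurableType d) (P : probability T R) (W : R -> T -> R)
    (n m : nat) (L0 : 'I_m -> 'rV[R]_m -> R)
    (L Lt : 'I_n -> 'I_m -> 'rV[R]_m -> R) (H Ht : 'rV[R]_m -> R)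
    (hW : brownian P W)
    (hL0 : forall a, smooth (L0 a))
    (hL : forall i a, smooth (L i a))
    (hLt : forall i a, smooth (Lt i a))
    (hH : smooth H) (hHt : smooth Ht)
    (z : 'rV[R]_n -> R -> T -> 'rV[R]_m)
    (hz : regular_field P W z)
    (hsol : solution P W L0 L Lt H Ht z) :
  [/\ structural_law P W L0 L Lt H Ht z (extd1 (oneform L0))
        (fun i => extd1 (oneform (L i))) (fun i => extd1 (oneform (Lt i))),
      extd1 (oneform L0) = half_curl_form L0,
      forall i, extd1 (oneform (L i)) = half_curl_form (L i),
      forall i, extd1 (oneform (Lt i)) = half_curl_form (Lt i) &
      structural_law P W L0 L Lt H Ht z (half_curl_form L0)
        (fun i => half_curl_form (L i)) (fun i => half_curl_form (Lt i))].
Proof.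
have E0 := extd1_oneform hL0.
have E i := extd1_oneform (hL i).
have Et i := extd1_oneform (hLt i).
have law : structural_law P W L0 L Lt H Ht z (half_curl_form L0)
    (fun i => half_curl_form (L i)) (fun i => half_curl_form (Lt i)).
  move=> U V fU fV x t t0.
  have h := vanishing_structural_law hW hL0 hL hLt hH hHt hz x t0 fU fV.
  (* The law determines the integral against [W]; that [J] is this integral is what the vanishing of
     the trapezoidal sums says. *)
  pose J w := - ((along (half_curl_form L0) z U V x t w - along (half_curl_form L0) z U V x 0 w)
    + time_integral (fun s w => \sum_(i < n) xder i (along (half_curl_form (L i)) z U V) x s w) t w).
  exists J; last by apply: aeW => w; rewrite /J subrr.
  apply: small_stratonovich => //; apply: vanishing_eq h => nu w.
  by rewrite /J opprK addrC.
split; [|exact: E0|exact: E|exact: Et|exact: law].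
rewrite E0 (_ : (fun i => extd1 (oneform (L i))) = fun i => half_curl_form (L i)); last exact/funext.
by rewrite (_ : (fun i => extd1 (oneform (Lt i))) = fun i => half_curl_form (Lt i)); last exact/funext.
Qed.
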